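(* Let $L_z\ge H$. Discretize the $t$-integrals in the definition of $U_{\text{Fourier}}$ by the trapezoidal rule with mesh size $\pi/(\alpha L_z)$. Then $$U_{\text{Fourier}}=\frac{2\pi}{L_xL_yL_z}\sum_{\boldsymbol k\neq \boldsymbol 0}\frac{e^{-k^2/(4\alpha^2)}}{k^2}\left|\sum_{i=1}^N q_i e^{\mathrm i\boldsymbol k\cdot\boldsymbol r_i}\right|^2-\frac{\alpha}{\sqrt\pi}\sum_{i=1}^N q_i^2+U_{\text{IBC}}+U_{\text{ELC}}+U_{\text{err}},$$ where $\boldsymbol k=2\pi(n_x/L_x,n_y/L_y,n_z/L_z)$ with $(n_x,n_y,n_z)\in\mathbb Z^3\setminus\{\boldsymbol 0\}$, $k=|\boldsymbol k|$, $$U_{\text{IBC}}:=\frac{2\pi}{L_xL_yL_z}\left(\sum_{i=1}^N q_iz_i\right)^2,\qquad U_{\text{ELC}}:=\frac{2\pi}{L_xL_y}\sum_{i,j=1}^N q_iq_j\sum_{\boldsymbol h\ne\boldsymbol 0}\frac{e^{\mathrm i\boldsymbol h\cdot\boldsymbol r_{ij}}}{h}\,\frac{\cosh(hz_{ij})}{1-e^{hL_z}},$$ and $U_{\text{err}}$ is the remainder error term due to the trapezoidal discretization. Moreover, $$|U_{\text{ELC}}|=\mathcal O\!\left(e^{-\frac{2\pi(L_z-H)}{\max\{L_x,L_y\}}}\right)\quad\text{and}\quad |U_{\text{err}}|=\mathcal O\!\left(e^{-\alpha^2(L_z-H)^2}\right).$$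
   Context: Setting: $L_x,L_y,H,\alpha>0$. There are $N$ point charges $q_1,\dots,q_N\in\mathbb R$ at positions $\boldsymbol r_i=(x_i,y_i,z_i)$ inside the box $[0,L_x]\times[0,L_y]\times[0,H]$ (so $0<z_i<H$), doubly periodic in $x,y$ with periods $L_x,L_y$ and free in $z$. Charge neutrality is assumed: $\sum_{i=1}^N q_i=0$. Write $\boldsymbol r_{ij}=\boldsymbol r_i-\boldsymbol r_j$ and $z_{ij}=z_i-z_j$. The vectors $\boldsymbol h=2\pi(n_x/L_x,n_y/L_y,0)$ with $(n_x,n_y)\in\mathbb Z^2$ are the two-dimensional reciprocal lattice vectors, and $h=|\boldsymbol h|$. $U_{\text{Fourier}}$ is the reciprocal-space part of the Ewald2D sum (Ewald splitting parameter $\alpha$), written in integral form: $$U_{\text{Fourier}}=\frac{1}{2\alpha L_xL_y}\sum_{i,j=1}^N q_iq_j\sum_{\boldsymbol h\neq\boldsymbol 0}e^{\mathrm i\boldsymbol h\cdot\boldsymbol r_{ij}}\int_{-\infty}^\infty\frac{e^{-\frac{h^2}{4\alpha^2}-t^2}}{\frac{h^2}{4\alpha^2}+t^2}e^{2\mathrm i\alpha z_{ij}t}\,dt-\frac{\alpha}{\sqrt\pi}\sum_{i=1}^Nq_i^2+\mathcal J_0,$$ $$\mathcal J_0=\frac{1}{2\alpha L_xL_y}\sum_{i,j=1}^N q_iq_j\int_{-\infty}^\infty\frac{e^{-t^2}e^{2\mathrm i\alpha z_{ij}t}-1}{t^2}\,dt .$$ The integral in $\mathcal J_0$ is understood as a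 principal value at $t=0$ (equivalently, one first sums over $i,j$, after which the integrand extends continuously to $t=0$ by neutrality); it equals $\mathcal J_0=\frac{-\pi}{L_xL_y}\sum_{i,j}q_iq_j\big[z_{ij}\,\mathrm{erf}(\alpha z_{ij})+\frac{1}{\alpha\sqrt\pi}e^{-\alpha^2z_{ij}^2}\big]$. The remainder $U_{\text{err}}$ is what is left when the displayed explicit terms are subtracted from $U_{\text{Fourier}}$. The $\mathcal O(\cdot)$ estimates describe decay as $L_z$ grows, with the particle configuration and all other parameters ($\alpha$, $L_x$, $L_y$, $H$, $N$, $q_i$) fixed. *)

(* Defs.v *)
From HB Require Import structures.
From mathcomp Require Import all_boot all_order all_algebra.
From mathcomp Require Import all_classical all_reals all_analysis.
From mathcomp.analysis.showcase Require summability.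
From mathcomp.real_closed Require Export complex.

Set Implicit Arguments.
Unset Strict Implicit.
Unset Printing Implicit Defensive.

Import Order.TTheory GRing.Theory Num.Theory.
Import numFieldNormedType.Exports.

Local Open Scope classical_set_scope.
Local Open Scope ring_scope.
Local Open Scope complex_scope.

(* Needed by the notation f =O_+oo g. *)
Canonical pinfty_filter_on (R : numFieldType) : filter_on R :=
  FilterType (pinfty_nbhs R) _.

Section complex_analysis.
Context {R : realType}.
Implicit Types (f : R -> R[i]) (D : set R).

Definition cosh (x : R) : R := (expR x + expR (- x)) / 2.

(* e^{i x} for real x *)
Definition expi (x : R) : R[i] := cos x +i* sin x.

Definition Cintegral D f : R[i] :=
  (\int[lebesgue_measure]_(t in D) complex.Re (f t)) +i*
  (\int[lebesgue_measure]_(t in D) complex.Im (f t)).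

(* Principal value at 0 of the integral of f over the real line; R[i]^o gives
   access to the topology of R[i]. *)
Definition pv_integral f : R[i] :=
  lim ((Cintegral [set t | e <= `|t|] f : R[i]^o) @[e --> 0^'+]).

(* Unordered sum (limit of the finite partial sums) over the nonzero elements
   of a lattice. *)
Definition sum_neq0 (I : zmodType) (F : I -> R[i]) : R[i] :=
  summability.sum (fun n : I => (if n == 0 then 0 else F n) : R[i]^o).

(* Trapezoidal rule on the real line with mesh size d. *)
Definition trapezoidal (d : R) f : R[i] :=
  d%:C * summability.sum (fun n : int => f (d * n%:~R) : R[i]^o).

(* f with its value at 0 replaced by its limit there *)
Definition extend0 f (t : R) : R[i] :=
  if t == 0 then lim ((f s : R[i]^o) @[s --> 0^']) else f t.

End complex_analysis.

Section vectors.
Context {R : realType}.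
Implicit Types u v : 'rV[R]_3.

Definition dot u v : R := \sum_(i < 3) u 0 i * v 0 i.

(* Euclidean norm; `|u| would be the sup norm. *)
Definition enorm u : R := Num.sqrt (dot u u).

Definition vec3 (a b c : R) : 'rV[R]_3 := \row_(i < 3) [:: a; b; c]`_i.

Definition xcoord u : R := u 0 0.
Definition ycoord u : R := u 0 1.
Definition zcoord u : R := u 0 2%:R.

End vectors.

Section ewald.
Context {R : realType}.
Variables (Lx Ly alpha : R) (N : nat) (q : 'I_N -> R) (r : 'I_N -> 'rV[R]_3).

Definition hvec (n : int * int) : 'rV[R]_3 :=
  (2 * pi) *: vec3 (n.1%:~R / Lx) (n.2%:~R / Ly) 0.

Definition kvec (Lz : R) (n : int * int * int) : 'rV[R]_3 :=
  (2 * pi) *: vec3 (n.1.1%:~R / Lx) (n.1.2%:~R / Ly) (n.2%:~R / Lz).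

Definition zdiff (i j : 'I_N) : R := zcoord (r i - r j).

(* The integrand of the term of U_Fourier with reciprocal vector h != 0, where
   h is the length of the vector and z = z_ij. *)
Definition Fourier_integrand (h z t : R) : R[i] :=
  (expR (- (h ^+ 2 / (4 * alpha ^+ 2)) - t ^+ 2)
     / (h ^+ 2 / (4 * alpha ^+ 2) + t ^+ 2))%:C * expi (2 * alpha * z * t).

Definition J0_integrand (z t : R) : R[i] :=
  ((expR (- t ^+ 2))%:C * expi (2 * alpha * z * t) - 1) / (t ^+ 2)%:C.

(* The h != 0 part of U_Fourier, with the integrals over t evaluated by the
   functional Q: the exact integral or a quadrature rule. *)
Definition Fourier_neq0 (Q : (R -> R[i]) -> R[i]) : R[i] :=
  (2 * alpha * Lx * Ly)^-1%:C *
  \sum_i \sum_j (q i * q j)%:C *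
    sum_neq0 (fun n : int * int =>
      expi (dot (hvec n) (r i - r j)) *
      Q (Fourier_integrand (enorm (hvec n)) (zdiff i j))).

Definition U_self : R := alpha / Num.sqrt pi * \sum_i q i ^+ 2.

Definition J0 : R[i] :=
  (2 * alpha * Lx * Ly)^-1%:C *
  \sum_i \sum_j (q i * q j)%:C * pv_integral (J0_integrand (zdiff i j)).

Definition U_Fourier : R[i] :=
  Fourier_neq0 (Cintegral setT) - U_self%:C + J0.

Definition trapezoidal_mesh (Lz : R) : R := pi / (alpha * Lz).

(* The integrands of J0 are individually singular at the node t = 0: they are
   summed over i, j first and extended continuously to t = 0. *)
Definition J0_trapezoidal (Lz : R) : R[i] :=
  (2 * alpha * Lx * Ly)^-1%:C *
  trapezoidal (trapezoidal_mesh Lz)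
    (extend0 (fun t =>
       \sum_i \sum_j (q i * q j)%:C * J0_integrand (zdiff i j) t)).

Definition U_Fourier_trapezoidal (Lz : R) : R[i] :=
  Fourier_neq0 (trapezoidal (trapezoidal_mesh Lz)) - U_self%:C
  + J0_trapezoidal Lz.

Definition U_Ewald3D (Lz : R) : R[i] :=
  (2 * pi / (Lx * Ly * Lz))%:C *
  sum_neq0 (fun n : int * int * int =>
    let k := kvec Lz n in
    (expR (- (enorm k ^+ 2 / (4 * alpha ^+ 2))) / enorm k ^+ 2)%:C *
    `|\sum_i (q i)%:C * expi (dot k (r i))| ^+ 2).

Definition U_IBC (Lz : R) : R :=
  2 * pi / (Lx * Ly * Lz) * (\sum_i q i * zcoord (r i)) ^+ 2.

Definition U_ELC (Lz : R) : R[i] :=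
  (2 * pi / (Lx * Ly))%:C *
  \sum_i \sum_j (q i * q j)%:C *
    sum_neq0 (fun n : int * int =>
      let h := enorm (hvec n) in
      expi (dot (hvec n) (r i - r j)) / h%:C *
      (cosh (h * zdiff i j) / (1 - expR (h * Lz)))%:C).

End ewald.

(* Main.v *)
(** Write [a = h / (2 alpha)] and [L = alpha Lz].  By Poisson summation, the
    trapezoidal rule of mesh [pi / L] for the kernel
    [e^(-a^2 - t^2) / (a^2 + t^2) * cos (2 z t)] adds to the exact integral
    the Fourier transform [F_a] of the kernel at the frequencies
    [k L +- z], [k >= 1].  Since [1 / (a^2 + t^2)] is the transform of
    [e^(-2 a |u|)], [F_a] is the convolution of a Gaussian with that function, and
    [F_a w = pi / a * e^(-2 a w) + O(e^(-2 a) e^(-w^2))] uniformly in [a].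
    The exponentials sum to a geometric series, which is the ELC term, and the
    remainders to [O(e^(-2 a) e^(-(L - alpha H)^2))], which is summable over [h].

    The mode [h = 0] is the limit [a -> 0] of the same estimate, taken at [z]
    minus at [0]: by neutrality only these differences matter.

    On the other hand the nodes of the trapezoidal rules for the vectors [h] are
    the wave vectors [k], so the discretized energy is the Ewald3D sum, and
    the node [k = 0], where the integrand of [J0] is extended by its limit
    [4 alpha^2 (\sum_i q_i z_i)^2], gives [U_IBC]. *)

Require Import Defs.
From mathcomp Require Import all_boot all_order all_algebra finmap ring lra.
From mathcomp Require Import all_classical all_reals all_analysis.
From mathcomp Require Import measurable_realfun.
From mathcomp.real_closed Require Import complex.

Set Implicit Arguments.
Unset Strict Implicit.
Unset Printing Implicit Defensive.

Import Order.TTheory GRing.Theory Num.Theory.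
Import numFieldNormedType.Exports.

Local Open Scope classical_set_scope.
Local Open Scope ring_scope.

(* The estimate of [F_a] must be uniform for large [a], where the errors have to be summable over
   [h], and for [a -> 0], where the convolution formula carries a factor [1 / a]. One pointwise
   bound serves both ends: replacing [e^(-2 a |u|)] by [e^(-2 a u)] against a Gaussian centred at
   [w] costs, at distance [v] from 0, a factor [e^(2 a v) - e^(-2 a v) <= 4 a v e^(2 a v)], whose
   [a] cancels [1 / a], and [(a - v - 1)^2 >= 0] yields the decay [e^(-2 a)]. This asks for
   [w >= 2], so the error estimates start at [alpha (Lz - H) >= 2].

   Poisson summation is needed only for a Lipschitz function dominated by [1 / (1 + t^2)] whose
   Fourier partial sums converge to a known limit. Cesaro means replace the Dirichlet kernel by the
   nonnegative Fejer kernel, and dominated convergence is then enough.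

   Sums and principal values are limits given by a total function, so no identity between them can
   be proved before their convergence: this is why bounds on absolute sums accompany every lattice
   sum. *)
#[local] Existing Instance summability.totally_filter.

(** * Unordered sums *)

Section unordered_sums.
Context {R : realType}.

(* [summability.sum] is a [lim]; [has_sum F s] also asserts that this limit exists. *)
Definition has_sum (I : choiceType) (F : I -> R) (s : R) : Prop :=
  summability.partial_sum F B @[B --> summability.totally] --> s.

(** For real families, unordered convergence is absolute convergence. The bound [M] is kept explicit
    so that it can be followed through the dependence on [Lz]. *)
Definition abs_bounded (I : choiceType) (F : I -> R) (M : R) : Prop :=
  forall B : {fset I}, \sum_(i <- B) `|F i| <= M.

Lemma partial_sumE (V : zmodType) (I : choiceType) (F : I -> V) (B : {fset I}) :
  summability.partial_sum F B = \sum_(i <- B) F i.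
Proof. by rewrite /summability.partial_sum big_seq_fsetE. Qed.

Lemma has_sumP (I : choiceType) (F : I -> R) (s : R) :
  has_sum F s <-> forall e : R, 0 < e -> exists A : {fset I},
    forall B : {fset I}, (A `<=` B)%fset -> `|s - \sum_(i <- B) F i| < e.
Proof.
rewrite /has_sum; split.
  move=> /cvgrPdist_lt FS e e0; have [A _ AB] := FS _ e0.
  by exists A => B /AB /=; rewrite partial_sumE.
move=> FS; apply/cvgrPdist_lt => e /FS [A AB].
by exists A => // B /AB /=; rewrite partial_sumE.
Qed.

Lemma cvg_le (T : Type) (F : set_system T) {FF : ProperFilter F} (f : T -> R)
    (l M : R) :
  f @ F --> l -> (\forall x \near F, f x <= M) -> l <= M.
Proof. by move=> fl fM; apply: (closed_cvg _ (@closed_le _ M) _ l fl). Qed.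

Lemma cvg_sumr (J T : Type) (r : seq J) (F : set_system T) {FF : Filter F}
    (f : J -> T -> R) (a : J -> R) :
  (forall j, f j @ F --> a j) ->
  (\sum_(j <- r) f j x) @[x --> F] --> \sum_(j <- r) a j.
Proof.
move=> fa; apply: (@cvg_big R J +%R 0 xpredT _ T F r f a) => //.
exact: add_continuous.
Qed.

Lemma has_sum_unique (I : choiceType) (F : I -> R) s t :
  has_sum F s -> has_sum F t -> s = t.
Proof. exact: cvg_unique. Qed.

Lemma eq_has_sum (I : choiceType) (F G : I -> R) s :
  F =1 G -> has_sum F s -> has_sum G s.
Proof. by move=> /funext ->. Qed.

Lemma has_sumD (I : choiceType) (F G : I -> R) s t :
  has_sum F s -> has_sum G t -> has_sum (fun i => F i + G i) (s + t).
Proof.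
move=> Fs Gt; rewrite /has_sum.
under eq_fun do rewrite partial_sumE big_split -!partial_sumE.
exact: cvgD.
Qed.

Lemma has_sumZ (I : choiceType) (F : I -> R) s c :
  has_sum F s -> has_sum (fun i => c * F i) (c * s).
Proof.
move=> Fs; rewrite /has_sum.
under eq_fun do rewrite partial_sumE -mulr_sumr -!partial_sumE.
by apply: cvgMr.
Qed.

Lemma has_sumN (I : choiceType) (F : I -> R) s :
  has_sum F s -> has_sum (fun i => - F i) (- s).
Proof.
by move=> /(has_sumZ (c := -1)); rewrite mulN1r; apply: eq_has_sum => i; rewrite mulN1r.
Qed.

Lemma has_sumB (I : choiceType) (F G : I -> R) s t :
  has_sum F s -> has_sum G t -> has_sum (fun i => F i - G i) (s - t).
Proof. by move=> Fs /has_sumN; exact: has_sumD. Qed.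

Lemma has_sum0 (I : choiceType) : has_sum (fun _ : I => 0) 0.
Proof.
rewrite /has_sum; under eq_fun do rewrite partial_sumE big1//.
exact: cvg_cst.
Qed.

Lemma has_sum_single (I : choiceType) (a : I) (c : R) :
  has_sum (fun i => if i == a then c else 0) c.
Proof.
apply/has_sumP => e e0; exists [fset a]%fset => B; rewrite fsub1set => aB.
rewrite (big_fsetD1 a)//= eqxx big1_fset ?addr0 ?subrr ?normr0//.
by move=> i; rewrite !inE => /andP[/negbTE ->].
Qed.

Lemma has_sum_le_bound (I : choiceType) (F : I -> R) s M :
  (forall B : {fset I}, \sum_(i <- B) F i <= M) -> has_sum F s -> s <= M.
Proof.
move=> FM Fs; apply: (cvg_le Fs).
by apply: nearW => B; rewrite partial_sumE.
Qed.

Lemma le_has_sum (I : choiceType) (F G : I -> R) s t :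
  (forall i, F i <= G i) -> has_sum F s -> has_sum G t -> s <= t.
Proof.
move=> FG Fs Gt; rewrite -subr_le0.
apply: has_sum_le_bound (has_sumB Fs Gt) => B.
by rewrite sumr_le0// => i _; rewrite subr_le0.
Qed.

Lemma sum_fset_subset (I : choiceType) (F : I -> R) (A B : {fset I}) :
  (forall i, 0 <= F i) -> (A `<=` B)%fset ->
  \sum_(i <- A) F i <= \sum_(i <- B) F i.
Proof.
move=> F0 AB; rewrite [leRHS](big_fsetID _ (mem A))/=.
have -> : [fset x in B | (mem A) x]%fset = A.
  apply/fsetP => x; rewrite !inE/=; apply/andb_idl => /(fsubsetP AB)//.
by rewrite lerDl sumr_ge0.
Qed.

Lemma has_sum_ge_partial (I : choiceType) (F : I -> R) s (A : {fset I}) :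
  (forall i, 0 <= F i) -> has_sum F s -> \sum_(i <- A) F i <= s.
Proof.
move=> F0 /has_sumP Fs; apply/ler_addgt0Pr => e /Fs[B AB].
have /AB : (B `<=` A `|` B)%fset by rewrite fsubsetUr.
have /(sum_fset_subset F0) : (A `<=` A `|` B)%fset by rewrite fsubsetUl.
by move=> h1; rewrite ltr_norml => /andP[h2 h3]; lra.
Qed.

Lemma ge0_bounded_has_sum (I : choiceType) (F : I -> R) M :
  (forall i, 0 <= F i) -> (forall B : {fset I}, \sum_(i <- B) F i <= M) ->
  exists s, has_sum F s.
Proof.
move=> F0 FM.
pose E := [set \sum_(i <- B) F i | B in [set: {fset I}]].
have Es : has_sup E.
  split; first by exists (\sum_(i <- fset0) F i); exists fset0.
  by exists M => _ [B _ <-].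
exists (sup E); apply/has_sumP => e e0.
have [_ [A _ <-] Ae] := sup_adherent e0 Es.
exists A => B AB.
have h1 := sum_fset_subset F0 AB.
have h2 : \sum_(i <- B) F i <= sup E by apply: ub_le_sup; [exact: Es.2|exists B].
by rewrite ger0_norm; lra.
Qed.

(** [F] is the difference of the nonnegative families [F + |F|] and [|F|], whose finite sums are
    bounded. *)
Lemma abs_bounded_has_sum (I : choiceType) (F : I -> R) M :
  abs_bounded F M -> exists s, has_sum F s /\ `|s| <= M.
Proof.
move=> FM.
have [t tE] : exists t, has_sum (fun i => `|F i|) t.
  exact: (@ge0_bounded_has_sum _ _ M).
have [u uE] : exists t, has_sum (fun i => F i + `|F i|) t.
  apply: (@ge0_bounded_has_sum _ _ (M + M)) => [i|B].
    by have := ler_norm (- F i); rewrite normrN; lra.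
  rewrite big_split/= lerD//; apply: le_trans (FM B).
  by apply: ler_sum => i _; exact: ler_norm.
have FS : has_sum F (u - t).
  by have := has_sumB uE tE; apply: eq_has_sum => i; rewrite addrK.
exists (u - t); split => //.
have h1 := le_has_sum (fun i => ler_norm (F i)) FS tE.
have h2 : - (u - t) <= t.
  by apply: le_has_sum (has_sumN FS) tE => i; rewrite -normrN ler_norm.
have h3 : t <= M := has_sum_le_bound FM tE.
by rewrite ler_norml; lra.
Qed.

Lemma abs_bounded_le (I : choiceType) (F G : I -> R) M :
  (forall i, `|F i| <= `|G i|) -> abs_bounded G M -> abs_bounded F M.
Proof. by move=> FG GM B; apply: le_trans (GM B); apply: ler_sum. Qed.

Lemma abs_boundedZ (I : choiceType) (F : I -> R) c M :
  abs_bounded F M -> abs_bounded (fun i => c * F i) (`|c| * M).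
Proof.
move=> FM B; under eq_bigr do rewrite normrM.
by rewrite -mulr_sumr ler_wpM2l.
Qed.

Lemma has_sum_abs_bounded (I : choiceType) (G : I -> R) t :
  (forall i, 0 <= G i) -> has_sum G t -> abs_bounded G t.
Proof.
move=> G0 Gt B; under eq_bigr do rewrite ger0_norm//.
exact: has_sum_ge_partial.
Qed.

(** One finite set [A] serves all families dominated by [G]; this order of the quantifiers is what
    [tannery] relies on. *)
Lemma has_sum_tail (I : choiceType) (G : I -> R) M :
  (forall i, 0 <= G i) -> abs_bounded G M ->
  forall e, 0 < e -> exists A : {fset I}, forall F s,
    (forall i, `|F i| <= G i) -> has_sum F s ->
    `|s - \sum_(i <- A) F i| <= e.
Proof.
move=> G0 GM e e0.
have [t Gt] : exists t, has_sum G t.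
  apply: (ge0_bounded_has_sum (M := M)) => // B.
  by have := GM B; under eq_bigr do rewrite ger0_norm//.
have /has_sumP/(_ e e0)[A AB] := Gt.
exists A => F s FG Fs.
apply/ler_addgt0Pr => d d0.
have /has_sumP/(_ d d0)[B hB] := Fs.
have /hB : (B `<=` A `|` B)%fset by rewrite fsubsetUr.
have := AB A (fsubset_refl A).
have := has_sum_ge_partial (A `|` B)%fset G0 Gt.
rewrite (big_fsetID _ (mem A))/= [in X in _ -> _ -> X -> _](big_fsetID _ (mem A))/=.
have -> : [fset x in (A `|` B) | (mem A) x]%fset = A.
  by apply/fsetP => x; rewrite !inE/=; case: (x \in A) => //=; rewrite andbF.
set C := [fset x | x in (A `|` B)%fset & x \notin A]%fset.
have : `|\sum_(i <- C) F i| <= \sum_(i <- C) G i.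
  by apply: le_trans (ler_norm_sum _ _ _) _; apply: ler_sum.
rewrite !ler_norml !ltr_norml => /andP[? ?] ? /andP[? ?] /andP[? ?].
apply/andP; split; lra.
Qed.

(** Dominated convergence for unordered sums: the tails outside a common finite set are uniformly
    small, and on that set termwise convergence suffices. *)
Lemma tannery (I : choiceType) (F : nat -> I -> R) (f G : I -> R) (S : nat -> R) s M :
  abs_bounded G M ->
  (forall k i, `|F k i| <= G i) -> (forall i, F k i @[k --> \oo] --> f i) ->
  (forall k, has_sum (F k) (S k)) -> has_sum f s -> S k @[k --> \oo] --> s.
Proof.
move=> GM FG Ff FS fs.
have G0 i : 0 <= G i by apply: le_trans (FG 0%N i).
have fG i : `|f i| <= G i.
  by apply: (cvg_le (cvg_norm (Ff i))); apply: nearW => k; exact: FG.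
apply/cvgrPdist_le => e e0.
have [e3 e30] : exists e3 : R, e3 = e / 3 by exists (e / 3).
have [A hA] := has_sum_tail G0 GM (e := e3) ltac:(lra).
have : (\sum_(i <- A) F k i) @[k --> \oo] --> \sum_(i <- A) f i.
  by apply: cvg_sumr => i; exact: Ff.
move/cvgrPdist_le => /(_ e3 ltac:(lra)); apply: filterS => k.
have := hA _ _ fG fs; have := hA _ _ (FG k) (FS k).
rewrite !ler_norml => /andP[? ?] /andP[? ?] /andP[? ?].
by apply/andP; split; lra.
Qed.

Lemma sum_fsetM (I J : choiceType) (F : I * J -> R) (A : {fset I}) (C : {fset J}) :
  \sum_(i <- A) \sum_(j <- C) F (i, j) = \sum_(p <- (A `*` C)%fset) F p.
Proof. by rewrite big_imfset2 //= => -[? ?] [? ?] _ _ /= [-> ->]. Qed.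

(** For a fixed finite [A] containing the first projection of [A0], the rectangles [A * C]
    eventually contain [A0]; letting [C] grow replaces the inner finite sums by [g]. *)
Lemma has_sum_prod (I J : choiceType) (F : I * J -> R) (g : I -> R) s :
  has_sum F s -> (forall i, has_sum (fun j => F (i, j)) (g i)) -> has_sum g s.
Proof.
move=> Fs Fg; apply/has_sumP => e e0.
have [e2 e20] : exists e2 : R, e2 = e / 2 by exists (e / 2).
have /has_sumP/(_ e2 ltac:(lra))[A0 hA] := Fs.
exists [fset p.1 | p in A0]%fset => A hA1.
suff : `|s - \sum_(i <- A) g i| <= e2 by move=> h; lra.
have : (\sum_(i <- A) summability.partial_sum (fun j => F (i, j)) C)
    @[C --> summability.totally] --> \sum_(i <- A) g i.
  by apply: cvg_sumr => i; exact: Fg.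
move=> h; apply: (cvg_le (cvg_norm (cvgB (cvg_cst s) h))).
exists [fset p.2 | p in A0]%fset => // C /= hC.
apply/ltW; rewrite !fctE.
under eq_bigr do rewrite partial_sumE.
rewrite sum_fsetM; apply: hA; apply/fsubsetP => p pA0.
rewrite in_fsetM; apply/andP; split.
  by apply: (fsubsetP hA1); apply/imfsetP; exists p.
by apply: (fsubsetP hC); apply/imfsetP; exists p.
Qed.

Lemma abs_bounded_prod (I J : choiceType) (F : I -> R) (G : J -> R) M K :
  abs_bounded F M -> abs_bounded G K ->
  abs_bounded (fun p : I * J => F p.1 * G p.2) (M * K).
Proof.
move=> FM GK B.
pose A := [fset p.1 | p in B]%fset; pose C := [fset p.2 | p in B]%fset.
apply: (@le_trans _ _ (\sum_(p <- (A `*` C)%fset) `|F p.1 * G p.2|)).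
  apply: (sum_fset_subset (F := fun p => `|F p.1 * G p.2|)) => [p|].
    exact: normr_ge0.
  apply/fsubsetP => p pB; rewrite in_fsetM; apply/andP.
  by split; apply/imfsetP; exists p.
rewrite -(sum_fsetM (fun p => `|F p.1 * G p.2|))/=.
under eq_bigr do under eq_bigr do rewrite normrM.
under eq_bigr do rewrite -mulr_sumr.
rewrite -mulr_suml; apply: ler_pM => //; exact: sumr_ge0.
Qed.

(** [Negz k] is [-(k + 1)], so this is the interval from [-N] to [N - 1], not symmetric about 0. *)
Definition int_fset (N : nat) : {fset int} :=
  [fset n in [seq Posz k | k <- iota 0 N] ++ [seq Negz k | k <- iota 0 N]]%fset.

Lemma int_fset_uniq N :
  uniq ([seq Posz k | k <- iota 0 N] ++ [seq Negz k | k <- iota 0 N]).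
Proof.
rewrite cat_uniq !map_inj_uniq ?iota_uniq//; last 2 first.
- by move=> ? ? [].
- by move=> ? ? [].
rewrite andbT/=; apply/hasPn => x /mapP[k _ ->].
by apply/negP => /mapP[].
Qed.

Lemma sum_int_fset (F : int -> R) N :
  \sum_(n <- int_fset N) F n = \sum_(0 <= k < N) (F (Posz k) + F (Negz k)).
Proof.
rewrite (perm_big ([seq Posz k | k <- iota 0 N] ++ [seq Negz k | k <- iota 0 N])).
  by rewrite /= big_cat !big_map big_split /index_iota subn0.
apply: uniq_perm; [exact: fset_uniq|exact: int_fset_uniq|].
by move=> n; rewrite /int_fset !inE mem_cat.
Qed.

Lemma int_fset_ub (A : {fset int}) :
  exists N, forall M, (N <= M)%N -> (A `<=` int_fset M)%fset.
Proof.
exists (\max_(n <- A) (`|n|%N.+1)) => M NM; apply/fsubsetP => n nA.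
rewrite /int_fset !inE.
have : (`|n| < M)%N.
  apply: leq_trans NM.
  exact: (@leq_bigmax_seq _ (enum_fset A) xpredT (fun n : int => `|n|%N.+1)).
case: n nA => k kA kM; apply/orP; [left|right]; apply/mapP; exists k => //.
  by rewrite mem_iota.
by rewrite mem_iota/= add0n ltnW.
Qed.

Lemma cvg_int_fset (F : int -> R) s : has_sum F s ->
  (\sum_(0 <= k < N) (F (Posz k) + F (Negz k))) @[N --> \oo] --> s.
Proof.
move=> /has_sumP Fs; apply/cvgrPdist_lt => e /Fs[A AB].
have [N hN] := int_fset_ub A.
by exists N => // M /= /hN /AB; rewrite sum_int_fset.
Qed.

Lemma abs_bounded_int (F : int -> R) M :
  (forall N, \sum_(0 <= k < N) (`|F (Posz k)| + `|F (Negz k)|) <= M) ->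
  abs_bounded F M.
Proof.
move=> FM B; have [N /(_ N (leqnn N)) hN] := int_fset_ub B.
apply: le_trans (FM N); rewrite -(sum_int_fset (fun n => `|F n|)).
exact: (sum_fset_subset (F := fun n => `|F n|)).
Qed.

Lemma geometric_bound (x : R) N : 0 <= x < 1 ->
  \sum_(0 <= k < N) x ^+ k <= (1 - x)^-1.
Proof.
move=> /andP[x0 x1]; rewrite -[leRHS]mul1r ler_pdivlMr ?subr_gt0// mulrC.
rewrite big_mkord -opprB mulNr -subrX1 opprB lerBlDr lerDl exprn_ge0//.
Qed.

Lemma abs_bounded_geometric (x : R) : 0 <= x < 1 ->
  abs_bounded (fun n : int => x ^+ `|n|%N) (2 / (1 - x)).
Proof.
move=> x01; have /andP[x0 x1] := x01; apply: abs_bounded_int => N.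
rewrite big_split/= mulrDl mul1r lerD//.
  by under eq_bigr do rewrite ger0_norm ?exprn_ge0//; exact: geometric_bound.
apply: le_trans (geometric_bound N x01); apply: ler_sum => k _.
by rewrite ger0_norm ?exprn_ge0// exprS ler_piMl ?exprn_ge0// ltW.
Qed.

End unordered_sums.

(** * Complex limits and sums through real and imaginary parts *)

Section complex_limits.
Local Open Scope complex_scope.
Context {R : realType}.

Lemma normc_le_ReIm (x : R[i]) :
  `|x| <= (`|complex.Re x| + `|complex.Im x|)%:C.
Proof.
case: x => a b; rewrite normc_def/= lecR.
rewrite -[leRHS]ger0_norm ?addr_ge0// -sqrtr_sqr ler_sqrt ?sqr_ge0//.
by rewrite sqrrD !real_normK ?num_real// addrAC lerDl mulrn_wge0// mulr_ge0.
Qed.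

Lemma cvg_complex (T : Type) (F : set_system T) {FF : Filter F}
    (f : T -> R[i]) (u v : R) :
  complex.Re (f x) @[x --> F] --> u -> complex.Im (f x) @[x --> F] --> v ->
  (f x : R[i]^o) @[x --> F] --> (u +i* v : R[i]^o).
Proof.
move=> fu fv; apply/cvgrPdist_lt => -[e e'] /=.
(* The radius ranges over [R[i]], whose positive elements are the positive reals. *)
rewrite ltcE/= => /andP[/eqP -> e0].
have e20 : 0 < e / 2 by rewrite divr_gt0.
move/cvgrPdist_lt : fu => /(_ _ e20) fu.
move/cvgrPdist_lt : fv => /(_ _ e20) fv.
near=> x; apply: le_lt_trans (normc_le_ReIm _) _.
have : `|u - complex.Re (f x)| < e / 2 by near: x.
have : `|v - complex.Im (f x)| < e / 2 by near: x.
case: (f x) => a b /= h1 h2.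
by rewrite -[_ +i* 0]/(e%:C) ltcR [e]splitr ltrD.
Unshelve. all: by end_near. Qed.

Lemma complex_sumE (I : choiceType) (F : I -> R[i]) (u v : R) :
  has_sum (fun i => complex.Re (F i)) u -> has_sum (fun i => complex.Im (F i)) v ->
  summability.sum (F : I -> R[i]^o) = u +i* v.
Proof.
move=> Fu Fv; apply: cvg_lim; first exact: norm_hausdorff.
apply: cvg_complex.
- by move: Fu; rewrite /has_sum; under eq_fun do rewrite partial_sumE -raddf_sum -partial_sumE.
- by move: Fv; rewrite /has_sum; under eq_fun do rewrite partial_sumE -raddf_sum -partial_sumE.
Qed.

End complex_limits.

(** * Integrals over the real line *)

Section real_line_integrals.
Context {R : realType}.
Notation mu := (@lebesgue_measure R).
Local Notation lorentz := (fun x : R => (1 + x ^+ 2)^-1).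

Lemma lorentz_gt0 (x : R) : 0 < (1 + x ^+ 2)^-1.
Proof. by rewrite invr_gt0 ltr_wpDr ?sqr_ge0. Qed.

Lemma integral_lorentz : (\int[mu]_x ((1 + x ^+ 2)^-1)%:E)%E = pi%:E.
Proof.
rewrite ge0_symfun_integralT//=.
- rewrite (_ : [set x | _] = `[0, +oo[%classic); last first.
    by apply/seteqP; split => x/=; rewrite in_itv/= andbT.
  by rewrite integral0y_oneDsqr -EFinM mulrCA divff// mulr1.
- by move=> x; exact/ltW/lorentz_gt0.
- exact: continuous_oneDsqrV.
- by move=> x/=; rewrite sqrrN.
Qed.

Lemma integrable_lorentz : mu.-integrable setT (EFin \o lorentz).
Proof.
have mf : measurable_fun setT lorentz.
  by apply: continuous_measurable_fun; exact: continuous_oneDsqrV.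
apply/integrableP; split; first exact/measurable_EFinP.
rewrite (_ : (\int[mu]_x _)%E = (\int[mu]_x ((1 + x ^+ 2)^-1)%:E)%E).
  by rewrite integral_lorentz ltry.
by apply: eq_integral => x _ /=; rewrite ger0_norm// ltW ?lorentz_gt0.
Qed.

Lemma Rintegral_lorentz : \int[mu]_x ((1 + x ^+ 2)^-1) = pi.
Proof. by rewrite /Rintegral integral_lorentz. Qed.

Lemma integrable_le (D : set (measurableTypeR R)) (f g : R -> R) : measurable D ->
  measurable_fun D f ->
  mu.-integrable D (EFin \o g) -> (forall x, D x -> `|f x| <= g x) ->
  mu.-integrable D (EFin \o f).
Proof.
move=> mD mf ig fg; apply: (@le_integrable _ _ _ mu D mD (EFin \o f) (EFin \o g)) => //.
  exact/measurable_EFinP.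
by move=> x Dx /=; rewrite lee_fin (le_trans (fg _ Dx))// ler_norm.
Qed.

Lemma integrableMl_const (D : set (measurableTypeR R)) (f : R -> R) c : measurable D ->
  mu.-integrable D (EFin \o f) -> mu.-integrable D (EFin \o (fun x => c * f x)).
Proof.
move=> mD fi; have := @integrableZl _ _ R mu D mD c (EFin \o f) fi.
by congr (integrable _ _ _); apply/funext => x /=; rewrite EFinM.
Qed.

(** [1 / (1 + x^2)] is the common majorant of the development: Gaussians, decaying exponentials and
    the Ewald kernels are all compared with it, and its integral is [pi]. *)
Lemma integrable_dominated (D : set (measurableTypeR R)) (f : R -> R) C : measurable D ->
  measurable_fun D f ->
  (forall x, `|f x| <= C / (1 + x ^+ 2)) -> mu.-integrable D (EFin \o f).
Proof.
move=> mD mf fC.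
apply: (@integrable_le _ _ (fun x => C / (1 + x ^+ 2))) => //.
apply: integrableMl_const => //.
exact: integrableS (@subsetT _ D) integrable_lorentz.
Qed.

Lemma Rintegral_dominated (f : R -> R) C : measurable_fun setT f ->
  (forall x, `|f x| <= C / (1 + x ^+ 2)) -> `|\int[mu]_x f x| <= C * pi.
Proof.
move=> mf fC.
have fi := integrable_dominated measurableT mf fC.
apply: (le_trans (le_normr_Rintegral measurableT fi)).
rewrite -Rintegral_lorentz -RintegralZl//; last exact: integrable_lorentz.
apply: le_Rintegral => //.
- by have /integrable_norm := fi.
- exact: integrableMl_const integrable_lorentz.
Qed.

Lemma dominated_cvg_Rintegral (D : set (measurableTypeR R)) (f_ : (R -> R)^nat) (f g : R -> R) :
  measurable D -> (forall n, measurable_fun D (f_ n)) ->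
  (forall x, D x -> f_ n x @[n --> \oo] --> f x) ->
  mu.-integrable D (EFin \o g) -> (forall n x, D x -> `|f_ n x| <= g x) ->
  \int[mu]_(x in D) f_ n x @[n --> \oo] --> \int[mu]_(x in D) f x.
Proof.
move=> mD mf_ ff ig fg.
have mf : measurable_fun D f by exact: (measurable_fun_cvg mf_ ff).
have [] := @dominated_convergence _ _ _ mu D mD (fun n => EFin \o f_ n)
  (EFin \o f) (EFin \o g).
- by move=> n; exact/measurable_EFinP.
- exact/measurable_EFinP.
- by apply: aeW => x Dx; apply: cvg_EFin; [exact: nearW|exact: ff].
- by [].
- by apply: aeW => x n Dx; rewrite /= lee_fin fg.
move=> fi _ h; apply: fine_cvg.
rewrite fineK; first exact: h.
by have := integrable_fin_num mD fi.
Qed.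

Lemma cvg_Rintegral_itv (f : R -> R) (a b : R^nat) :
  mu.-integrable setT (EFin \o f) -> a n @[n --> \oo] --> -oo ->
  b n @[n --> \oo] --> +oo ->
  \int[mu]_(x in `[a n, b n]) f x @[n --> \oo] --> \int[mu]_x f x.
Proof.
move=> fi aNy bNy; under eq_fun do rewrite Rintegral_mkcond.
have mf : measurable_fun setT f by have /integrableP[/measurable_EFinP] := fi.
apply: (@dominated_cvg_Rintegral _ _ _ (fun x => `|f x|)) => //.
- by move=> n; apply/(measurable_restrictT _ _).1 => //; exact: measurable_funTS.
- move=> x _; apply: cvg_near_cst.
  move/cvgrNyPle : aNy => /(_ x) h1; move/cvgryPge : bNy => /(_ x) h2.
  near=> n; rewrite patchE ifT// inE/= in_itv/=; apply/andP; split.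
    by near: n.
  by near: n.
- by have /integrable_norm := fi.
- by move=> n x _; rewrite patchE; case: ifPn; rewrite // normr0.
Unshelve. all: by end_near. Qed.

Lemma Rintegral_FTC (f F : R -> R) (a b : R) : a <= b -> continuous f ->
  (forall x : R, is_derive x 1 F (f x)) ->
  \int[mu]_(x in `[a, b]) f x = F b - F a.
Proof.
rewrite le_eqVlt => /predU1P[->|ab] cf dF.
  by rewrite set_itv1 Rintegral_set1 subrr.
rewrite /Rintegral (@continuous_FTC2 _ f F)//.
- exact: continuous_subspaceT.
- have dF' x : derivable F x 1 by have [] := dF x.
  have cF : continuous F by move=> x; apply/differentiable_continuous/derivable1_diffP.
  split => //.
  + by apply: cvg_at_right_filter; exact: cF.
  + by apply: cvg_at_left_filter; exact: cF.
- by move=> x _; rewrite derive1E; have [] := dF x.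
Qed.

End real_line_integrals.

(** * Syntactic rules for derivatives *)

Section derivation_rules.
Context {R : realType}.
Implicit Types (f g : R -> R) (x c : R).

Lemma der_eq f x d d' : is_derive x 1 f d -> d = d' -> is_derive x 1 f d'.
Proof. by move=> fd <-. Qed.

Lemma der_cst x c : is_derive x 1 (fun _ : R => c) 0.
Proof. exact: is_derive_cst. Qed.

Lemma der_id x : is_derive x 1 (fun t : R => t) 1.
Proof. exact: is_derive_id. Qed.

Lemma der_add f g x df dg : is_derive x 1 f df -> is_derive x 1 g dg ->
  is_derive x 1 (fun t => f t + g t) (df + dg).
Proof. by move=> hf hg; exact: (is_deriveD hf hg). Qed.

Lemma der_opp f x df : is_derive x 1 f df -> is_derive x 1 (fun t => - f t) (- df).
Proof. by move=> hf; exact: (is_deriveN hf). Qed.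

Lemma der_mul f g x df dg : is_derive x 1 f df -> is_derive x 1 g dg ->
  is_derive x 1 (fun t => f t * g t) (df * g x + f x * dg).
Proof.
move=> hf hg; apply: der_eq (is_deriveM hf hg) _.
by rewrite addrC; congr (_ + _); rewrite mulrC.
Qed.

Lemma der_sqr f x df : is_derive x 1 f df ->
  is_derive x 1 (fun t => f t ^+ 2) (2 * f x * df).
Proof. by move=> hf; apply: der_eq (der_mul hf hf) _; ring. Qed.

Lemma der_expR f x df : is_derive x 1 f df ->
  is_derive x 1 (fun t => expR (f t)) (expR (f x) * df).
Proof. by move=> hf; exact: (is_derive1_comp (is_derive_expR (f x)) hf). Qed.

Lemma der_cos f x df : is_derive x 1 f df ->
  is_derive x 1 (fun t => cos (f t)) (- sin (f x) * df).
Proof. by move=> hf; exact: (is_derive1_comp (is_derive_cos (f x)) hf). Qed.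

Lemma der_sin f x df : is_derive x 1 f df ->
  is_derive x 1 (fun t => sin (f t)) (cos (f x) * df).
Proof. by move=> hf; exact: (is_derive1_comp (is_derive_sin (f x)) hf). Qed.

Lemma der_inv f x df : f x != 0 -> is_derive x 1 f df ->
  is_derive x 1 (fun t => (f t)^-1) (- (f x ^- 2) * df).
Proof. by move=> fx hf; exact: (is_deriveV fx hf). Qed.

Lemma is_derive_continuous f (df : R -> R) :
  (forall x, is_derive x 1 f (df x)) -> continuous f.
Proof.
move=> fd x; apply/differentiable_continuous/derivable1_diffP.
by have [] := fd x.
Qed.

End derivation_rules.

(** The rules are applied with the derivative left as an existential variable. [derive] then leaves
    the equality between the computed and the claimed derivative, while [continuity] discards the
    derivative. *)
Ltac derive_rules :=
  repeat first [ apply: der_cst | apply: der_id | eapply der_sqr | eapply der_add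
    | eapply der_opp | eapply der_mul | eapply der_expR | eapply der_cos
    | eapply der_sin | eapply der_inv ].
Ltac derive := eapply der_eq; [derive_rules|cbv beta].
Ltac continuity := eapply is_derive_continuous; move=> ?; derive_rules.

(** * Gaussian integrals and the Fourier transform of the Gaussian *)

Section gaussian_integrals.
Context {R : realType}.
Notation mu := (@lebesgue_measure R).

Lemma expRN_le_lorentz (x : R) : expR (- x ^+ 2) <= (1 + x ^+ 2)^-1.
Proof.
rewrite expRN lef_pV2 ?posrE ?expR_gt0 ?expR_ge1Dx//.
by rewrite ltr_wpDr ?sqr_ge0.
Qed.

Lemma expR_ge_sqr (y : R) : 0 <= y -> (1 + y / 2) ^+ 2 <= expR y.
Proof.
move=> y0; rewrite [y in expR y](splitr y) expRD -expr2.
by rewrite lerXn2r ?nnegrE ?expR_ge0 ?expR_ge1Dx//; lra.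
Qed.

Lemma expR_norm_le_lorentz (x : R) : expR (- `|x|) <= 4 / (1 + x ^+ 2).
Proof.
have h0 := normr_ge0 x; rewrite -[x ^+ 2]real_normK ?num_real//.
move: `|x| h0 => y y0; rewrite expRN ler_pdivlMr; last by nra.
rewrite mulrC ler_pdivrMr ?expR_gt0//.
have h := expR_ge_sqr y0.
nra.
Qed.

Lemma gauss_shift (c : R) :
  mu.-integrable setT (EFin \o (fun x : R => expR (- (x + c) ^+ 2))) /\
  \int[mu]_x expR (- (x + c) ^+ 2) = Num.sqrt pi.
Proof.
have E : (\int[mu]_x (expR (- (x + c) ^+ 2))%:E)%E = (Num.sqrt pi)%:E.
  rewrite -integralT_gauss.
  have dF (x : R) : is_derive x 1 (fun t : R => t + c) 1 by derive; rewrite addr0.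
  have D1 : derive1 (fun t : R => t + c) = cst 1.
    by apply/funext => x; rewrite derive1E; have [] := dF x.
  rewrite (@increasing_ge0_integration_by_substitutionT R (fun t => t + c) (@gauss_fun R)).
  - by apply: eq_integral => x _ /=; rewrite D1/= mulr1.
  - by move=> x y xy; rewrite ltrD2r.
  - by rewrite D1; exact: cst_continuous.
  - by rewrite D1; exact: is_cvg_cst.
  - by rewrite D1; exact: is_cvg_cst.
  - by move=> x; have [] := dF x.
  - apply/cvgrNyPle => A; near=> x; rewrite -lerBrDr.
    by near: x; apply: nbhs_ninfty_le; exact: num_real.
  - apply/cvgryPge => A; near=> x; rewrite -lerBlDr.
    by near: x; apply: nbhs_pinfty_ge; exact: num_real.
  - exact: continuous_gauss_fun.
  - exact: gauss_fun_ge0.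
split; last by rewrite /Rintegral E.
have mf : measurable_fun setT (fun x : R => expR (- (x + c) ^+ 2)).
  by apply: continuous_measurable_fun; continuity.
apply/integrableP; split; first exact/measurable_EFinP.
rewrite (_ : (\int[mu]_x _)%E = (\int[mu]_x (expR (- (x + c) ^+ 2))%:E)%E).
  by rewrite E ltry.
by apply: eq_integral => x _ /=; rewrite ger0_norm ?expR_ge0.
Unshelve. all: by end_near. Qed.

End gaussian_integrals.

Section gaussian_fourier.
Context {R : realType}.
Notation mu := (@lebesgue_measure R).
Local Notation sqrtpi := (Num.sqrt (pi : R)).

Lemma Rintegral_gauss : \int[mu]_t expR (- t ^+ 2) = sqrtpi.
Proof. by rewrite /Rintegral integralT_gauss. Qed.

Lemma cvg_opp_natr : - (n%:R : R) @[n --> \oo] --> -oo.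
Proof. by apply/cvgNrNy; exact: cvgr_idn. Qed.

Lemma Rintegral_derivative (f F : R -> R) (l m : R) : continuous f ->
  mu.-integrable setT (EFin \o f) -> (forall x : R, is_derive x 1 F (f x)) ->
  F n%:R @[n --> \oo] --> l -> F (- n%:R) @[n --> \oo] --> m ->
  \int[mu]_x f x = l - m.
Proof.
move=> cf fi dF Fl Fm.
have h1 := cvg_Rintegral_itv fi cvg_opp_natr (@cvgr_idn R).
have h2 : F n%:R - F (- n%:R) @[n --> \oo] --> l - m by exact: cvgB.
have E n : \int[mu]_(x in `[- n%:R, n%:R]) f x = F n%:R - F (- n%:R).
  by apply: Rintegral_FTC => //; rewrite ge0_cp.
move: h1; under eq_fun do rewrite E; move=> h1.
exact: cvg_unique h1 h2.
Qed.

(** Completing the square: the exponent is [a^2 - 2 a w - (u + a - w)^2]. This is the convolution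
    integrand with [|u|] replaced by [u], and it supplies the main term of the transform. *)
Lemma gauss_tilt (a w : R) :
  mu.-integrable setT (EFin \o (fun u : R => expR (- (2 * a * u) - (u - w) ^+ 2))) /\
  \int[mu]_u expR (- (2 * a * u) - (u - w) ^+ 2) = sqrtpi * expR (a ^+ 2 - 2 * a * w).
Proof.
have [gi gE] := gauss_shift (a - w).
have E : (fun u : R => expR (- (2 * a * u) - (u - w) ^+ 2)) =
    (fun u => expR (a ^+ 2 - 2 * a * w) * expR (- (u + (a - w)) ^+ 2)).
  by apply/funext => u; rewrite -expRD; congr expR; ring.
rewrite E; split; first exact: integrableMl_const gi.
by rewrite RintegralZl// gE mulrC.
Qed.

Lemma norm_expR_sqr_le_lorentz (t : R) :
  `|t| * expR (- t ^+ 2) <= 4 / (1 + t ^+ 2).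
Proof.
have h0 := normr_ge0 t; rewrite -[t ^+ 2]real_normK ?num_real//.
move: `|t| h0 => y y0; rewrite expRN ler_pdivlMr; last by nra.
rewrite mulrAC ler_pdivrMr ?expR_gt0//.
have h := expR_ge_sqr (sqr_ge0 y).
have := sqr_ge0 (y - 1); have := sqr_ge0 (y * (y - 1)).
nra.
Qed.

Lemma integrable_gauss_trig (f : R -> R) : continuous f ->
  (forall t, `|f t| <= 1) ->
  mu.-integrable setT (EFin \o (fun t : R => expR (- t ^+ 2) * f t)).
Proof.
move=> cf f1; apply: (@integrable_dominated _ _ _ 1) => //.
  apply: measurable_funM; apply: continuous_measurable_fun => //; continuity.
move=> t; rewrite normrM mul1r ger0_norm ?expR_ge0//.
apply: le_trans (expRN_le_lorentz t).
by rewrite ler_piMr ?expR_ge0.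
Qed.

(** Differentiation under the integral, followed by the integration by parts below, shows that
    [J w * e^(w^2)] has zero derivative; its constant value is the Gaussian integral, read off at
    0. *)
Lemma gauss_fourier (w0 : R) :
  \int[mu]_t (expR (- t ^+ 2) * cos (2 * w0 * t)) = sqrtpi * expR (- w0 ^+ 2).
Proof.
pose f (w t : R) := expR (- t ^+ 2) * cos (2 * w * t).
pose g (w t : R) := - (2 * t * expR (- t ^+ 2) * sin (2 * w * t)).
pose J w := \int[mu]_t f w t.
have ccos (w : R) : continuous (fun t : R => cos (2 * w * t)) by continuity.
have fi w : mu.-integrable setT (EFin \o f w).
  apply: integrable_gauss_trig => // t.
  by rewrite ler_norml cos_geN1 cos_le1.
have df (w t : R) : is_derive w 1 (f ^~ t) (g w t).
  by rewrite /f /g; derive; ring.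
have g_le (w t : R) : `|g w t| <= 8 / (1 + t ^+ 2).
  rewrite normrN !normrM ger0_norm// (ger0_norm (expR_ge0 _)).
  have h1 := norm_expR_sqr_le_lorentz t.
  have h2 : `|sin (2 * w * t)| <= 1 by rewrite ler_norml sin_geN1 sin_le1.
  have h3 : 0 <= `|t| * expR (- t ^+ 2) by rewrite mulr_ge0 ?expR_ge0.
  have -> : 8 / (1 + t ^+ 2) = 2 * (4 / (1 + t ^+ 2)) by ring.
  by have h4 := ler_piMr h3 h2; lra.
have gi w : mu.-integrable setT (EFin \o g w).
  apply: (@integrable_dominated _ _ _ 8) => //.
  apply: continuous_measurable_fun; rewrite /g; continuity.
have dJ (w : R) : is_derive w 1 J (\int[mu]_t g w t).
  have Iw : `]w - 1, w + 1[%classic w by rewrite /= in_itv/=; lra.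
  have hd (x y : R) : `]w - 1, w + 1[%classic x -> [set: R] y -> derivable (f ^~ y) x 1.
    by move=> _ _; have [] := df x y.
  have d1E (x y : R) : partial1of2 f x y = g x y by rewrite partial1of2E; have [] := df x y.
  have Gub (x y : R) : `]w - 1, w + 1[%classic x -> [set: R] y ->
      `|partial1of2 f x y| <= 8 / (1 + y ^+ 2) by move=> _ _; rewrite d1E.
  have iG : mu.-integrable setT (EFin \o (fun y : R => 8 / (1 + y ^+ 2))).
    exact: integrableMl_const (@integrable_lorentz R).
  have G0 (y : R) : 0 <= 8 / (1 + y ^+ 2).
    by rewrite mulr_ge0// ltW ?lorentz_gt0.
  have fi' (x : R) : `]w - 1, w + 1[%classic x -> mu.-integrable setT (EFin \o f x) by [].
  have A1 := @derivable_under_integral R _ _ mu f setT measurableT w _ _ Iw fi' hd _ G0 iG Gub.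
  have A2 :=
    @differentiation_under_integral R _ _ mu f setT measurableT w _ _ Iw fi' hd _ G0 iG Gub.
  split => //; rewrite -derive1E A2; apply: eq_Rintegral => y _; exact: d1E.
(* Integration by parts: [J] solves [J' w = - 2 w J w]. *)
have JE w : \int[mu]_t g w t = - (2 * w * J w).
  pose F (t : R) := expR (- t ^+ 2) * sin (2 * w * t).
  have dF (t : R) : is_derive t 1 F (g w t + 2 * w * f w t).
    by rewrite /F /g /f; derive; ring.
  have F0 (u : R^nat) : `|u n| @[n --> \oo] --> +oo -> F (u n) @[n --> \oo] --> 0.
    move=> uy; apply/norm_cvg0P.
    apply: (@squeeze_cvgr _ _ _ _ (cst 0) (fun n => gauss_fun `|u n|)).
    - apply: nearW => n; rewrite normr_ge0/= /F normrM ger0_norm ?expR_ge0//.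
      by rewrite /gauss_fun real_normK ?num_real// ler_piMr ?expR_ge0// ler_norml sin_geN1 sin_le1.
    - exact: cvg_cst.
    - exact: cvg_comp uy (@cvg_gauss_fun R).
  have fi2 := @integrableMl_const R setT _ (2 * w) measurableT (fi w).
  have : \int[mu]_t (g w t + 2 * w * f w t) = 0 - 0.
    apply: (Rintegral_derivative (F := F)) => //.
    - by rewrite /g /f; continuity.
    - by have := integrableD measurableT (gi w) fi2.
    - apply: F0; under eq_fun do rewrite normr_nat; exact: cvgr_idn.
    - apply: F0; under eq_fun do rewrite normrN normr_nat; exact: cvgr_idn.
  by rewrite RintegralD// RintegralZl// subr0 => /eqP; rewrite addr_eq0 => /eqP.
have dK (w : R) : is_derive w 1 (fun w => J w * expR (w ^+ 2)) 0.
  have dE : is_derive w 1 (fun w : R => expR (w ^+ 2)) (2 * w * expR (w ^+ 2)).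
    by derive; ring.
  apply: der_eq (der_mul (dJ w) dE) _.
  by rewrite JE; ring.
have K0 : J w0 * expR (w0 ^+ 2) = J 0 * expR (0 ^+ 2).
  exact: (@is_derive_0_is_cst _ (fun w => J w * expR (w ^+ 2))).
have J0 : J 0 = sqrtpi.
  rewrite -[RHS](@Rintegral_gauss); apply: eq_Rintegral => t _.
  by rewrite /f mulr0 mul0r cos0 mulr1.
rewrite -/(J w0) expRN; move: K0; rewrite J0 expr0n expR0 mulr1 => <-.
by rewrite mulfK// gt_eqF ?expR_gt0.
Qed.

End gaussian_fourier.

(** * Exchange of two integrals under a product majorant *)

Section lorentz_fourier.
Context {R : realType}.
Notation mu := (@lebesgue_measure R).
Notation RT := (measurableTypeR R).

Lemma Fubini_lorentz (F : R -> R -> R) C :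
  measurable_fun setT (fun p : RT * RT => F p.1 p.2) ->
  (forall x y, `|F x y| <= C / (1 + x ^+ 2) / (1 + y ^+ 2)) ->
  \int[mu]_x \int[mu]_y F x y = \int[mu]_y \int[mu]_x F x y.
Proof.
move=> mF FC.
have mF1 x : measurable_fun (setT : set RT) (F x).
  exact: (measurableT_comp mF (pair1_measurable x)).
have mF2 y : measurable_fun (setT : set RT) (F^~ y).
  exact: (measurableT_comp mF (pair2_measurable y)).
have i1 x : mu.-integrable setT (EFin \o F x).
  apply: (@integrable_dominated _ _ _ (C / (1 + x ^+ 2))) => //; exact: FC.
have i2 y : mu.-integrable setT (EFin \o F^~ y).
  apply: (@integrable_dominated _ _ _ (C / (1 + y ^+ 2))) => //.
  move=> x.
  by rewrite mulrAC; exact: FC.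
have E1 x : (\int[mu]_y (F x y)%:E)%E = (\int[mu]_y F x y)%:E.
  by rewrite /Rintegral fineK//; exact: integrable_fin_num (i1 x).
have E2 y : (\int[mu]_x (F x y)%:E)%E = (\int[mu]_x F x y)%:E.
  by rewrite /Rintegral fineK//; exact: integrable_fin_num (i2 y).
have imF : (mu \x mu)%E.-integrable setT (fun p : RT * RT => (F p.1 p.2)%:E).
  apply/integrable12ltyP; first exact/measurable_EFinP.
  have mG : measurable_fun setT (fun x : RT => (\int[mu]_y `|(F x y)%:E|)%E).
    apply: (@measurable_fun_fubini_tonelli_F _ _ RT RT R mu (fun p => `|(F p.1 p.2)%:E|)%E).
      by apply: measurableT_comp => //; exact/measurable_EFinP.
    by move=> p; exact: abse_ge0.
  apply: (@le_lt_trans _ _ (\int[mu]_x (C * pi / (1 + x ^+ 2))%:E)%E).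
    apply: ge0_le_integral => //=.
    - by move=> x _; apply: integral_ge0.
    - apply/measurable_EFinP; apply: measurable_funM => //.
      by apply: continuous_measurable_fun; exact: continuous_oneDsqrV.
    - move=> x _.
      have h : (\int[mu]_y (C / (1 + x ^+ 2) / (1 + y ^+ 2))%:E)%E = (C * pi / (1 + x ^+ 2))%:E.
        under eq_integral do rewrite EFinM.
        rewrite integralZl//; last exact: integrable_lorentz.
        by rewrite integral_lorentz -EFinM mulrAC.
      rewrite -h; apply: ge0_le_integral => //=.
      + by apply/measurable_EFinP; exact: measurableT_comp.
      + apply/measurable_EFinP; apply: measurable_funM => //.
        by apply: continuous_measurable_fun; exact: continuous_oneDsqrV.
      + by move=> y _; rewrite lee_fin FC.
  under eq_integral do rewrite EFinM.
  rewrite integralZl//; last exact: integrable_lorentz.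
  by rewrite integral_lorentz -EFinM ltry.
have := Fubini imF; rewrite /=.
under eq_integral do rewrite E1.
under [X in _ = X -> _]eq_integral do rewrite E2.
by rewrite /Rintegral => ->.
Qed.

End lorentz_fourier.

(** * The Fourier transform of the two-sided exponential *)

Section laplace_fourier_transform.
Context {R : realType}.
Notation mu := (@lebesgue_measure R).
Notation RT := (measurableTypeR R).

Lemma continuous_normr : continuous (fun u : R => `|u|).
Proof. by move=> u; apply: cvg_norm. Qed.

Lemma measurable_laplace (a : R) :
  measurable_fun (setT : set RT) (fun u : R => expR (- (2 * a * `|u|))).
Proof.
apply: continuous_measurable_fun => u.
apply: (@continuous_comp _ _ _ (fun u : R => `|u|) (fun y => expR (- (2 * a * y)))).
  exact: continuous_normr.
by move: (`|u|); continuity.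
Qed.

(** The factor [1 + 1 / (4 a^2)] undoes the rescaling by [2 a]: it bounds [1 + u^2] by its product
    with [1 + (2 a u)^2]. *)
Lemma laplace_le_lorentz (a u : R) : 0 < a ->
  expR (- (2 * a * `|u|)) <= (4 * (1 + (4 * a ^+ 2)^-1)) / (1 + u ^+ 2).
Proof.
move=> a0; have := expR_norm_le_lorentz (2 * a * u).
rewrite normrM (ger0_norm (x := 2 * a)) ?mulr_ge0 ?(ltW a0)// => /le_trans; apply.
rewrite -[leRHS]mulrA ler_pM2l// ler_pdivlMr; last by nra.
rewrite mulrC ler_pdivrMr; last by nra.
have a20 : 0 < 4 * a ^+ 2 by nra.
have u20 := sqr_ge0 u.
have -> : (1 + (4 * a ^+ 2)^-1) * (1 + (2 * a * u) ^+ 2) =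
  1 + u ^+ 2 + (4 * a ^+ 2)^-1 + (2 * a * u) ^+ 2 by field; rewrite gt_eqF.
have ai : 0 < (4 * a ^+ 2)^-1 by rewrite invr_gt0.
have := sqr_ge0 (2 * a * u); lra.
Qed.

Lemma integrable_laplace (a : R) (f : R -> R) : 0 < a -> measurable_fun (setT : set RT) f ->
  (forall u, `|f u| <= 1) ->
  mu.-integrable setT (EFin \o (fun u : R => expR (- (2 * a * `|u|)) * f u)).
Proof.
move=> a0 mf f1; apply: (@integrable_dominated _ _ _ (4 * (1 + (4 * a ^+ 2)^-1))) => //.
  by apply: measurable_funM => //; exact: measurable_laplace.
move=> u; apply: le_trans (laplace_le_lorentz u a0).
by rewrite normrM ger0_norm ?expR_ge0// ler_piMr ?expR_ge0.
Qed.

Lemma Rintegral_split (f : R -> R) (a c b : R) : a <= c -> c <= b ->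
  mu.-integrable setT (EFin \o f) ->
  \int[mu]_(x in `[a, b]) f x =
  \int[mu]_(x in `[a, c]) f x + \int[mu]_(x in `[c, b]) f x.
Proof.
move=> ac cb fi.
have i1 : mu.-integrable [set` `[a, b]] (EFin \o f) by exact: integrableS fi.
have i2 : mu.-integrable [set` `]c, b]] (EFin \o f) by exact: integrableS fi.
have := @Rintegral_itvB R f (BLeft a) (BRight b) c i1.
rewrite !bnd_simp => /(_ ac cb).
rewrite (Rintegral_itv_obnd_cbnd i2) => <-.
by rewrite addrC subrK.
Qed.

Lemma cvg_laplace_tail (a : R) (f : R -> R) (C : R) : 0 < a -> (forall u, `|f u| <= C) ->
  expR (- (2 * a * n%:R)) * f n%:R @[n --> \oo] --> 0.
Proof.
move=> a0 fC; apply/norm_cvg0P.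
have h : expR (- (2 * a * n%:R)) * C @[n --> \oo] --> 0 * C.
  apply: cvgM; last exact: cvg_cst.
  have : expR (- x) @[x --> +oo] --> (0 : R) by exact: cvgr_expR.
  apply: cvg_comp; apply/cvgryPge => A; near=> n.
  rewrite -ler_pdivrMl ?mulr_gt0//; near: n; exact: nbhs_infty_ger.
rewrite mul0r in h.
apply: (@squeeze_cvgr _ _ _ _ (cst 0) _ _ _ _ (@cvg_cst _ _ _ _ _) h).
by apply: nearW => n; rewrite normr_ge0/= normrM ger0_norm ?expR_ge0// ler_wpM2l ?expR_ge0.
Unshelve. all: by end_near. Qed.

Lemma laplace_fourier (a v : R) : 0 < a ->
  \int[mu]_u (expR (- (2 * a * `|u|)) * cos (2 * v * u)) = a / (a ^+ 2 + v ^+ 2).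
Proof.
move=> a0.
have c1 (u : R) : `|cos (2 * v * u)| <= 1 by rewrite ler_norml cos_geN1 cos_le1.
have fi : mu.-integrable setT
    (EFin \o (fun u : R => expR (- (2 * a * `|u|)) * cos (2 * v * u))).
  apply: integrable_laplace => //.
  by apply: continuous_measurable_fun; continuity.
have D0 : a ^+ 2 + v ^+ 2 != 0 by rewrite gt_eqF//; have := sqr_ge0 v; nra.
(* [e^(-2 a u) P u] is the real part of the primitive [e^((-2 a + 2 i v) u) / (-2 a + 2 i v)]. *)
pose P (u : R) := (- a * cos (2 * v * u) + v * sin (2 * v * u)) / (2 * (a ^+ 2 + v ^+ 2)).
pose F1 (u : R) := expR (- (2 * a * u)) * P u.
have dP (u : R) : is_derive u 1 P ((2 * a * v * sin (2 * v * u)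
    + 2 * v ^+ 2 * cos (2 * v * u)) / (2 * (a ^+ 2 + v ^+ 2))).
  by rewrite /P; derive; field.
have dF1 (u : R) : is_derive u 1 F1 (expR (- (2 * a * u)) * cos (2 * v * u)).
  have dE : is_derive u 1 (fun u : R => expR (- (2 * a * u))) (- (2 * a) * expR (- (2 * a * u))).
    by derive; ring.
  by apply: der_eq (der_mul dE (dP u)) _; rewrite /P; field.
pose F2 (u : R) := - F1 (- u).
have dF2 (u : R) : is_derive u 1 F2 (expR (2 * a * u) * cos (2 * v * u)).
  have dN : is_derive u 1 (fun u : R => - u) (-1) by derive.
  have h := is_derive1_comp (dF1 (- u)) dN.
  by apply: der_eq (der_opp h) _; rewrite !mulrN cosN !opprK; ring.
have E n : \int[mu]_(u in `[- n%:R, n%:R]) (expR (- (2 * a * `|u|)) * cos (2 * v * u)) =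
    F1 n%:R * 2 - P 0 * 2.
  rewrite (@Rintegral_split _ _ 0)// ?oppr_le0//.
  have -> : \int[mu]_(u in `[- n%:R, 0]) (expR (- (2 * a * `|u|)) * cos (2 * v * u)) =
      \int[mu]_(u in `[- n%:R, 0]) (expR (2 * a * u) * cos (2 * v * u)).
    apply: eq_Rintegral => u; rewrite inE/= in_itv/= => /andP[_ u0].
    by rewrite ler0_norm// mulrN opprK.
  have -> : \int[mu]_(u in `[0, n%:R]) (expR (- (2 * a * `|u|)) * cos (2 * v * u)) =
      \int[mu]_(u in `[0, n%:R]) (expR (- (2 * a * u)) * cos (2 * v * u)).
    apply: eq_Rintegral => u; rewrite inE/= in_itv/= => /andP[u0 _].
    by rewrite ger0_norm.
  rewrite (Rintegral_FTC _ _ dF2) ?oppr_le0//; last by continuity.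
  rewrite (Rintegral_FTC _ _ dF1)//; last by continuity.
  have F10 : F1 0 = P 0 by rewrite /F1 mulr0 oppr0 expR0 mul1r.
  by rewrite /F2 oppr0 !opprK F10; ring.
have h1 := cvg_Rintegral_itv fi (@cvg_opp_natr R) (@cvgr_idn R).
move: h1; under eq_fun do rewrite E; move=> h1.
have h2 : F1 n%:R * 2 - P 0 * 2 @[n --> \oo] --> 0 * 2 - P 0 * 2.
  apply: cvgB; last exact: cvg_cst.
  apply: cvgM; last exact: cvg_cst.
  apply: (@cvg_laplace_tail _ _ ((a + `|v|) / (2 * (a ^+ 2 + v ^+ 2)))) => // u.
  have D2 : 0 < a ^+ 2 + v ^+ 2 by have := sqr_ge0 v; nra.
  have D3 : 0 <= (2 * (a ^+ 2 + v ^+ 2))^-1 by rewrite invr_ge0 mulr_ge0 ?(ltW D2).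
  rewrite normrM (ger0_norm D3) ler_wpM2r//.
  apply: le_trans (ler_normD _ _) _; rewrite !normrM normrN (gtr0_norm a0).
  rewrite lerD//; first by rewrite ler_piMr// (ltW a0).
  by rewrite ler_piMr// ler_norml sin_geN1 sin_le1.
transitivity (0 * 2 - P 0 * 2); first exact: (cvg_unique _ h1 h2).
by rewrite /P !mulr0 cos0 sin0; field; exact: D0.
Qed.

End laplace_fourier_transform.

(** * The Ewald kernel and its Fourier transform *)

Section ewald_kernel.
Context {R : realType}.
Notation mu := (@lebesgue_measure R).
Notation RT := (measurableTypeR R).
Local Notation sqrtpi := (Num.sqrt (pi : R)).

(** The value [a = 0] is allowed and gives the kernel of the zero mode; by the convention
    [x / 0 = 0] its value at [t = 0] is then 0. *)
Definition ewald_weight (a t : R) : R := expR (- a ^+ 2 - t ^+ 2) / (a ^+ 2 + t ^+ 2).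

Definition ewald_transform (a w : R) : R :=
  \int[mu]_t (ewald_weight a t * cos (2 * w * t)).

Lemma ewald_weight_ge0 (a t : R) : 0 <= ewald_weight a t.
Proof. by rewrite divr_ge0 ?expR_ge0// addr_ge0 ?sqr_ge0. Qed.

Lemma ewald_weight_le_gauss (a t : R) : 0 < a ->
  ewald_weight a t <= a ^- 2 * expR (- t ^+ 2).
Proof.
move=> a0; have a20 : 0 < a ^+ 2 by rewrite exprn_gt0.
have t20 := sqr_ge0 t.
rewrite mulrC; apply: ler_pM; rewrite ?expR_ge0 ?invr_ge0 ?addr_ge0 ?(ltW a20)//.
  by rewrite ler_expR; lra.
by rewrite lef_pV2 ?posrE ?ltr_wpDr// lerDl.
Qed.

Lemma continuous_ewald_weight (a : R) : 0 < a -> continuous (ewald_weight a).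
Proof.
move=> a0; rewrite /ewald_weight; continuity.
by rewrite gt_eqF// ltr_wpDr ?sqr_ge0 ?exprn_gt0.
Qed.

Lemma integrable_ewald (a : R) (f : R -> R) : 0 < a -> continuous f ->
  (forall t, `|f t| <= 1) ->
  mu.-integrable setT (EFin \o (fun t : R => ewald_weight a t * f t)).
Proof.
move=> a0 cf f1; apply: (@integrable_dominated _ _ _ (a ^- 2)) => //.
  apply: measurable_funM; apply: continuous_measurable_fun => //.
  exact: continuous_ewald_weight.
move=> t; rewrite normrM (ger0_norm (ewald_weight_ge0 a t)).
apply: (@le_trans _ _ (ewald_weight a t)); first by rewrite ler_piMr ?ewald_weight_ge0.
apply: le_trans (ewald_weight_le_gauss t a0) _.
by rewrite ler_wpM2l ?expRN_le_lorentz// invr_ge0 sqr_ge0.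
Qed.

Lemma cosM (x y : R) : cos x * cos y = (cos (y - x) + cos (y + x)) / 2.
Proof. by rewrite cosB cosD; field. Qed.

Lemma gauss_fourier_pair (u w : R) :
  \int[mu]_t (expR (- t ^+ 2) * cos (2 * w * t) * cos (2 * t * u)) =
  sqrtpi / 2 * (expR (- (u - w) ^+ 2) + expR (- (u + w) ^+ 2)).
Proof.
have i1 v : mu.-integrable setT (EFin \o (fun t : R => expR (- t ^+ 2) * cos (2 * v * t))).
  apply: integrable_gauss_trig; first by continuity.
  by move=> t; rewrite ler_norml cos_geN1 cos_le1.
transitivity (\int[mu]_t (2^-1 * (expR (- t ^+ 2) * cos (2 * (u - w) * t) +
    expR (- t ^+ 2) * cos (2 * (u + w) * t)))).
  apply: eq_Rintegral => t _; rewrite -mulrA cosM.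
  rewrite (_ : 2 * t * u - 2 * w * t = 2 * (u - w) * t); last by ring.
  by rewrite (_ : 2 * t * u + 2 * w * t = 2 * (u + w) * t); [field|ring].
rewrite RintegralZl//; last by have := integrableD measurableT (i1 (u - w)) (i1 (u + w)).
by rewrite RintegralD// !gauss_fourier; field.
Qed.

Lemma integrable_laplace_gauss (a w : R) : 0 < a ->
  mu.-integrable setT (EFin \o (fun u : R => expR (- (2 * a * `|u|)) *
      (expR (- (u - w) ^+ 2) + expR (- (u + w) ^+ 2)))).
Proof.
move=> a0.
rewrite (_ : (fun u : R => _) = (fun u => 2 * (expR (- (2 * a * `|u|)) *
    ((expR (- (u - w) ^+ 2) + expR (- (u + w) ^+ 2)) / 2)))); last first.
  by apply/funext => u; field.
apply: integrableMl_const => //; apply: integrable_laplace => //.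
  by apply: continuous_measurable_fun; continuity.
move=> u; rewrite ger0_norm ?divr_ge0 ?addr_ge0 ?expR_ge0//.
have h (x : R) : expR (- x ^+ 2) <= 1 by rewrite -expR0 ler_expR oppr_le0 sqr_ge0.
by have := h (u - w); have := h (u + w); lra.
Qed.

Lemma ewald_transform_convolution (a w : R) : 0 < a ->
  ewald_transform a w = sqrtpi * expR (- a ^+ 2) / (2 * a) *
    \int[mu]_u (expR (- (2 * a * `|u|)) *
      (expR (- (u - w) ^+ 2) + expR (- (u + w) ^+ 2))).
Proof.
move=> a0.
(* The integral of [F t u] over [u] gives back the kernel at [t], the integral over
   [t] is a Gaussian in [u]. *)
pose F (t u : R) := expR (- t ^+ 2) * cos (2 * w * t) *
  (expR (- (2 * a * `|u|)) * cos (2 * t * u)).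
have mc (v : R) : measurable_fun (setT : set RT) (fun t : R => cos (v * t)).
  by apply: continuous_measurable_fun; continuity.
have cosle (x : R) : `|cos x| <= 1 by rewrite ler_norml cos_geN1 cos_le1.
have FubF : \int[mu]_t \int[mu]_u F t u = \int[mu]_u \int[mu]_t F t u.
  apply: (@Fubini_lorentz _ _ (4 * (1 + (4 * a ^+ 2)^-1))).
    apply: measurable_funM.
      apply: (measurableT_comp (f := fun t : R => expR (- t ^+ 2) * cos (2 * w * t))) => //.
      by apply: continuous_measurable_fun; continuity.
    apply: measurable_funM.
      by apply: (measurableT_comp (measurable_laplace a)).
    apply: (measurableT_comp (f := @cos R)).
      by apply: continuous_measurable_fun; exact: continuous_cos.
    by apply: measurable_funM => //; apply: measurable_funM.
  move=> t u; rewrite /F !normrM !(ger0_norm (expR_ge0 _)).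
  rewrite [leRHS](_ : _ = (1 + t ^+ 2)^-1 *
    ((4 * (1 + (4 * a ^+ 2)^-1)) / (1 + u ^+ 2))); last by ring.
  apply: ler_pM; rewrite ?mulr_ge0 ?expR_ge0 ?normr_ge0//.
    by apply: le_trans (expRN_le_lorentz t); rewrite ler_piMr ?expR_ge0.
  by apply: le_trans (laplace_le_lorentz u a0); rewrite ler_piMr ?expR_ge0.
have L (t : R) : \int[mu]_u F t u = a * expR (a ^+ 2) * (ewald_weight a t * cos (2 * w * t)).
  rewrite /F RintegralZl; last 2 first.
    exact: measurableT.
    by apply: integrable_laplace => //; exact: mc.
  rewrite laplace_fourier// /ewald_weight expRD (expRN (a ^+ 2)); field.
  by rewrite !gt_eqF ?expR_gt0// ltr_wpDr ?sqr_ge0 ?exprn_gt0.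
have Rr (u : R) : \int[mu]_t F t u = sqrtpi / 2 * (expR (- (2 * a * `|u|)) *
      (expR (- (u - w) ^+ 2) + expR (- (u + w) ^+ 2))).
  transitivity (\int[mu]_t (expR (- (2 * a * `|u|)) *
      (expR (- t ^+ 2) * cos (2 * w * t) * cos (2 * t * u)))).
    by apply: eq_Rintegral => t _; rewrite /F; ring.
  rewrite RintegralZl; last 2 first.
    exact: measurableT.
    under eq_fun do rewrite -mulrA.
    apply: integrable_gauss_trig; first by continuity.
    by move=> t; rewrite normrM mulr_ile1.
  by rewrite gauss_fourier_pair; ring.
move: FubF; under eq_Rintegral do rewrite L; under [RHS]eq_Rintegral do rewrite Rr.
rewrite RintegralZl; last 2 first.
  exact: measurableT.
  by apply: integrable_ewald => //; continuity.
rewrite RintegralZl; last 2 first.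
  exact: measurableT.
  exact: integrable_laplace_gauss.
rewrite -/(ewald_transform a w) => h.
set I := (X in _ = _ * X); rewrite -/I in h.
have E0 := expR_gt0 (a ^+ 2).
apply: (@mulfI _ (a * expR (a ^+ 2))); first by rewrite gt_eqF// mulr_gt0.
rewrite [LHS]h expRN; field.
by rewrite !gt_eqF.
Qed.

End ewald_kernel.

(** * Decay of the transform, uniformly in [a] *)

Section ewald_asymptotics.
Context {R : realType}.
Notation mu := (@lebesgue_measure R).
Local Notation sqrtpi := (Num.sqrt (pi : R)).

Lemma ewald_transformN (a w : R) : ewald_transform a (- w) = ewald_transform a w.
Proof.
by apply: eq_Rintegral => t _; rewrite mulrN mulNr cosN.
Qed.

(** With [v = |u|], this is the error made at [u] when the two-sided exponential is replaced by a
    one-sided one, weighted by [e^(-a^2)]. The right-hand side carries the factor [a] that cancels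
    the [1 / a] of the convolution formula, and a factor [e^(-v)] for the integration over [u]. *)
Lemma ewald_tail_pointwise (a w v : R) : 0 < a -> 2 <= w -> 0 <= v ->
  0 <= expR (- a ^+ 2) * ((expR (2 * a * v) - expR (- (2 * a * v))) * expR (- (v + w) ^+ 2))
    <= 4 * a * expR (1 - 2 * a - w ^+ 2) * expR (- v).
Proof.
move=> a0 w2 v0; have av0 : 0 <= 2 * a * v by rewrite !mulr_ge0// ltW.
have h1 : 0 <= expR (2 * a * v) - expR (- (2 * a * v)) by rewrite subr_ge0 ler_expR; lra.
apply/andP; split; first by rewrite !mulr_ge0 ?expR_ge0.
have h2 : expR (2 * a * v) - expR (- (2 * a * v)) <= 4 * a * v * expR (2 * a * v).
  have -> : expR (- (2 * a * v)) = expR (2 * a * v) * expR (- (4 * a * v)).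
    by rewrite -expRD; congr expR; ring.
  have := expR_ge1Dx (- (4 * a * v)); have := expR_gt0 (2 * a * v); nra.
have h3 : v <= expR v by have := expR_ge1Dx v; lra.
(* [(a - v - 1)^2 >= 0] bounds [-a^2 + 2 a v - v^2] by [1 - 2 a + 2 v], and [w >= 2] bounds the
   remaining [2 v - 2 v w] by [-2 v]. *)
have h4 : expR (- a ^+ 2) * (expR (2 * a * v) * expR (- (v + w) ^+ 2)) <=
    expR (1 - 2 * a - w ^+ 2) * expR (- (2 * v)).
  rewrite -!expRD ler_expR.
  have := sqr_ge0 (a - v - 1); nra.
apply: (@le_trans _ _ (4 * a * v * (expR (1 - 2 * a - w ^+ 2) * expR (- (2 * v))))).
  apply: le_trans
    (_ : _ <= 4 * a * v * (expR (- a ^+ 2) * (expR (2 * a * v) * expR (- (v + w) ^+ 2)))) _.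
    rewrite [leRHS](_ : _ = expR (- a ^+ 2) *
      (4 * a * v * expR (2 * a * v) * expR (- (v + w) ^+ 2))); last by ring.
    by rewrite ler_wpM2l ?expR_ge0// ler_wpM2r ?expR_ge0.
  by rewrite ler_wpM2l// !mulr_ge0// ltW.
rewrite [leLHS](_ : _ = 4 * a * expR (1 - 2 * a - w ^+ 2) * (v * expR (- (2 * v)))); last by ring.
apply: ler_wpM2l; first by rewrite !mulr_ge0 ?expR_ge0// ltW.
rewrite (_ : - (2 * v) = - v - v); last by ring.
rewrite expRD mulrA ler_piMl ?expR_ge0//.
by rewrite expRN ler_pdivrMr ?expR_gt0// mul1r.
Qed.

(** In the convolution, [e^(-2 a |u|)] is replaced by [e^(-2 a u)] for the Gaussian centred at [w]
    and by [e^(2 a u)] for the one centred at [-w]. The two tilted integrals are equal and explicit,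
    and together give [pi / a * e^(-2 a w)]; [D] is the error of the replacement. *)
Lemma ewald_transform_asymp (a w : R) : 0 < a -> 2 <= w ->
  `|ewald_transform a w - pi / a * expR (- (2 * a * w))| <=
  8 * pi * sqrtpi * expR 1 * (expR (- (2 * a)) * expR (- w ^+ 2)).
Proof.
move=> a0 w2.
have [i1 E1] := gauss_tilt a w.
have [i2 E2] := gauss_tilt (- a) (- w).
pose D (u : R) := expR (- (2 * a * `|u|)) *
      (expR (- (u - w) ^+ 2) + expR (- (u + w) ^+ 2)) -
   (expR (- (2 * a * u) - (u - w) ^+ 2) + expR (- (2 * - a * u) - (u - - w) ^+ 2)).
have i12 : mu.-integrable setT (EFin \o (fun u : R =>
    expR (- (2 * a * u) - (u - w) ^+ 2) + expR (- (2 * - a * u) - (u - - w) ^+ 2))).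
  by have := integrableD measurableT i1 i2.
have sp0 : 0 < pi :> R := pi_gt0 R.
have sp : sqrtpi * sqrtpi = pi by rewrite -expr2 sqr_sqrtr// ltW.
have E : ewald_transform a w - pi / a * expR (- (2 * a * w)) =
    sqrtpi * expR (- a ^+ 2) / (2 * a) * \int[mu]_u D u.
  rewrite RintegralB; [|exact: measurableT|exact: integrable_laplace_gauss|exact: i12].
  rewrite RintegralD; [|exact: measurableT|exact: i1|exact: i2].
  rewrite E1 E2 ewald_transform_convolution// mulrBr; congr (_ - _).
  rewrite (_ : (- a) ^+ 2 - 2 * - a * - w = a ^+ 2 - 2 * a * w); last by ring.
  rewrite -[in LHS]sp (expRD (a ^+ 2)) (expRN (a ^+ 2)); field.
  by rewrite !gt_eqF ?expR_gt0.
(* The constant [4 a] of the tail bound times the 4 of [expR_norm_le_lorentz]; [e^(a^2)] removes the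
   weight [e^(-a^2)] of the tail bound. *)
pose K := 16 * a * expR (1 - 2 * a - w ^+ 2) * expR (a ^+ 2).
have iD : mu.-integrable setT (EFin \o D).
  have := integrableB measurableT (integrable_laplace_gauss w a0) i12.
  by congr (integrable _ _ _).
have Dle (u : R) : `|D u| <= K / (1 + u ^+ 2).
  have := @ewald_tail_pointwise a w `|u| a0 w2 (normr_ge0 u).
  have -> : (expR (2 * a * `|u|) - expR (- (2 * a * `|u|))) * expR (- (`|u| + w) ^+ 2) = - D u.
    rewrite /D opprK !opprB.
    have [u0|u0] := leP 0 u.
      rewrite (ger0_norm u0) (_ : - (2 * - a * u) = 2 * a * u); last by ring.
      rewrite (expRD (2 * a * u)) (expRD (- (2 * a * u))); ring.
    rewrite (ltr0_norm u0).
    rewrite (_ : - (2 * - a * u) = 2 * a * u); last by ring.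
    rewrite (expRD (2 * a * u)) (expRD (- (2 * a * u))).
    rewrite (_ : - (2 * a * - u) = 2 * a * u); last by ring.
    rewrite (_ : 2 * a * - u = - (2 * a * u)); last by ring.
    rewrite (_ : (- u + w) ^+ 2 = (u - w) ^+ 2); last by ring.
    ring.
  move=> /andP[h1 h2].
  have e0 := expR_gt0 (- a ^+ 2).
  have h3 : 0 <= - D u by rewrite -(pmulr_rge0 _ e0).
  rewrite ler0_norm -?oppr_ge0//.
  rewrite -(ler_pM2l e0); apply: le_trans h2 _.
  rewrite /K (expRN (a ^+ 2)).
  have := expR_norm_le_lorentz u.
  have ea0 := expR_gt0 (a ^+ 2).
  move=> h.
  rewrite [leRHS](_ : _ = 4 * a * expR (1 - 2 * a - w ^+ 2) * (4 / (1 + u ^+ 2))); last first.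
    by field; rewrite !gt_eqF// ltr_wpDr ?sqr_ge0.
  by rewrite ler_wpM2l// !mulr_ge0 ?expR_ge0// ltW.
rewrite E normrM.
have mD : measurable_fun setT D by have /integrableP[/measurable_EFinP] := iD.
have := Rintegral_dominated mD Dle.
have c0 : 0 <= sqrtpi * expR (- a ^+ 2) / (2 * a).
  by rewrite divr_ge0 ?mulr_ge0 ?sqrtr_ge0 ?expR_ge0// ltW.
rewrite (ger0_norm c0) => /(ler_wpM2l c0) => /le_trans; apply.
rewrite /K (expRN (a ^+ 2)) -addrA expRD expRD le_eqVlt; apply/orP; left; apply/eqP.
by field; rewrite !gt_eqF ?expR_gt0.
Qed.

End ewald_asymptotics.

(** * Poisson summation *)

Section fejer_kernel.
Context {R : realType}.
Implicit Types (x y : R) (M : nat).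

(** Weaker than Jordan's bound [2 y / pi], but obtained without concavity: up to [pi / 4] the
    derivative is at least [1 / 2 >= 1 / pi], and beyond it [sin y >= 1 / 2 >= y / pi]. *)
Lemma sin_ge_linear y : 0 <= y <= pi / 2 -> y / pi <= sin y.
Proof.
move=> /andP[y0 y2]; have p0 := pi_gt0 R; have p2 := pi_ge2 R.
have hc : (2^-1 : R) <= cos (pi / 4).
  have := cos_mulr2n (pi / 4 : R).
  rewrite (_ : (pi / 4) *+ 2 = pi / 2 :> R); last by field.
  rewrite cos_pihalf => h.
  have c0 : 0 <= cos (pi / 4 : R) by apply: cos_ge0_pihalf; apply/andP; split; lra.
  by nra.
have [y4|y4] := leP y (pi / 4).
  move: y0; rewrite le_eqVlt => /predU1P[<-|y0]; first by rewrite sin0 mul0r.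
  have [c] := @MVT _ sin cos 0 y y0 (fun x _ => is_derive_sin x)
    (continuous_subspaceT (@continuous_sin R)).
  rewrite in_itv/= => /andP[c0 cy]; rewrite sin0 !subr0 => ->.
  have : cos (pi / 4) <= cos c.
    by apply/ltW; rewrite ltr_cos ?in_itv/=; [lra|apply/andP; split; lra..].
  move=> h; rewrite mulrC ler_wpM2r ?(ltW y0)//.
  apply: le_trans h; apply: le_trans hc.
  by rewrite lef_pV2 ?posrE.
have hs : (2^-1 : R) <= sin (pi / 4).
  have -> : sin (pi / 4 : R) = cos (pi / 4).
    by rewrite -cosBpihalf -cosN; congr cos; field.
  exact: hc.
have h : sin (pi / 4) <= sin y.
  by apply/ltW; rewrite ltr_sin ?in_itv/=; [lra|apply/andP; split; lra..].
apply: (@le_trans _ _ 2^-1); last exact: le_trans hs h.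
by rewrite ler_pdivrMr// mulrC.
Qed.

Lemma norm_sin_ge_linear y : `|y| <= pi / 2 -> `|y| / pi <= `|sin y|.
Proof.
move=> h; have -> : `|sin y| = `|sin `|y| |.
  by have [y0|y0] := leP 0 y; rewrite ?(ger0_norm y0)// (ltr0_norm y0) sinN normrN.
apply: le_trans (ler_norm _); apply: sin_ge_linear.
by rewrite normr_ge0.
Qed.

(** The squared modulus of [\sum_(k < M) e^(i k x)], divided by [M]. Nonnegativity is immediate in
    this form; [sum_dirichlet] recovers the mean of Dirichlet kernels. *)
Definition fejer M x : R :=
  ((\sum_(0 <= k < M) cos (k%:R * x)) ^+ 2 +
   (\sum_(0 <= k < M) sin (k%:R * x)) ^+ 2) / M%:R.

Definition dirichlet M x : R := 1 + 2 * \sum_(0 <= k < M) cos (k.+1%:R * x).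

Lemma fejer_ge0 M x : 0 <= fejer M x.
Proof. by rewrite divr_ge0 ?addr_ge0 ?sqr_ge0. Qed.

Lemma norm_sum_le_size (F : nat -> R) M : (forall k, `|F k| <= 1) ->
  (\sum_(0 <= k < M) F k) ^+ 2 <= M%:R ^+ 2.
Proof.
move=> F1; rewrite -real_normK ?num_real// lerXn2r ?nnegrE ?normr_ge0 ?ler0n//.
apply: le_trans (ler_norm_sum _ _ _) _.
apply: (@le_trans _ _ (\sum_(0 <= k < M) 1)); first exact: ler_sum.
by rewrite sumr_const_nat subn0.
Qed.

Lemma fejer_le M x : fejer M x <= 2 * M%:R.
Proof.
case: M => [|M]; first by rewrite /fejer invr0 !mulr0.
rewrite ler_pdivrMr ?ltr0n// -mulrA -expr2 mulr2n mulrDl mul1r lerD//.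
  by apply: norm_sum_le_size => k; exact: cos_max.
by apply: norm_sum_le_size => k; exact: sin_max.
Qed.

(** The closed form [sin(M x / 2)^2 / (M sin(x / 2)^2)] written without a quotient, hence valid also
    at the multiples of [2 pi]. *)
Lemma fejer_cos M x : (1 - cos x) * (fejer M x * M%:R) = 1 - cos (M%:R * x).
Proof.
case: M => [|M]; first by rewrite mulr0 mul0r cos0 subrr mulr0.
rewrite /fejer divfK ?pnatr_eq0//.
(* Real and imaginary parts of the geometric sum identity: [\sum_(k < n) e^(i k x)] times
   [1 - e^(i x)] is [1 - e^(i n x)]. *)
have [A B] : (\sum_(0 <= k < M.+1) cos (k%:R * x)) * (1 - cos x) +
      (\sum_(0 <= k < M.+1) sin (k%:R * x)) * sin x = 1 - cos (M.+1%:R * x) /\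
    (\sum_(0 <= k < M.+1) sin (k%:R * x)) * (1 - cos x) -
      (\sum_(0 <= k < M.+1) cos (k%:R * x)) * sin x = - sin (M.+1%:R * x).
  elim: (M.+1) => [|n [IH1 IH2]].
    by rewrite !big_nil !mul0r cos0 sin0; split; ring.
  rewrite !big_nat_recr//= (_ : n.+1%:R * x = n%:R * x + x); last by rewrite -natr1; ring.
  rewrite cosD sinD; move: IH1 IH2.
  move: (\sum_(0 <= k < n) cos _) (\sum_(0 <= k < n) sin _) => C S IH1 IH2.
  by split; lra.
move: A B; set C := \sum_(_ <= _ < _) cos _; set S := \sum_(_ <= _ < _) sin _.
set c := cos (_ * x); set s := sin (_ * x) => A B.
have h1 : c ^+ 2 + s ^+ 2 = 1 by rewrite cos2Dsin2.
have h2 := cos2Dsin2 x.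
nra.
Qed.

(** Adding the term [e^(i n x)] raises the squared modulus by 1 plus twice the cross terms
    [cos ((n - k) x)], [k < n]: this is the Dirichlet kernel of order [n]. *)
Lemma sum_dirichlet M x :
  (\sum_(0 <= k < M) cos (k%:R * x)) ^+ 2 +
  (\sum_(0 <= k < M) sin (k%:R * x)) ^+ 2 = \sum_(0 <= k < M) dirichlet k x.
Proof.
elim: M => [|n IH]; first by rewrite !big_nil expr0n/= addr0.
rewrite !big_nat_recr//= -IH.
have E : (\sum_(0 <= k < n) cos (k%:R * x)) * cos (n%:R * x) +
    (\sum_(0 <= k < n) sin (k%:R * x)) * sin (n%:R * x) =
    \sum_(0 <= k < n) cos (k.+1%:R * x).
  rewrite !mulr_suml -big_split/= big_nat_rev/= !big_nat.
  apply: eq_bigr => k /= kn; rewrite add0n -cosB -mulrBl -cosN -mulNr opprB.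
  by rewrite -natrB ?leq_subr// subKn.
rewrite /dirichlet -E; have := cos2Dsin2 (n%:R * x).
set c := cos (n%:R * x); set s := sin (n%:R * x) => h.
by move: (\sum_(0 <= k < n) cos _) (\sum_(0 <= k < n) sin _) => C S; lra.
Qed.

End fejer_kernel.

(** * Cutting the line into cells around the nodes *)

Section poisson_summation.
Context {R : realType}.
Notation mu := (@lebesgue_measure R).
Notation RT := (measurableTypeR R).

Lemma integrable_sum_nat (D : set RT) (F : nat -> R -> R) N : measurable D ->
  (forall k, mu.-integrable D (EFin \o F k)) ->
  mu.-integrable D (EFin \o (fun x => \sum_(0 <= k < N) F k x)).
Proof.
move=> mD Fi; elim: N => [|N IH].
  under eq_fun do rewrite big_nil.
  exact: integrable0.
under eq_fun do rewrite big_nat_recr//=.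
by have := integrableD mD IH (Fi N).
Qed.

Lemma Rintegral_sum_nat (D : set RT) (F : nat -> R -> R) N : measurable D ->
  (forall k, mu.-integrable D (EFin \o F k)) ->
  \int[mu]_(x in D) (\sum_(0 <= k < N) F k x) =
  \sum_(0 <= k < N) \int[mu]_(x in D) F k x.
Proof.
move=> mD Fi; elim: N => [|N IH].
  under eq_Rintegral do rewrite big_nil.
  by rewrite Rintegral_cst// mul0r big_nil.
under eq_Rintegral do rewrite big_nat_recr//=.
by rewrite RintegralD// ?IH ?big_nat_recr//; exact: integrable_sum_nat.
Qed.

Lemma continuous_sum_nat (F : nat -> R -> R) N : (forall k, continuous (F k)) ->
  continuous (fun x => \sum_(0 <= k < N) F k x).
Proof. by move=> Fc x; apply: cvg_sumr => k; exact: Fc. Qed.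

(** Each node [n d] is the centre of a closed cell of length [d], one period of the rescaled Fejer
    kernel with its peak in the middle. Neighbours share an endpoint, a null set. *)
Definition cell (d : R) (n : int) : set RT :=
  `[(n%:~R - 2^-1) * d, (n%:~R + 2^-1) * d]%classic.

Lemma measurable_cell d n : measurable (cell d n).
Proof. exact: measurable_itv. Qed.

Lemma integrable_cell (d : R) n (h : R -> R) : mu.-integrable setT (EFin \o h) ->
  mu.-integrable (cell d n) (EFin \o h).
Proof.
exact: (@integrableS _ _ R mu setT (cell d n) _ measurableT (measurable_cell d n) (@subsetT _ _)).
Qed.

Lemma cell_le (d : R) n : 0 < d -> (n%:~R - 2^-1) * d <= (n%:~R + 2^-1) * d.
Proof. by move=> d0; rewrite ler_pM2r//; lra. Qed.

Lemma sum_cells (d : R) (h : R -> R) N : 0 < d -> mu.-integrable setT (EFin \o h) ->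
  \sum_(0 <= k < N) (\int[mu]_(x in cell d (Posz k)) h x +
                     \int[mu]_(x in cell d (Negz k)) h x) =
  \int[mu]_(x in `[(- N%:R - 2^-1) * d, (N%:R - 2^-1) * d]) h x.
Proof.
move=> d0 hi; elim: N => [|N IH].
  by rewrite big_nil oppr0 set_itv1 Rintegral_set1.
rewrite big_nat_recr//= IH.
have N0 : 0 <= N%:R :> R by [].
have SN : N.+1%:R = N%:R + 1 :> R by rewrite -natr1.
have l1 : (- N.+1%:R - 2^-1) * d <= (- N%:R - 2^-1) * d by rewrite SN ler_pM2r//; lra.
have l2 : (- N%:R - 2^-1) * d <= (N%:R - 2^-1) * d by rewrite ler_pM2r//; lra.
have l3 : (N%:R - 2^-1) * d <= (N.+1%:R - 2^-1) * d by rewrite SN ler_pM2r//; lra.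
rewrite (Rintegral_split l1 (le_trans l2 l3) hi) (Rintegral_split l2 l3 hi).
have E (a b a' b' : R) : a = a' -> b = b' ->
  \int[mu]_(x in `[a, b]) h x = \int[mu]_(x in `[a', b']) h x by move=> -> ->.
rewrite [LHS]addrA [LHS]addrC.
congr (_ + (_ + _)).
- apply: E; rewrite NegzE mulrNz -pmulrn SN; lra.
- by apply: E; rewrite -pmulrn ?SN; lra.
Qed.

Lemma abs_bounded_cells (d : R) (h : R -> R) : 0 < d -> mu.-integrable setT (EFin \o h) ->
  abs_bounded (fun n => \int[mu]_(x in cell d n) h x) (\int[mu]_x `|h x|).
Proof.
move=> d0 hi.
have ai : mu.-integrable setT (EFin \o (fun x => `|h x|)) by have := integrable_norm hi.
apply: abs_bounded_int => N.
apply: (@le_trans _ _ (\sum_(0 <= k < N) (\int[mu]_(x in cell d (Posz k)) `|h x| +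
                     \int[mu]_(x in cell d (Negz k)) `|h x|))).
  apply: ler_sum => k _.
  by apply: lerD; exact: (le_normr_Rintegral (measurable_cell d _) (integrable_cell d _ hi)).
rewrite sum_cells// Rintegral_mkcond; apply: le_Rintegral => //.
  apply: (@integrable_le _ _ _ (fun x => `|h x|)) => //.
    apply/(measurable_restrictT _ _).1 => //; apply: measurable_funTS.
    by have /integrableP[/measurable_EFinP] := ai.
  by move=> x _; rewrite patchE; case: ifP; rewrite ?normr0 ?normr_id.
by move=> x _; rewrite patchE; case: ifPn => _ //; exact: normr_ge0.
Qed.

Lemma has_sum_cells (d : R) (h : R -> R) : 0 < d -> mu.-integrable setT (EFin \o h) ->
  has_sum (fun n => \int[mu]_(x in cell d n) h x) (\int[mu]_x h x).
Proof.
move=> d0 hi.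
have [s [hs _]] := abs_bounded_has_sum (abs_bounded_cells d0 hi).
have := cvg_int_fset hs; under eq_fun do rewrite sum_cells//; move=> h1.
suff h2 : \int[mu]_(x in `[(- N%:R - 2^-1) * d, (N%:R - 2^-1) * d]) h x @[N --> \oo] -->
    \int[mu]_x h x.
  by rewrite -(cvg_unique _ h1 h2).
apply: cvg_Rintegral_itv => //.
- apply/cvgrNyPle => A; near=> N.
  rewrite -ler_pdivlMr// lerBlDr -lerNl opprD; near: N; exact: nbhs_infty_ger.
- apply/cvgryPge => A; near=> N.
  rewrite -ler_pdivrMr// lerBrDr; near: N; exact: nbhs_infty_ger.
Unshelve. all: by end_near. Qed.

End poisson_summation.

(** * Mass and concentration of the Fejer kernel on a cell *)

Section fejer_kernel_cells.
Context {R : realType}.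
Notation mu := (@lebesgue_measure R).

Lemma sin_periodic_nat (x : R) k : sin (x + 2 * pi * k%:R) = sin x.
Proof.
have := periodicn (@sinD2pi R) k x.
by rewrite (_ : (pi *+ 2) *+ k = 2 * pi * k%:R)// -[in LHS]mulr_natr mulr2n; ring.
Qed.

Lemma cos_periodic_nat (x : R) k : cos (x + 2 * pi * k%:R) = cos x.
Proof.
have := periodicn (@cosD2pi R) k x.
by rewrite (_ : (pi *+ 2) *+ k = 2 * pi * k%:R)// -[in LHS]mulr_natr mulr2n; ring.
Qed.

Lemma cos_periodic_int (x : R) (n : int) : cos (x + 2 * pi * n%:~R) = cos x.
Proof.
case: n => k; first exact: cos_periodic_nat.
rewrite NegzE mulrNz -[LHS](cos_periodic_nat _ k.+1); congr cos.
by rewrite -pmulrn; ring.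
Qed.

Lemma continuous_integrable_itv (f : R -> R) a b : continuous f ->
  mu.-integrable `[a, b] (EFin \o f).
Proof.
move=> cf; apply: continuous_compact_integrable; first exact: segment_compact.
exact: continuous_subspaceT.
Qed.

Lemma Rintegral_dirichlet_cell (d : R) (n : int) M : 0 < d ->
  \int[mu]_(t in cell d n) dirichlet M (2 * pi / d * t) = d.
Proof.
move=> d0; have p0 := pi_gt0 R.
have c1 k : continuous (fun t : R => cos (k.+1%:R * (2 * pi / d * t))) by continuity.
have ci k : mu.-integrable (cell d n) (EFin \o (fun t : R => cos (k.+1%:R * (2 * pi / d * t)))).
  exact: continuous_integrable_itv.
rewrite RintegralD; last 3 first.
- exact: measurable_cell.
- by apply: continuous_integrable_itv => t; exact: cvg_cst.
- apply: integrableMl_const; first exact: measurable_cell.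
  by apply: integrable_sum_nat => //; exact: measurable_cell.
rewrite RintegralZl; last 2 first.
- exact: measurable_cell.
- by apply: integrable_sum_nat => //; exact: measurable_cell.
rewrite Rintegral_sum_nat//; last exact: measurable_cell.
rewrite big1 => [|k _].
  rewrite mulr0 addr0 (@Rintegral_FTC _ (fun=> 1) (fun t => t) _ _ (cell_le n d0)).
  - by field.
  - by move=> t; exact: cvg_cst.
have k0 : 0 < k.+1%:R :> R by [].
pose S (t : R) := sin (k.+1%:R * (2 * pi / d * t)) / (k.+1%:R * (2 * pi / d)).
have dS (t : R) : is_derive t 1 S (cos (k.+1%:R * (2 * pi / d * t))).
  rewrite /S; have : 2 * pi / d != 0 by rewrite gt_eqF// divr_gt0// mulr_gt0.
  move: (2 * pi / d) (k.+1%:R) k0 => w K K0 w0; derive; field.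
  by rewrite w0 gt_eqF.
rewrite (Rintegral_FTC (cell_le n d0) (c1 k) dS) /S.
rewrite -mulrBl; apply/eqP; rewrite mulf_eq0; apply/orP; left; rewrite subr_eq0.
apply/eqP; rewrite -[RHS](sin_periodic_nat _ k.+1); congr sin.
by move: (pi : R) (k.+1%:R : R) => p K; field; rewrite gt_eqF.
Qed.

Lemma continuous_dirichlet (c : R) M : continuous (fun t : R => dirichlet M (c * t)).
Proof.
move=> t; apply: cvgD; first exact: cvg_cst.
apply: cvgM; first exact: cvg_cst.
apply: (@continuous_sum_nat R (fun k t => cos (k.+1%:R * (c * t)))) => k.
by continuity.
Qed.

Lemma fejerE (M : nat) (x : R) : fejer M.+1 x =
  M.+1%:R^-1 * \sum_(0 <= k < M.+1) dirichlet k x.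
Proof. by rewrite /fejer mulrC sum_dirichlet. Qed.

Lemma continuous_fejer (c : R) M : continuous (fun t : R => fejer M.+1 (c * t)).
Proof.
under eq_fun do rewrite fejerE.
move=> t; apply: cvgM; first exact: cvg_cst.
apply: (@continuous_sum_nat R (fun k t => dirichlet k (c * t))) => k.
exact: continuous_dirichlet.
Qed.

Lemma Rintegral_fejer_cell (d : R) (n : int) M : 0 < d ->
  \int[mu]_(t in cell d n) fejer M.+1 (2 * pi / d * t) = d.
Proof.
move=> d0; under eq_Rintegral do rewrite fejerE.
have di k : mu.-integrable (cell d n) (EFin \o (fun t => dirichlet k (2 * pi / d * t))).
  by apply: continuous_integrable_itv; exact: continuous_dirichlet.
rewrite RintegralZl; last 2 first.
- exact: measurable_cell.
- by apply: integrable_sum_nat => //; exact: measurable_cell.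
rewrite Rintegral_sum_nat//; last exact: measurable_cell.
under eq_bigr do rewrite Rintegral_dirichlet_cell//.
by rewrite sumr_const_nat subn0 -[d *+ _]mulr_natl mulKf// pnatr_eq0.
Qed.

(** The second bound gives convergence to 0 away from the node, the first a majorant independent of
    [M]. The powers of the distance are there because a Lipschitz difference contributes one such
    factor. *)
Lemma fejer_distance (d t : R) (n : int) M : 0 < d -> cell d n t ->
  `|t - n%:~R * d| * fejer M.+1 (2 * pi / d * t) <= 2 * d /\
  `|t - n%:~R * d| ^+ 2 * fejer M.+1 (2 * pi / d * t) <= d ^+ 2 / M.+1%:R.
Proof.
move=> d0; rewrite /cell/= in_itv/= => /andP[t1 t2].
have p0 := pi_gt0 R.
set u := t - n%:~R * d.
have ud : `|u| <= d / 2 by rewrite /u ler_norml; apply/andP; split; lra.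
set F := fejer _ _.
have F0 : 0 <= F by exact: fejer_ge0.
have F1 : F <= 2 * M.+1%:R by exact: fejer_le.
have M0 : 0 < M.+1%:R :> R by [].
set m := M.+1%:R in F1 M0 *.
have cosE : cos (2 * pi / d * t) = 1 - 2 * sin (pi / d * u) ^+ 2.
  rewrite sin2cos2 (_ : 2 * pi / d * t = (pi / d * u) *+ 2 + 2 * pi * n%:~R); last first.
    by rewrite /u mulr2n; field; rewrite gt_eqF.
  rewrite cos_periodic_int cos_mulr2n; ring.
have FM : 2 * sin (pi / d * u) ^+ 2 * (F * m) <= 2.
  have := fejer_cos M.+1 (2 * pi / d * t); rewrite cosE -/F -/m opprB addrC subrK => ->.
  by have := cos_geN1 (m * (2 * pi / d * t)); lra.
have sinu : `|u| / d <= `|sin (pi / d * u)|.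
  have pd : 0 < pi / d by rewrite divr_gt0.
  have := @norm_sin_ge_linear R (pi / d * u).
  rewrite normrM (gtr0_norm pd) => h.
  have -> : `|u| / d = pi / d * `|u| / pi.
    by move: (pi : R) p0 => p p0; field; rewrite !gt_eqF.
  apply: h; rewrite -[leRHS](_ : pi / d * (d / 2) = pi / 2); last first.
    by move: (pi : R) => p; field; rewrite gt_eqF.
  by rewrite ler_pM2l.
have sq : (`|u| / d) ^+ 2 <= sin (pi / d * u) ^+ 2.
  by rewrite -[leRHS]real_normK ?num_real// lerXn2r ?nnegrE// divr_ge0// ltW.
have h2 : `|u| ^+ 2 * F <= d ^+ 2 / m.
  rewrite ler_pdivlMr//.
  have -> : `|u| ^+ 2 * F * m = d ^+ 2 * ((`|u| / d) ^+ 2 * (F * m)) by field; rewrite gt_eqF.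
  rewrite -[leRHS]mulr1 ler_wpM2l ?sqr_ge0//.
  have : 0 <= F * m by rewrite mulr_ge0// ltW.
  nra.
split => //.
(* The first bound is the geometric mean of the second one and of [F <= 2 m], in which [m]
   cancels. *)
have h3 : (`|u| * F) ^+ 2 <= (2 * d) ^+ 2.
  have -> : (`|u| * F) ^+ 2 = (`|u| ^+ 2 * F) * F by ring.
  apply: (@le_trans _ _ (d ^+ 2 / m * (2 * m))).
    by apply: ler_pM => //; rewrite mulr_ge0.
  rewrite (_ : _ * _ = d ^+ 2 * 2); last by field; rewrite gt_eqF.
  nra.
by rewrite -(@ler_pXn2r _ 2)// nnegrE mulr_ge0// ltW.
Qed.

End fejer_kernel_cells.

(** * The Poisson summation formula *)

Section poisson_formula.
Context {R : realType}.
Notation mu := (@lebesgue_measure R).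
Notation RT := (measurableTypeR R).

Lemma has_sum_lorentz_cells (d : R) : 0 < d ->
  abs_bounded (fun n => \int[mu]_(x in cell d n) (1 + x ^+ 2)^-1) pi.
Proof.
move=> d0 B; apply: le_trans (abs_bounded_cells d0 (@integrable_lorentz R) B) _.
rewrite -Rintegral_lorentz le_eqVlt; apply/orP; left; apply/eqP.
by apply: eq_Rintegral => x _; rewrite ger0_norm// ltW ?lorentz_gt0.
Qed.

(** Two points of a cell are at distance at most [d], so [1 + x^2 <= (2 + 2 d^2) (1 + t^2)]. Point
    values are thereby bounded by integrals over cells, which are summable. *)
Lemma le_cell_lorentz (d t : R) n : 0 < d -> cell d n t ->
  d / (1 + t ^+ 2) <= (2 + 2 * d ^+ 2) * \int[mu]_(x in cell d n) (1 + x ^+ 2)^-1.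
Proof.
move=> d0 tn; rewrite -RintegralZl; last 2 first.
- exact: measurable_cell.
- exact: integrable_cell (@integrable_lorentz R).
have c1 : continuous (fun _ : R => (1 + t ^+ 2)^-1) by move=> x; exact: cvg_cst.
have -> : d / (1 + t ^+ 2) = \int[mu]_(x in cell d n) (1 + t ^+ 2)^-1.
  have dL (x : R) : is_derive x 1 (fun x : R => x * (1 + t ^+ 2)^-1) (1 + t ^+ 2)^-1.
    by derive; ring.
  by rewrite (Rintegral_FTC (cell_le n d0) c1 dL) -mulrBl; congr (_ * _); field.
apply: le_Rintegral.
- exact: measurable_cell.
- exact: continuous_integrable_itv.
- apply: integrableMl_const; first exact: measurable_cell.
  exact: integrable_cell (@integrable_lorentz R).
move=> x; move: tn; rewrite /cell/= !in_itv/= => /andP[t1 t2] /andP[x1 x2].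
rewrite ler_pdivlMr ?ltr_wpDr ?sqr_ge0// mulrC ler_pdivrMr ?ltr_wpDr ?sqr_ge0//.
have h : `|x - t| <= d by rewrite ler_norml; apply/andP; split; lra.
have h2 : (x - t) ^+ 2 <= d ^+ 2.
  by rewrite -real_normK ?num_real// lerXn2r ?nnegrE ?normr_ge0// ltW.
have := sqr_ge0 (x - 2 * t); have := sqr_ge0 d; have := sqr_ge0 (d * t); nra.
Qed.

(* The integral of [f] against the Fejer kernel tends, cell by cell, to the sum over the
   nodes, and it is a Cesaro mean of the Fourier partial sums, which tends to [s]. *)
Lemma poisson_summation (f : R -> R) (d C K s : R) : 0 < d -> continuous f ->
  (forall x y, `|f x - f y| <= K * `|x - y|) ->
  (forall t, `|f t| <= C / (1 + t ^+ 2)) ->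
  let c (k : nat) := \int[mu]_t (f t * cos (k%:R * (2 * pi / d * t))) in
  c 0%N + 2 * \sum_(0 <= k < M) c k.+1 @[M --> \oo] --> s ->
  has_sum (fun n : int => d * f (n%:~R * d)) s.
Proof.
move=> d0 cf fK fC c cs.
have C0 : 0 <= C.
  have := le_trans (normr_ge0 _) (fC 0); rewrite expr0n/= addr0 invr1 mulr1//.
have K0 : 0 <= K.
  have := le_trans (normr_ge0 _) (fK 1 0); rewrite subr0 normr1 mulr1//.
pose w := 2 * pi / d.
pose F M t := fejer M.+1 (w * t).
have F0 M t : 0 <= F M t by exact: fejer_ge0.
have cF M : continuous (F M) by exact: continuous_fejer.
have mf : measurable_fun (setT : set RT) f by exact: continuous_measurable_fun.
have mF M : measurable_fun (setT : set RT) (F M) by exact: continuous_measurable_fun.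
have fFi M : mu.-integrable setT (EFin \o (fun t => f t * F M t)).
  apply: (@integrable_dominated _ _ _ (C * (2 * M.+1%:R))) => //.
    exact: measurable_funM.
  move=> t; rewrite normrM (ger0_norm (F0 _ _)) mulrAC.
  by apply: ler_pM => //; exact: fejer_le.
have fci k : mu.-integrable setT (EFin \o (fun t => f t * cos (k%:R * (w * t)))).
  apply: (@integrable_dominated _ _ _ C) => //.
    by apply: measurable_funM => //; apply: continuous_measurable_fun; continuity.
  by move=> t; rewrite normrM (le_trans _ (fC t))// ler_piMr// cos_max.
pose G M := \int[mu]_t (f t * F M t).
have GE M : G M = arithmetic_mean (fun M => c 0%N + 2 * \sum_(0 <= k < M) c k.+1) M.
  have fDE k t : f t * dirichlet k (w * t) = f t * cos (0%:R * (w * t)) +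
      2 * \sum_(0 <= j < k) f t * cos (j.+1%:R * (w * t)).
    by rewrite /dirichlet mul0r cos0 -mulr_sumr; ring.
  have i1 k : mu.-integrable setT (EFin \o
      (fun t => 2 * \sum_(0 <= j < k) f t * cos (j.+1%:R * (w * t)))).
    by apply: integrableMl_const => //; apply: integrable_sum_nat => // j; exact: fci.
  have fDi k : mu.-integrable setT (EFin \o (fun t => f t * dirichlet k (w * t))).
    under eq_fun do rewrite fDE.
    by have := integrableD measurableT (fci 0%N) (i1 k).
  have fDI k : \int[mu]_t (f t * dirichlet k (w * t)) = c 0%N + 2 * \sum_(0 <= j < k) c j.+1.
    under eq_Rintegral do rewrite fDE.
    rewrite RintegralD; [|exact: measurableT|exact: fci|exact: i1].
    rewrite RintegralZl; [|exact: measurableT|].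
      by rewrite Rintegral_sum_nat.
    by apply: integrable_sum_nat => // j; exact: fci.
  rewrite /G /arithmetic_mean/=.
  transitivity (\int[mu]_t (M.+1%:R^-1 * \sum_(0 <= k < M.+1) f t * dirichlet k (w * t))).
    by apply: eq_Rintegral => t _; rewrite /F fejerE mulrCA mulr_sumr.
  rewrite RintegralZl; [|exact: measurableT|exact: integrable_sum_nat].
  rewrite Rintegral_sum_nat//; congr (_ * _).
  by apply: eq_bigr => k _; exact: fDI.
have Gs : G M @[M --> \oo] --> s.
  by rewrite (_ : G = arithmetic_mean (fun M => c 0%N + 2 * \sum_(0 <= k < M) c k.+1));
    [exact: cesaro|exact/funext].
pose A M n := \int[mu]_(t in cell d n) (f t * F M t).
have AG M : has_sum (A M) (G M) by exact: has_sum_cells.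
(* The majorant for [tannery]: the integral of [F M] over a cell is [d], so [|A M n|] is at most [d]
   times any bound of [|f|] on the cell. *)
pose B n := C * (2 + 2 * d ^+ 2) * \int[mu]_(x in cell d n) (1 + x ^+ 2)^-1.
have Bb := abs_boundedZ (C * (2 + 2 * d ^+ 2)) (has_sum_lorentz_cells d0).
have fB n t : cell d n t -> d * `|f t| <= B n.
  move=> nt; rewrite /B -mulrA; apply: le_trans (ler_wpM2l C0 (le_cell_lorentz d0 nt)).
  by rewrite mulrCA ler_wpM2l// ltW.
have AB M n : `|A M n| <= B n.
  apply: le_trans (le_normr_Rintegral (measurable_cell d n) (integrable_cell d n (fFi M))) _.
  have -> : B n = \int[mu]_(t in cell d n) (B n / d * F M t).
    rewrite RintegralZl; [|exact: measurable_cell|].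
      by rewrite Rintegral_fejer_cell// divfK// gt_eqF.
    by apply: continuous_integrable_itv.
  apply: le_Rintegral.
  - exact: measurable_cell.
  - by have := integrable_norm (integrable_cell d n (fFi M)).
  - by apply: integrableMl_const; [exact: measurable_cell|exact: continuous_integrable_itv].
  - move=> t nt; rewrite normrM (ger0_norm (F0 _ _)) ler_wpM2r//.
    by rewrite ler_pdivlMr// mulrC fB.
have node n : cell d n (n%:~R * d).
  by rewrite /cell/= in_itv/= !ler_pM2r//; apply/andP; split; lra.
have Alim n : A M n @[M --> \oo] --> d * f (n%:~R * d).
  pose D M t := (f t - f (n%:~R * d)) * F M t.
  have cD M : continuous (D M).
    move=> t; apply: cvgM; last exact: cF.
    by apply: cvgB; [exact: cf|exact: cvg_cst].
  have AE M : A M n = d * f (n%:~R * d) + \int[mu]_(t in cell d n) D M t.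
    have -> : d * f (n%:~R * d) = \int[mu]_(t in cell d n) (f (n%:~R * d) * F M t).
      rewrite RintegralZl; [|exact: measurable_cell|exact: continuous_integrable_itv].
      by rewrite Rintegral_fejer_cell// mulrC.
    rewrite -RintegralD.
    - by apply: eq_Rintegral => t _; rewrite /D; ring.
    - exact: measurable_cell.
    - by apply: integrableMl_const; [exact: measurable_cell|exact: continuous_integrable_itv].
    - exact: continuous_integrable_itv.
  (* By the Lipschitz bound, [|D M t|] is at most [K |t - n d| F M t]: this tends to 0 off the node
     and never exceeds [2 K d]. *)
  suff D0 : \int[mu]_(t in cell d n) D M t @[M --> \oo] --> 0.
    under eq_fun do rewrite AE.
    have h : d * f (n%:~R * d) + \int[mu]_(t in cell d n) D M t @[M --> \oo]
        --> d * f (n%:~R * d) + 0 by apply: cvgD D0; exact: cvg_cst.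
    by rewrite addr0 in h.
  have -> : 0 = \int[mu]_(t in cell d n) (0 : R).
    by rewrite Rintegral_cst ?mul0r//; exact: measurable_cell.
  apply: (@dominated_cvg_Rintegral _ _ D (fun=> 0) (fun=> K * (2 * d))).
  - exact: measurable_cell.
  - by move=> M; apply: measurable_funTS; exact: continuous_measurable_fun.
  - move=> t nt; have [->|tn] := eqVneq t (n%:~R * d).
      under eq_fun do rewrite /D subrr mul0r.
      exact: cvg_cst.
    have u0 : 0 < `|t - n%:~R * d| by rewrite normr_gt0 subr_eq0.
    set u := `|_| in u0.
    apply/norm_cvg0P.
    have h : K * (d ^+ 2 / u) * M.+1%:R^-1 @[M --> \oo] --> K * (d ^+ 2 / u) * 0.
      by apply: cvgM; [exact: cvg_cst|exact: cvg_harmonic].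
    rewrite mulr0 in h.
    apply: (@squeeze_cvgr _ _ _ _ (cst 0) _ _ _ _ (@cvg_cst _ _ _ _ _) h).
    apply: nearW => M; rewrite normr_ge0/= /D normrM (ger0_norm (F0 _ _)).
    have [_] := fejer_distance M d0 nt; rewrite -/u -/w -/(F M t) => h2.
    apply: (@le_trans _ _ (K * u * F M t)); first by rewrite ler_wpM2r// fK.
    have -> : K * u * F M t = K * u^-1 * (u ^+ 2 * F M t) by field; rewrite gt_eqF.
    have -> : K * (d ^+ 2 / u) * M.+1%:R^-1 = K * u^-1 * (d ^+ 2 / M.+1%:R) by ring.
    by rewrite ler_wpM2l// mulr_ge0// invr_ge0 ltW.
  - by apply: continuous_integrable_itv => t; exact: cvg_cst.
  - move=> M t nt; rewrite /D normrM (ger0_norm (F0 _ _)).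
    have [h _] := fejer_distance M d0 nt.
    apply: (@le_trans _ _ (K * `|t - n%:~R * d| * F M t)); first by rewrite ler_wpM2r// fK.
    by rewrite -mulrA ler_wpM2l.
have limB n : `|d * f (n%:~R * d)| <= B n.
  by rewrite normrM (gtr0_norm d0); exact: fB.
(* The node values have some sum [S] by absolute summability; [tannery] makes it the limit of [G],
   and uniqueness of limits identifies it with [s]. *)
have [S [hS _]] : exists S, has_sum (fun n : int => d * f (n%:~R * d)) S /\
    `|S| <= `|C * (2 + 2 * d ^+ 2)| * pi.
  apply: abs_bounded_has_sum; apply: abs_bounded_le Bb => n.
  exact: le_trans (limB n) (ler_norm _).
have GS := tannery Bb AB Alim AG hS.
by rewrite (cvg_unique _ Gs GS).
Qed.

End poisson_formula.

(** * The trapezoidal rule for the Ewald kernel *)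

Section ewald_trapezoidal.
Context {R : realType}.
Notation mu := (@lebesgue_measure R).
Local Notation sqrtpi := (Num.sqrt (pi : R)).

(** The sequence is extended by zero to the negative integers, so that the results on unordered sums
    over [int] apply to it. *)
Lemma bounded_series (u : nat -> R) M : (forall N, \sum_(0 <= k < N) `|u k| <= M) ->
  exists s, (\sum_(0 <= k < N) u k) @[N --> \oo] --> s /\ `|s| <= M.
Proof.
move=> uM; pose v (n : int) := if n is Posz k then u k else 0.
have vM : abs_bounded v M.
  apply: abs_bounded_int => N; apply: le_trans (uM N).
  by apply: ler_sum => k _; rewrite normr0 addr0.
have [s [vs sM]] := abs_bounded_has_sum vM; exists s; split => //.
have := cvg_int_fset vs.
by under eq_fun do under eq_bigr do rewrite addr0.
Qed.

Lemma derivative_lipschitz (f f' : R -> R) K : (forall x : R, is_derive x 1 f (f' x)) ->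
  (forall x, `|f' x| <= K) -> forall x y, `|f x - f y| <= K * `|x - y|.
Proof.
move=> df fK.
have h x y : x < y -> `|f x - f y| <= K * `|x - y|.
  move=> xy; have [c _] := MVT xy (fun x _ => df x)
    (continuous_subspaceT (is_derive_continuous df)).
  by rewrite distrC => ->; rewrite normrM distrC ler_wpM2r.
move=> x y; have [xy|xy|->] := ltgtP x y; first exact: h.
  by rewrite distrC [X in _ * X]distrC; exact: h.
by rewrite !subrr normr0 mulr0.
Qed.

(** [K] may grow without bound as [a -> 0]; this is harmless, since it is only a hypothesis of
    [poisson_summation] and enters no error estimate. *)
Lemma ewald_weight_lipschitz (a z : R) : 0 < a -> exists K, forall x y,
  `|ewald_weight a x * cos (2 * z * x) - ewald_weight a y * cos (2 * z * y)| <= K * `|x - y|.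
Proof.
move=> a0; have a20 : 0 < a ^+ 2 by rewrite exprn_gt0.
pose g t := - (2 * t * expR (- a ^+ 2 - t ^+ 2) * ((a ^+ 2 + t ^+ 2)^-1 + (a ^+ 2 + t ^+ 2) ^- 2)).
pose g' t := g t * cos (2 * z * t) - 2 * z * ewald_weight a t * sin (2 * z * t).
exists (2 * 4 * (a ^- 2 + (a ^+ 2) ^- 2) + 2 * `|z| * a ^- 2).
have X0 t : 0 < a ^+ 2 + t ^+ 2 by rewrite ltr_wpDr ?sqr_ge0.
apply: (@derivative_lipschitz _ g').
  move=> t; rewrite /g' /g /ewald_weight; derive; first by rewrite gt_eqF.
  by field; rewrite gt_eqF.
move=> t; have Xa : (a ^+ 2 + t ^+ 2)^-1 <= a ^- 2.
  by rewrite lef_pV2 ?posrE// lerDl sqr_ge0.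
have X2a : (a ^+ 2 + t ^+ 2)^- 2 <= (a ^+ 2)^- 2.
  rewrite lef_pV2 ?posrE ?exprn_gt0// lerXn2r ?nnegrE ?(ltW a20) ?(ltW (X0 t))//.
  by rewrite lerDl sqr_ge0.
have gt : `|g t| <= 2 * 4 * (a ^- 2 + (a ^+ 2) ^- 2).
  rewrite /g normrN !normrM (ger0_norm (expR_ge0 _)) ger0_norm//.
  rewrite (ger0_norm (x := _ + _)); last first.
    by rewrite addr_ge0// invr_ge0 ?sqr_ge0// ltW.
  apply: ler_pM.
  - by rewrite !mulr_ge0 ?expR_ge0.
  - by rewrite addr_ge0// invr_ge0 ?sqr_ge0// ltW.
  - rewrite -mulrA ler_pM2l//; apply: (@le_trans _ _ (`|t| * expR (- t ^+ 2))).
      by rewrite ler_wpM2l// ler_expR; lra.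
    apply: le_trans (norm_expR_sqr_le_lorentz t) _.
    by rewrite ler_pdivrMr ?ltr_wpDr ?sqr_ge0//; have := sqr_ge0 t; lra.
  - by rewrite lerD.
apply: le_trans (ler_normB _ _) _; apply: lerD.
  by rewrite normrM (le_trans _ gt)// ler_piMr// cos_max.
have w0 := ewald_weight_ge0 a t.
have w1 : ewald_weight a t <= a ^- 2.
  apply: le_trans (ewald_weight_le_gauss t a0) _.
  by rewrite ler_piMr ?invr_ge0 ?(ltW a20)// -[leRHS]expR0 ler_expR oppr_le0 sqr_ge0.
rewrite normrM (normrM (2 * z)) (normrM 2) normr_nat (ger0_norm w0).
move: (ewald_weight a t) w0 w1 => w w0 w1.
rewrite -[leRHS]mulr1; apply: ler_pM; rewrite ?sin_max ?mulr_ge0//.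
by rewrite ler_wpM2l// mulr_ge0.
Qed.

(* Twice (for the frequencies [k L - z] and [k L + z]) the constant of
   [ewald_transform_asymp], times [\sum_k e^(-k)]. *)
Definition ewald_constant : R := 16 * pi * sqrtpi * expR 1 / (1 - expR (- 1)).

Lemma expRN1_lt1 : expR (- 1) < 1 :> R.
Proof. by rewrite expR_lt1 oppr_lt0. Qed.

Lemma ewald_constant_ge0 : 0 <= ewald_constant.
Proof.
by rewrite /ewald_constant divr_ge0 ?subr_ge0 ?(ltW expRN1_lt1) ?mulr_ge0 ?pi_ge0
  ?sqrtr_ge0 ?expR_ge0.
Qed.

(** [H + 2 <= L] places all frequencies [k L - z] and [k L + z], [k >= 1], in the range [w >= 2] of
    the asymptotics. The bound on [E] stays finite as [a -> 0], unlike the two main terms. *)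
Lemma ewald_trapezoidal_sum (a z L H : R) : 0 < a -> `|z| <= H -> H + 2 <= L ->
  exists E, has_sum (fun n : int => pi / L *
      (ewald_weight a (n%:~R * (pi / L)) * cos (2 * z * (n%:~R * (pi / L)))))
    (ewald_transform a z +
     2 * pi / a * cosh (2 * a * z) / (expR (2 * a * L) - 1) + E) /\
    `|E| <= ewald_constant * (expR (- (2 * a)) * expR (- (L - H) ^+ 2)).
Proof.
move=> a0 zH HL.
have H0 : 0 <= H := le_trans (normr_ge0 z) zH.
have L2 : 2 <= L by lra.
have L0 : 0 < L by lra.
have p0 := pi_gt0 R.
have d0 : 0 < pi / L by rewrite divr_gt0.
have /andP[z1 z2] : - H <= z <= H by rewrite -ler_norml.
pose f t := ewald_weight a t * cos (2 * z * t).
have cf : continuous f.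
  by move=> t; apply: cvgM; [exact: continuous_ewald_weight|move: t; continuity].
have [K fK] := @ewald_weight_lipschitz a z a0.
have fC t : `|f t| <= a ^- 2 / (1 + t ^+ 2).
  rewrite normrM (ger0_norm (ewald_weight_ge0 _ _)).
  apply: (@le_trans _ _ (ewald_weight a t)); first by rewrite ler_piMr ?ewald_weight_ge0// cos_max.
  apply: le_trans (ewald_weight_le_gauss t a0) _.
  by rewrite ler_wpM2l ?expRN_le_lorentz// invr_ge0 sqr_ge0.
pose c k := \int[mu]_t (f t * cos (k%:R * (2 * pi / (pi / L) * t))).
have iw v : mu.-integrable setT (EFin \o (fun t => ewald_weight a t * cos (2 * v * t))).
  by apply: integrable_ewald => //; [continuity|move=> t; exact: cos_max].
have cE k : c k = (ewald_transform a (k%:R * L - z) + ewald_transform a (k%:R * L + z)) / 2.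
  rewrite /ewald_transform -RintegralD//.
  rewrite mulrC -RintegralZl//; last first.
    by have := integrableD measurableT (iw (k%:R * L - z)) (iw (k%:R * L + z)).
  apply: eq_Rintegral => t _; rewrite /f -mulrA cosM.
  have -> : k%:R * (2 * pi / (pi / L) * t) = 2 * (k%:R * L) * t.
    by move: (pi : R) p0 => p p0; field; rewrite !gt_eqF.
  rewrite (_ : 2 * (k%:R * L) * t - 2 * z * t = 2 * (k%:R * L - z) * t); last by ring.
  rewrite (_ : 2 * (k%:R * L) * t + 2 * z * t = 2 * (k%:R * L + z) * t); last by ring.
  by field.
pose D (w : R) := ewald_transform a w - pi / a * expR (- (2 * a * w)).
pose u k := D (k.+1%:R * L - z) + D (k.+1%:R * L + z).
pose W := expR (- (2 * a)) * expR (- (L - H) ^+ 2).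
(* From [w >= (L - H) + k L] with [L - H >= 2] follows [w^2 >= (L - H)^2 + k]; the surplus [k] makes
   the errors a geometric series. *)
have Dle k w : k.+1%:R * L - H <= w -> `|D w| <= 8 * pi * sqrtpi * expR 1 * W * expR (- 1) ^+ k.
  move=> kw.
  have k0 : 0 <= k%:R :> R by [].
  have w1 : (L - H) + k%:R * L <= w by move: kw; rewrite -natr1; lra.
  have kL : 0 <= k%:R * L by rewrite mulr_ge0// ltW.
  have kL2 : k%:R <= k%:R * L by rewrite ler_peMr//; lra.
  have w2 : 2 <= w by lra.
  apply: le_trans (ewald_transform_asymp a0 w2) _.
  rewrite -[leRHS]mulrA ler_wpM2l ?mulr_ge0 ?sqrtr_ge0 ?expR_ge0 ?(ltW p0)//.
  rewrite /W -[leRHS]mulrA ler_wpM2l ?expR_ge0// -expRM_natl -expRD ler_expR.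
  nra.
have uM N : \sum_(0 <= k < N) `|u k| <= ewald_constant * W.
  apply: (@le_trans _ _ (\sum_(0 <= k < N) (16 * pi * sqrtpi * expR 1 * W) * expR (- 1) ^+ k)).
    apply: ler_sum => k _; apply: le_trans (ler_normD _ _) _.
    have h1 := @Dle k (k.+1%:R * L - z) ltac:(lra).
    have h2 := @Dle k (k.+1%:R * L + z) ltac:(lra).
    lra.
  rewrite -mulr_sumr /ewald_constant.
  rewrite [leRHS](_ : _ = (16 * pi * sqrtpi * expR 1 * W) * (1 - expR (- 1))^-1); last by ring.
  apply: ler_wpM2l.
    by rewrite /W !mulr_ge0 ?sqrtr_ge0 ?expR_ge0 ?(ltW p0).
  by apply: geometric_bound; rewrite expR_ge0 expRN1_lt1.
have [E [uE EM]] := bounded_series uM.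
exists E; split => //.
pose r := expR (- (2 * a * L)).
(* The main terms form the geometric series of ratio [r], and [r / (1 - r)] equals
   [1 / (e^(2 a L) - 1)]. *)
have r01 : 0 < r < 1 by rewrite expR_gt0 expR_lt1 oppr_lt0 !mulr_gt0.
have /andP[r0 r1] := r01.
apply: (@poisson_summation _ f (pi / L) (a ^- 2) K) => //=.
have cS M : c 0%N + 2 * \sum_(0 <= k < M) c k.+1 =
    ewald_transform a z + 2 * pi / a * cosh (2 * a * z) * series (geometric r r) M +
    \sum_(0 <= k < M) u k.
  rewrite cE mul0r sub0r add0r ewald_transformN.
  have -> : (ewald_transform a z + ewald_transform a z) / 2 = ewald_transform a z by field.
  rewrite -addrA; congr (_ + _).
  rewrite /series/= !mulr_sumr -big_split/=; apply: eq_bigr => k _.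
  rewrite cE /u /D /geometric/= /cosh.
  rewrite (_ : expR (- (2 * a * (k.+1%:R * L - z))) = r * r ^+ k * expR (2 * a * z)); last first.
    by rewrite -exprS /r -expRM_natl -expRD; congr expR; ring.
  rewrite (_ : expR (- (2 * a * (k.+1%:R * L + z))) = r * r ^+ k * expR (- (2 * a * z)));
    last first.
    by rewrite -exprS /r -expRM_natl -expRD; congr expR; ring.
  by field; rewrite gt_eqF.
have h : ewald_transform a z + 2 * pi / a * cosh (2 * a * z) * series (geometric r r) M +
    \sum_(0 <= k < M) u k @[M --> \oo] -->
    ewald_transform a z + 2 * pi / a * cosh (2 * a * z) * (r * (1 - r)^-1) + E.
  apply: cvgD; last exact: uE.
  apply: cvgD; first exact: cvg_cst.
  apply: cvgM; first exact: cvg_cst.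
  by apply: cvg_geometric_series; rewrite gtr0_norm.
have -> : 2 * pi / a * cosh (2 * a * z) / (expR (2 * a * L) - 1) =
    2 * pi / a * cosh (2 * a * z) * (r * (1 - r)^-1).
  congr (_ * _); rewrite -[2 * a * L]opprK expRN -/r; field.
  by rewrite !gt_eqF ?subr_gt0.
by move: h; under eq_fun do rewrite -cS.
Qed.

End ewald_trapezoidal.

(** * Complex sums and principal values *)

Section reflection.
Context {R : realType}.
Notation mu := (@lebesgue_measure R).
Notation RT := (measurableTypeR R).

Lemma measurable_opp : measurable_fun (setT : set RT) (fun x : RT => (- x : RT)).
Proof. by apply: continuous_measurable_fun; exact: opp_continuous. Qed.

Lemma lebesgue_measure_opp (A : set RT) : measurable A ->
  pushforward mu (fun x : RT => (- x : RT)) A = mu A.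
Proof.
move=> mA; apply/esym.
apply: (@lebesgue_measure_unique R (pushforward mu (fun x : RT => (- x : RT)))) => //.
  exact: measurable_opp.
move=> ? _ [[a b] _ <-]; rewrite /= /pushforward.
have -> : (fun x : RT => (- x : RT)) @^-1` `]a, b] = `[- b, - a[%classic.
  by apply/seteqP; split => x /=; rewrite !in_itv/= => /andP[? ?]; apply/andP; split; lra.
rewrite !lebesgue_measure_itv/= !lte_fin ltrN2; case: ifP => // _.
by rewrite opprK addeC.
Qed.

Lemma Rintegral_odd (D : set RT) (f : R -> R) : measurable D ->
  (forall x, D x -> D (- x)) -> measurable_fun (setT : set RT) f ->
  mu.-integrable D (EFin \o f) -> (forall x, f (- x) = - f x) ->
  \int[mu]_(x in D) f x = 0.
Proof.
move=> mD symD mf fi fN.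
have preD : (fun x : RT => (- x : RT)) @^-1` D = D.
  apply/seteqP; split => x /=; last exact: symD.
  by move=> /symD; rewrite opprK.
have fNi : mu.-integrable D (EFin \o (fun x => - f x)) by have := integrableN fi.
have E : \int[mu]_(x in D) f x = \int[mu]_(x in D) (- f x).
  rewrite /Rintegral; congr fine.
  transitivity (\int[pushforward mu (fun x : RT => (- x : RT)%R)]_(y in D) (f y)%:E)%E.
    apply: eq_measure_integral; first exact: measurable_opp.
    by move=> ? A mA _; apply/esym; exact: lebesgue_measure_opp.
  rewrite integral_pushforward//.
  - by rewrite preD; apply: eq_integral => x _; rewrite /= fN.
  - exact: measurable_opp.
  - exact/measurable_EFinP.
  - rewrite preD; apply: eq_integrable fNi => // x _; by rewrite /= fN.
move: E; rewrite (_ : \int[mu]_(x in D) - f x = - \int[mu]_(x in D) f x); first by lra.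
by rewrite -mulN1r -RintegralZl//; apply: eq_Rintegral => x _; rewrite mulN1r.
Qed.

End reflection.

Section reindexing.
Context {R : realType}.

Lemma has_sum_reindex (I J : choiceType) (f : I -> J) (g : J -> I) (F : J -> R) s :
  cancel f g -> cancel g f -> has_sum F s -> has_sum (fun i => F (f i)) s.
Proof.
move=> fg gf /has_sumP Fs; apply/has_sumP => e /Fs[A hA].
exists [fset g j | j in A]%fset => B hB.
have := hA [fset f i | i in B]%fset; rewrite big_imfset/=; last first.
  by move=> x y _ _ /(can_inj fg).
apply; apply/fsubsetP => j jA; apply/imfsetP; exists (g j); last by rewrite gf.
by apply: (fsubsetP hB); apply/imfsetP; exists j.
Qed.

Lemma has_sum_odd (F : int -> R) s : (forall n, F (- n) = - F n) -> has_sum F s -> s = 0.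
Proof.
move=> FN Fs; have := has_sum_reindex opprK opprK Fs.
under eq_fun do rewrite FN.
by move=> /(has_sum_unique (has_sumN Fs)) h; lra.
Qed.

Lemma abs_bounded_fiber (I J : choiceType) (F : I * J -> R) M i :
  abs_bounded F M -> abs_bounded (fun j => F (i, j)) M.
Proof.
move=> FM B; have := FM [fset (i, j) | j in B]%fset.
by rewrite big_imfset//= => x y _ _ [].
Qed.

End reindexing.

Section complex_sums.
Local Open Scope complex_scope.
Context {R : realType}.
Implicit Types (s t c : R[i]).

Definition has_csum (I : choiceType) (F : I -> R[i]) s : Prop :=
  has_sum (fun i => complex.Re (F i)) (complex.Re s) /\
  has_sum (fun i => complex.Im (F i)) (complex.Im s).

Lemma has_csumE (I : choiceType) (F : I -> R[i]) s :
  has_csum F s -> summability.sum (F : I -> R[i]^o) = s.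
Proof. by case: s => u v [/= Fu Fv]; exact: complex_sumE. Qed.

Lemma eq_has_csum (I : choiceType) (F G : I -> R[i]) s :
  F =1 G -> has_csum F s -> has_csum G s.
Proof. by move=> /funext ->. Qed.

Lemma has_csumD (I : choiceType) (F G : I -> R[i]) s t :
  has_csum F s -> has_csum G t -> has_csum (fun i => F i + G i) (s + t).
Proof.
move=> [F1 F2] [G1 G2]; split.
  by have := has_sumD F1 G1; rewrite raddfD/=; apply: eq_has_sum => i; rewrite raddfD.
by have := has_sumD F2 G2; rewrite raddfD/=; apply: eq_has_sum => i; rewrite raddfD.
Qed.

Lemma Re_mul (x y : R[i]) : complex.Re (x * y) =
  complex.Re x * complex.Re y - complex.Im x * complex.Im y.
Proof. by case: x => ? ?; case: y => ? ?. Qed.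

Lemma Im_mul (x y : R[i]) : complex.Im (x * y) =
  complex.Re x * complex.Im y + complex.Im x * complex.Re y.
Proof. by case: x => ? ?; case: y => ? ?. Qed.

Lemma has_csumZ (I : choiceType) (F : I -> R[i]) s c :
  has_csum F s -> has_csum (fun i => c * F i) (c * s).
Proof.
move=> [F1 F2]; split.
  rewrite Re_mul.
  have := has_sumB (has_sumZ (c := complex.Re c) F1) (has_sumZ (c := complex.Im c) F2).
  by apply: eq_has_sum => i; rewrite Re_mul.
rewrite Im_mul.
have := has_sumD (has_sumZ (c := complex.Re c) F2) (has_sumZ (c := complex.Im c) F1).
by apply: eq_has_sum => i; rewrite Im_mul.
Qed.

Lemma has_csumN (I : choiceType) (F : I -> R[i]) s :
  has_csum F s -> has_csum (fun i => - F i) (- s).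
Proof.
by move=> /(has_csumZ (-1)); rewrite mulN1r; apply: eq_has_csum => i; rewrite mulN1r.
Qed.

Lemma has_csum0 (I : choiceType) : has_csum (fun _ : I => 0) 0.
Proof. by split; exact: has_sum0. Qed.

Lemma has_csum_sum (I : choiceType) (J : Type) (r : seq J) (F : J -> I -> R[i]) (s : J -> R[i]) :
  (forall j, has_csum (F j) (s j)) ->
  has_csum (fun i => \sum_(j <- r) F j i) (\sum_(j <- r) s j).
Proof.
move=> Fs; elim: r => [|j r IH].
  by rewrite big_nil; have := has_csum0 I; apply: eq_has_csum => i; rewrite big_nil.
rewrite big_cons; have := has_csumD (Fs j) IH.
by apply: eq_has_csum => i; rewrite big_cons.
Qed.

Lemma has_csum_single (I : choiceType) (a : I) c :
  has_csum (fun i => if i == a then c else 0) c.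
Proof.
split.
  by have := @has_sum_single _ _ a (complex.Re c); apply: eq_has_sum => i; case: ifP.
by have := @has_sum_single _ _ a (complex.Im c); apply: eq_has_sum => i; case: ifP.
Qed.

Lemma has_csum_neq0 (I : zmodType) (F : I -> R[i]) s :
  has_csum F s -> has_csum (fun n => if n == 0 then 0 else F n) (s - F 0).
Proof.
move=> Fs; have := has_csumD Fs (has_csumN (has_csum_single 0 (F 0))); apply: eq_has_csum => n.
by case: eqVneq => [->|]; rewrite ?subrr ?subr0.
Qed.

Lemma has_csum_prod (I J : choiceType) (F : I * J -> R[i]) (g : I -> R[i]) s :
  has_csum F s -> (forall i, has_csum (fun j => F (i, j)) (g i)) -> has_csum g s.
Proof.
move=> [F1 F2] Fg; split.
  by apply: has_sum_prod F1 _ => i; have [] := Fg i.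
by apply: has_sum_prod F2 _ => i; have [] := Fg i.
Qed.

Lemma expiD (x y : R) : expi (x + y) = expi x * expi y.
Proof. by rewrite /expi cosD sinD; congr (_ +i* _); rewrite addrC. Qed.

(** Phases do not affect absolute summability; the factor 2 comes from adding the bounds of the real
    and imaginary parts. *)
Lemma has_csum_expi (I : choiceType) (theta F : I -> R) M : abs_bounded F M ->
  exists s, has_csum (fun i => expi (theta i) * (F i)%:C) s /\
    ComplexField.Normc.normc s <= 2 * M.
Proof.
move=> FM.
have [u [uE uM]] : exists u, has_sum (fun i => cos (theta i) * F i) u /\ `|u| <= M.
  apply: abs_bounded_has_sum; apply: abs_bounded_le FM => i.
  by rewrite normrM ler_piMl// cos_max.
have [v [vE vM]] : exists u, has_sum (fun i => sin (theta i) * F i) u /\ `|u| <= M.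
  apply: abs_bounded_has_sum; apply: abs_bounded_le FM => i.
  by rewrite normrM ler_piMl// sin_max.
exists (u +i* v); split.
  split => /=.
    by apply: eq_has_sum uE => i; rewrite mulr0 subr0.
  by apply: eq_has_sum vE => i; rewrite mulr0 add0r.
have := normc_le_ReIm (u +i* v); rewrite normc_def/= lecR => h.
by apply: (le_trans h); lra.
Qed.

End complex_sums.

(** * The principal value in [J0] *)

Section principal_value.
Local Open Scope complex_scope.
Context {R : realType}.
Notation mu := (@lebesgue_measure R).
Notation RT := (measurableTypeR R).

Lemma derive_quotient (f : R -> R) (l : R) : is_derive (0 : R) 1 f l -> f 0 = 0 ->
  f x / x @[x --> 0^'] --> l.
Proof.
move=> [df <-] f0; have := df.
rewrite /derivable /derive => /cvg_ex[m hm].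
have -> : lim (h^-1 *: (f (h *: 1 + 0) - f 0) @[h --> 0^']) = m by exact: cvg_lim.
move: hm; apply: cvg_trans; apply: near_eq_cvg; apply: nearW => h /=.
by rewrite f0 subr0 addr0 /GRing.scale/= mulr1 mulrC.
Qed.

Lemma norm_sin_le (x : R) : `|sin x| <= `|x|.
Proof.
have := @derivative_lipschitz R _ _ 1 (fun x => is_derive_sin x) (@cos_max R) x 0.
by rewrite sin0 !subr0 mul1r.
Qed.

Lemma one_sub_cosE (x : R) : 1 - cos x = 2 * sin (x / 2) ^+ 2.
Proof.
rewrite sin2cos2 {1}(_ : x = (x / 2) *+ 2); last by rewrite mulr2n -splitr.
by rewrite cos_mulr2n; ring.
Qed.

Lemma one_sub_cos_bound (x : R) : 0 <= 1 - cos x <= x ^+ 2 / 2.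
Proof.
rewrite one_sub_cosE mulr_ge0 ?sqr_ge0//=.
have : sin (x / 2) ^+ 2 <= (x / 2) ^+ 2.
  rewrite -[leLHS]real_normK ?num_real// -[leRHS]real_normK ?num_real//.
  by rewrite lerXn2r ?nnegrE// norm_sin_le.
nra.
Qed.

Lemma measurable_div_sqr (f : R -> R) : continuous f ->
  measurable_fun (setT : set RT) (fun t : R => f t / t ^+ 2).
Proof.
move=> cf; rewrite -(setUv [set (0 : R)]).
have m0 : measurable ([set 0] : set RT) by exact: measurable_set1.
apply/measurable_funU => //; first exact: measurableC.
split; first exact: measurable_fun_set1.
apply: open_continuous_measurable_fun; first by apply: closed_openC; exact: closed_eq.
move=> t; rewrite inE/= => t0; apply: cvgM; first exact: cf.
apply: cvgV; first by rewrite expf_neq0//; apply/eqP.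
exact: exprn_continuous.
Qed.

(** The real part of the integrand of [J0], bounded near 0 and hence integrable. Only the imaginary
    part, of order [1 / t], calls for a principal value, and it is odd. *)
Definition pv_weight (v t : R) : R := (expR (- t ^+ 2) * cos (2 * v * t) - 1) / t ^+ 2.

Lemma pv_weight_le (v t : R) : `|pv_weight v t| <= (3 + 2 * v ^+ 2) / (1 + t ^+ 2).
Proof.
have t20 := sqr_ge0 t.
have [->|t0] := eqVneq t 0.
  by rewrite /pv_weight expr0n/= invr0 mulr0 normr0; have := sqr_ge0 v; rewrite addr0 divr1; lra.
have t2 : 0 < t ^+ 2 by rewrite exprn_even_gt0.
have e1 := expR_ge1Dx (- t ^+ 2).
have e2 : expR (- t ^+ 2) <= 1 by rewrite -[leRHS]expR0 ler_expR; lra.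
have e0 := expR_gt0 (- t ^+ 2).
have /andP[c1 c2] := one_sub_cos_bound (2 * v * t).
have c3 := cos_geN1 (2 * v * t); have c4 := cos_le1 (2 * v * t).
set e := expR _ in e1 e2 e0 *; set c := cos _ in c1 c2 c3 c4 *.
(* In the product of the numerator with [1 + t^2], the bound 2 is used for the term [t^2] and the
   quadratic bound for the term 1; together they give [(3 + 2 v^2) t^2]. *)
have n1 : `|e * c - 1| <= 2.
  rewrite ler_norml; apply/andP; split; nra.
have n2 : `|e * c - 1| <= (1 + 2 * v ^+ 2) * t ^+ 2.
  rewrite ler_norml; apply/andP; split; nra.
rewrite /pv_weight normrM (gtr0_norm (x := _^-1)) ?invr_gt0// -/e -/c.
rewrite ler_pdivrMr// mulrAC ler_pdivlMr ?ltr_wpDr//.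
move: `|e * c - 1| n1 n2 => n n1 n2; nra.
Qed.

Lemma measurable_pv_weight (v : R) : measurable_fun (setT : set RT) (pv_weight v).
Proof. by apply: measurable_div_sqr; continuity. Qed.

Lemma integrable_pv_weight (D : set RT) (v : R) : measurable D ->
  mu.-integrable D (EFin \o pv_weight v).
Proof.
move=> mD; apply: (@integrable_dominated _ _ _ (3 + 2 * v ^+ 2)) => //.
  by apply: measurable_funTS; exact: measurable_pv_weight.
exact: pv_weight_le.
Qed.

Lemma Re_mulC (x : R[i]) (c : R) : complex.Re (x * c%:C) = complex.Re x * c.
Proof. by rewrite Re_mul/= mulr0 subr0. Qed.

Lemma Im_mulC (x : R[i]) (c : R) : complex.Im (x * c%:C) = complex.Im x * c.
Proof. by rewrite Im_mul/= mulr0 add0r. Qed.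

Lemma J0_integrandE (alpha z t : R) : J0_integrand alpha z t =
  pv_weight (alpha * z) t +i* (expR (- t ^+ 2) * sin (2 * (alpha * z) * t) / t ^+ 2).
Proof.
rewrite /J0_integrand -fmorphV /pv_weight/=; apply/eqP; rewrite eq_complex.
rewrite Re_mulC Im_mulC !raddfB/= subr0 mul0r subr0 mul0r addr0.
by rewrite !mulrA !eqxx.
Qed.

Lemma measurable_ge_norm (e : R) : measurable ([set t | e <= `|t|] : set RT).
Proof.
rewrite (_ : [set t | e <= `|t|] = (fun t : R => `|t|) @^-1` `[e, +oo[%classic); last first.
  by apply/seteqP; split => t /=; rewrite in_itv/= andbT.
rewrite -[X in measurable X]setTI; apply: (continuous_measurable_fun _ measurableT).
  exact: continuous_normr.
exact: measurable_itv.
Qed.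

Lemma pv_integral_J0 (alpha z : R) :
  pv_integral (J0_integrand alpha z) = (\int[mu]_t pv_weight (alpha * z) t)%:C.
Proof.
rewrite (funext (J0_integrandE alpha z)) /pv_integral.
apply: (@cvg_lim R[i]^o); first exact: norm_hausdorff.
apply: cvg_complex => /=.
  apply/cvg_at_rightP => u [u0 ucvg].
  under eq_fun do rewrite Rintegral_mkcond.
  apply: (@dominated_cvg_Rintegral _ _ _ _ (fun t => `|pv_weight (alpha * z) t|)) => //.
  - move=> n; apply/(measurable_restrictT _ _).1; first exact: measurable_ge_norm.
    by apply: measurable_funTS; exact: measurable_pv_weight.
  - move=> t _; have [->|t0] := eqVneq t 0.
      rewrite /pv_weight expr0n/= invr0 mulr0.
      apply: cvg_near_cst; apply: nearW => n; rewrite patchE.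
      by case: ifP => // _; rewrite expr0n/= invr0 mulr0.
    apply: cvg_near_cst; near=> n; rewrite patchE ifT// inE/=.
    near: n; move/cvgrPdist_le : ucvg => /(_ `|t|); rewrite normr_gt0 => /(_ t0).
    by apply: filterS => n; rewrite sub0r normrN (gtr0_norm (u0 n)).
  - by have := integrable_norm (integrable_pv_weight (alpha * z) measurableT).
  - by move=> n t _; rewrite patchE; case: ifP => //; rewrite normr0.
(* The imaginary part is already 0 for every [e > 0], by oddness. Away from 0 it is integrable
   because [1 / t^2 <= 1 / e^2]. *)
apply: cvg_near_cst; near=> e.
have e0 : 0 < e by near: e; exact: nbhs_right_gt.
apply: Rintegral_odd.
- exact: measurable_ge_norm.
- by move=> t /=; rewrite normrN.
- by apply: measurable_div_sqr; continuity.
- apply: (@integrable_le _ _ _ (fun t => e ^- 2 * (1 + t ^+ 2)^-1)).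
  + exact: measurable_ge_norm.
  + by apply: measurable_funTS; apply: measurable_div_sqr; continuity.
  + apply: (@integrableMl_const _ _ (fun t => (1 + t ^+ 2)^-1)); first exact: measurable_ge_norm.
    by apply: integrableS (@integrable_lorentz R) => //; exact: measurable_ge_norm.
  + move=> t /= et; rewrite normrM mulrC normfV normrX real_normK ?num_real//.
    have t2 : e ^+ 2 <= t ^+ 2.
      by rewrite -[leRHS]real_normK ?num_real// lerXn2r ?nnegrE// ltW.
    apply: ler_pM => //; first by rewrite invr_ge0 sqr_ge0.
      have e2 : 0 < e ^+ 2 by rewrite exprn_gt0.
      by rewrite lef_pV2 ?posrE// (lt_le_trans e2).
    rewrite normrM gtr0_norm ?expR_gt0// (le_trans _ (expRN_le_lorentz t))//.
    by rewrite ler_piMr ?expR_ge0 ?sin_max.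
- by move=> t; rewrite mulrN sinN sqrrN; ring.
Unshelve. all: by end_near. Qed.

End principal_value.

(** * Sums over reciprocal lattices *)

Section vectors.
Context {R : realType}.
Implicit Types u v : 'rV[R]_3.

Lemma dotE u v : dot u v = xcoord u * xcoord v + ycoord u * ycoord v + zcoord u * zcoord v.
Proof.
rewrite /dot !big_ord_recl big_ord0 addr0 addrA; congr (_ * _ + _ * _ + _ * _).
all: by congr (_ 0 _); apply/val_inj.
Qed.

Lemma dotBr u v w : dot u (v - w) = dot u v - dot u w.
Proof. by rewrite /dot -sumrB; apply: eq_bigr => i _; rewrite !mxE mulrBr. Qed.

Lemma sqr_enorm u : enorm u ^+ 2 = dot u u.
Proof. by rewrite sqr_sqrtr// sumr_ge0// => i _; rewrite -expr2 sqr_ge0. Qed.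

Lemma enorm_ge0 u : 0 <= enorm u.
Proof. exact: sqrtr_ge0. Qed.

Lemma coord_vec3 (c x y z : R) : (xcoord (c *: vec3 x y z) = c * x) *
  (ycoord (c *: vec3 x y z) = c * y) * (zcoord (c *: vec3 x y z) = c * z).
Proof. by rewrite /xcoord /ycoord /zcoord !mxE. Qed.

Variables Lx Ly Lz : R.
Implicit Types (n : int * int) (m : int).

Lemma dot_hvec n u : dot (hvec Lx Ly n) u =
  2 * pi * (n.1%:~R / Lx) * xcoord u + 2 * pi * (n.2%:~R / Ly) * ycoord u.
Proof. by rewrite dotE !coord_vec3 mulr0 mul0r addr0. Qed.

Lemma dot_kvec n m u : dot (kvec Lx Ly Lz (n, m)) u =
  dot (hvec Lx Ly n) u + 2 * pi * (m%:~R / Lz) * zcoord u.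
Proof. by rewrite dot_hvec dotE !coord_vec3. Qed.

Lemma sqr_enorm_hvec n : enorm (hvec Lx Ly n) ^+ 2 =
  (2 * pi / Lx) ^+ 2 * n.1%:~R ^+ 2 + (2 * pi / Ly) ^+ 2 * n.2%:~R ^+ 2.
Proof.
rewrite sqr_enorm dot_hvec !coord_vec3 -!expr2 -!exprMn.
by congr (_ ^+ 2 + _ ^+ 2); rewrite mulrA mulrAC.
Qed.

Lemma sqr_enorm_kvec n m : enorm (kvec Lx Ly Lz (n, m)) ^+ 2 =
  enorm (hvec Lx Ly n) ^+ 2 + (2 * pi * (m%:~R / Lz)) ^+ 2.
Proof.
by rewrite !sqr_enorm dot_kvec !dot_hvec !coord_vec3 expr2.
Qed.

Lemma enorm_hvec0 : enorm (hvec Lx Ly 0) = 0.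
Proof. by apply/eqP; rewrite -sqrf_eq0 sqr_enorm_hvec/= !expr0n !mulr0 addr0. Qed.

End vectors.

Section lattice_sums.
Context {R : realType}.

(** Through this bound on integers, Gaussian lattice sums are dominated by geometric series. *)
Lemma natr_absz_le_sqr (n : int) : `|n|%N%:R <= n%:~R ^+ 2 :> R.
Proof.
rewrite -[leRHS]real_normK ?num_real// -intr_norm -natr_absz -natrX ler_nat.
by case: `|n|%N => // k; rewrite leq_pmulr.
Qed.

Lemma abs_bounded_expR_absz (c : R) : 0 < c ->
  abs_bounded (fun n : int => expR (- (c * `|n|%N%:R))) (2 / (1 - expR (- c))).
Proof.
move=> c0; apply: abs_bounded_le (abs_bounded_geometric (x := expR (- c)) _) => [n|].
  by rewrite -mulNr mulrC expRM_natl.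
by rewrite expR_ge0 expR_lt1 oppr_lt0.
Qed.

(** Off the origin some coordinate is nonzero, so [X] is at least [a], [b] or [c], and [1 / X] is at
    most the sum of the three inverses. At the origin the term is 0, by [x / 0 = 0]. *)
Lemma abs_bounded_gauss_lattice (a b c : R) : 0 < a -> 0 < b -> 0 < c ->
  let X (p : int * int * int) :=
    a * p.1.1%:~R ^+ 2 + b * p.1.2%:~R ^+ 2 + c * p.2%:~R ^+ 2 : R in
  exists M, abs_bounded (fun p => expR (- X p) / X p) M.
Proof.
move=> a0 b0 c0 X.
have B := abs_bounded_prod (abs_bounded_prod (abs_bounded_expR_absz a0)
  (abs_bounded_expR_absz b0)) (abs_bounded_expR_absz c0).
have := abs_boundedZ (a^-1 + b^-1 + c^-1) B => {}B.
eexists; apply: abs_bounded_le B => -[[n1 n2] n3].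
have i0 : 0 < a^-1 /\ 0 < b^-1 /\ 0 < c^-1 by rewrite !invr_gt0.
have s0 : 0 < a^-1 + b^-1 + c^-1 by lra.
rewrite !normrM !(gtr0_norm (expR_gt0 _)) (gtr0_norm s0) mulrC/=.
have h1 := natr_absz_le_sqr n1; have h2 := natr_absz_le_sqr n2; have h3 := natr_absz_le_sqr n3.
have k1 : a * `|n1|%N%:R <= a * n1%:~R ^+ 2 by rewrite ler_pM2l.
have k2 : b * `|n2|%N%:R <= b * n2%:~R ^+ 2 by rewrite ler_pM2l.
have k3 : c * `|n3|%N%:R <= c * n3%:~R ^+ 2 by rewrite ler_pM2l.
have l1 : 0 <= a * `|n1|%N%:R by rewrite mulr_ge0// ltW.
have l2 : 0 <= b * `|n2|%N%:R by rewrite mulr_ge0// ltW.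
have l3 : 0 <= c * `|n3|%N%:R by rewrite mulr_ge0// ltW.
apply: ler_pM; rewrite ?expR_ge0//; last first.
  by rewrite -!expRD ler_expR /X/=; lra.
have X0 : 0 <= X (n1, n2, n3) by rewrite /X/=; lra.
rewrite ger0_norm ?invr_ge0//.
have ge1 (n : int) : n != 0 -> 1 <= `|n|%N%:R :> R by rewrite ler1n absz_gt0.
have inv_le (d : R) : 0 < d -> d <= X (n1, n2, n3) -> (X (n1, n2, n3))^-1 <= d^-1.
  by move=> d0 dX; rewrite lef_pV2 ?posrE// (lt_le_trans d0).
have [z1|/ge1 z1] := eqVneq n1 0; last first.
  have := inv_le _ a0; have : a <= a * `|n1|%N%:R by rewrite ler_peMr// ltW.
  rewrite /X/= => ? h; have : (X (n1, n2, n3))^-1 <= a^-1 by apply: h; lra.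
  by rewrite /X/=; lra.
have [z2|/ge1 z2] := eqVneq n2 0; last first.
  have := inv_le _ b0; have : b <= b * `|n2|%N%:R by rewrite ler_peMr// ltW.
  rewrite /X/= => ? h; have : (X (n1, n2, n3))^-1 <= b^-1 by apply: h; lra.
  by rewrite /X/=; lra.
have [z3|/ge1 z3] := eqVneq n3 0; last first.
  have := inv_le _ c0; have : c <= c * `|n3|%N%:R by rewrite ler_peMr// ltW.
  rewrite /X/= => ? h; have : (X (n1, n2, n3))^-1 <= c^-1 by apply: h; lra.
  by rewrite /X/=; lra.
by rewrite /X z1 z2 z3/= expr0n !mulr0 !addr0 invr0 ltW.
Qed.

Variables (Lx Ly : R) (Lx_gt0 : 0 < Lx) (Ly_gt0 : 0 < Ly).

(** A lower bound linear in both indices bounds [e^(-b h)] by a product of two geometric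
    families. *)
Lemma enorm_hvec_ge (n : int * int) :
  pi / Lx * `|n.1|%N%:R + pi / Ly * `|n.2|%N%:R <= enorm (hvec Lx Ly n).
Proof.
have p0 : 0 < (pi : R) := pi_gt0 R.
have x0 : 0 <= pi / Lx * `|n.1|%N%:R by rewrite mulr_ge0// divr_ge0// ltW.
have y0 : 0 <= pi / Ly * `|n.2|%N%:R by rewrite mulr_ge0// divr_ge0// ltW.
rewrite -(@ler_pXn2r _ 2)// ?nnegrE ?enorm_ge0 ?addr_ge0// sqr_enorm_hvec.
have e (k : int) : k%:~R ^+ 2 = `|k|%N%:R ^+ 2 :> R.
  by rewrite natr_absz intr_norm real_normK ?num_real.
rewrite !e -!exprMn -!mulrA !(mulrA pi).
by move: (pi / Lx * _) x0 (pi / Ly * _) y0 => x x0 y y0; nra.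
Qed.

(** The length of the shortest nonzero reciprocal vector; it is the decay rate of the ELC term. *)
Lemma enorm_hvec_min (n : int * int) : n != 0 ->
  2 * pi / Num.max Lx Ly <= enorm (hvec Lx Ly n).
Proof.
move=> n0; have m0 : 0 < Num.max Lx Ly by rewrite lt_max Lx_gt0.
have p0 : 0 < (pi : R) := pi_gt0 R.
rewrite -(@ler_pXn2r _ 2)// ?nnegrE ?enorm_ge0//; last first.
  by rewrite divr_ge0 ?mulr_ge0// ltW.
rewrite sqr_enorm_hvec.
have key (L : R) (k : int) : 0 < L -> L <= Num.max Lx Ly -> k != 0 ->
    (2 * pi / Num.max Lx Ly) ^+ 2 <= (2 * pi / L) ^+ 2 * k%:~R ^+ 2.
  move=> L0 LM k0; rewrite -[leLHS]mulr1 ler_pM ?sqr_ge0//.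
    have q0 : 0 < 2 * pi :> R by rewrite mulr_gt0.
    rewrite lerXn2r ?nnegrE; [by []|by rewrite divr_ge0 ?ltW..|].
    by rewrite ler_pM2l// lef_pV2.
  by apply: le_trans (natr_absz_le_sqr k); rewrite ler1n absz_gt0.
have [z1|z1] := eqVneq n.1 0.
  have z2 : n.2 != 0.
    by apply: contra n0 => /eqP z2; apply/eqP; case: (n) z1 z2 => ? ? /= -> ->.
  apply: (le_trans (key Ly _ _ _ z2)) => //; first by rewrite le_max lexx orbT.
  by rewrite -!exprMn lerDr sqr_ge0.
apply: (le_trans (key Lx _ _ _ z1)) => //; first by rewrite le_max lexx.
by rewrite -!exprMn lerDl sqr_ge0.
Qed.

Lemma enorm_hvec_gt0 (n : int * int) : n != 0 -> 0 < enorm (hvec Lx Ly n).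
Proof.
move=> n0; apply: lt_le_trans (enorm_hvec_min n0).
by rewrite divr_gt0 ?mulr_gt0 ?pi_gt0// lt_max Lx_gt0.
Qed.

Lemma abs_bounded_expR_hvec (b : R) : 0 < b ->
  exists M, abs_bounded (fun n => expR (- (b * enorm (hvec Lx Ly n)))) M.
Proof.
move=> b0; have p0 : 0 < (pi : R) := pi_gt0 R.
have bx : 0 < b * (pi / Lx) by rewrite mulr_gt0// divr_gt0.
have by0 : 0 < b * (pi / Ly) by rewrite mulr_gt0// divr_gt0.
eexists; apply: abs_bounded_le (abs_bounded_prod (abs_bounded_expR_absz bx)
  (abs_bounded_expR_absz by0)) => n.
rewrite -expRD !gtr0_norm ?expR_gt0// ler_expR -opprD lerN2 -!mulrA -mulrDr.
by rewrite ler_pM2l// !mulrA enorm_hvec_ge.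
Qed.

End lattice_sums.

(** * The three-dimensional Ewald sum *)

Section structure_factor.
Local Open Scope complex_scope.
Context {R : realType}.

Lemma expiN (x : R) : expi (- x) = (expi x)^*.
Proof. by rewrite /expi cosN sinN. Qed.

Lemma expi0 : expi (0 : R) = 1.
Proof. by rewrite /expi cos0 sin0. Qed.

Lemma sqr_norm_structure_factor N (q theta : 'I_N -> R) :
  `|\sum_i (q i)%:C * expi (theta i)| ^+ 2 =
  \sum_i \sum_j (q i * q j)%:C * expi (theta i - theta j).
Proof.
rewrite normCK rmorph_sum mulr_suml; apply: eq_bigr => i _.
rewrite mulr_sumr; apply: eq_bigr => j _.
rewrite expiD expiN rmorphM -[X in _ * (X * _)]/((q j)%:C^*) conjc_real rmorphM/=.
by rewrite mulrACA.
Qed.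

Lemma sqr_normc (x : R[i]) : `|x| ^+ 2 = (complex.Re x ^+ 2 + complex.Im x ^+ 2)%:C.
Proof. by case: x => a b; rewrite normc_def -rmorphXn/= sqr_sqrtr// addr_ge0 ?sqr_ge0. Qed.

Lemma sum_qq_eq0 N (q : 'I_N -> R) : \sum_i q i = 0 -> \sum_i \sum_j (q i * q j) = 0.
Proof. by move=> q0; rewrite big1// => i _; rewrite -mulr_sumr q0 mulr0. Qed.

End structure_factor.

Section fourier_integrand.
Local Open Scope complex_scope.
Context {R : realType}.
Notation RT := (measurableTypeR R).
Variables (alpha : R) (alpha_gt0 : 0 < alpha).

Lemma Fourier_integrand_weight (h z t : R) : Fourier_integrand alpha h z t =
  expi (2 * (alpha * z) * t) * (ewald_weight (h / (2 * alpha)) t)%:C.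
Proof.
rewrite /Fourier_integrand /ewald_weight mulrC mulrA; congr (_ * _%:C).
by rewrite exprMn exprVn exprMn -natrX.
Qed.

Lemma Cintegral_Fourier_integrand (h z : R) : 0 < h ->
  Cintegral setT (Fourier_integrand alpha h z) =
  (ewald_transform (h / (2 * alpha)) (alpha * z))%:C.
Proof.
move=> h0; have a0 : 0 < h / (2 * alpha) by rewrite divr_gt0// mulr_gt0.
rewrite (funext (Fourier_integrand_weight h z)) /Cintegral.
apply/eqP; rewrite eq_complex/=; apply/andP; split; apply/eqP.
  by apply: eq_Rintegral => t _; rewrite mulr0 subr0 mulrC.
under eq_Rintegral do rewrite mulr0 add0r.
have ct : continuous (fun t => sin (2 * (alpha * z) * t) * ewald_weight (h / (2 * alpha)) t).
  by move=> t; apply: cvgM; [move: t; continuity|exact: continuous_ewald_weight].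
have mt : measurable_fun (setT : set RT)
    (fun t => sin (2 * (alpha * z) * t) * ewald_weight (h / (2 * alpha)) t).
  exact: continuous_measurable_fun.
apply: Rintegral_odd => //.
- apply: (@integrable_dominated _ _ _ ((h / (2 * alpha)) ^- 2)) => // t.
  rewrite normrM (le_trans (ler_piMl _ (sin_max _)))//.
  rewrite ger0_norm ?ewald_weight_ge0// (le_trans (ewald_weight_le_gauss _ _))//.
  by rewrite ler_wpM2l ?expRN_le_lorentz// invr_ge0 sqr_ge0.
- by move=> t; rewrite mulrN sinN mulNr /ewald_weight sqrrN.
Qed.

Lemma trapezoidalE (d : R) (f : R -> R[i]) s :
  has_csum (fun n : int => f (d * n%:~R)) s -> trapezoidal d f = d%:C * s.
Proof. by rewrite /trapezoidal => /has_csumE ->. Qed.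

End fourier_integrand.

Section ewald3d.
Local Open Scope complex_scope.
Context {R : realType}.
Variables (Lx Ly Lz alpha : R).
Hypotheses (Lx_gt0 : 0 < Lx) (Ly_gt0 : 0 < Ly) (Lz_gt0 : 0 < Lz) (alpha_gt0 : 0 < alpha).
Notation d := (trapezoidal_mesh alpha Lz).

Definition lattice_weight (p : int * int * int) : R :=
  ewald_weight (enorm (hvec Lx Ly p.1) / (2 * alpha)) (d * p.2%:~R).

(** The vertical component [2 pi m / Lz] of the wave vector is [2 alpha] times the node [d m], and
    [h] is [2 alpha] times [a]; hence [k^2 = 4 alpha^2 (a^2 + t^2)]. *)
Lemma lattice_weightE (p : int * int * int) :
  let k := enorm (kvec Lx Ly Lz p) in
  expR (- (k ^+ 2 / (4 * alpha ^+ 2))) / k ^+ 2 = (4 * alpha ^+ 2)^-1 * lattice_weight p.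
Proof.
case: p => n m k; rewrite /lattice_weight /ewald_weight/=.
have a0 : 4 * alpha ^+ 2 != 0 by rewrite mulf_neq0// expf_neq0// gt_eqF.
set X := (_ / _) ^+ 2 + (d * _) ^+ 2.
have -> : k ^+ 2 = X * (4 * alpha ^+ 2).
  rewrite /k /X sqr_enorm_kvec /trapezoidal_mesh.
  move: (enorm _) (pi : R) (m%:~R) => h p x; field.
  by rewrite !gt_eqF.
by rewrite mulfK// -opprD -/X invfM mulrA mulrC.
Qed.

Lemma abs_bounded_lattice_weight : exists M, abs_bounded lattice_weight M.
Proof.
have p0 : 0 < (pi : R) := pi_gt0 R.
have ltr02 : 0 < 2 :> R by [].
have sq0 (x : R) : 0 < x -> 0 < x ^+ 2 by move=> ?; rewrite exprn_gt0.
have a2 : 0 < 4 * alpha ^+ 2 by rewrite mulr_gt0// sq0.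
have [M] := @abs_bounded_gauss_lattice R ((2 * pi / Lx) ^+ 2 / (4 * alpha ^+ 2))
  ((2 * pi / Ly) ^+ 2 / (4 * alpha ^+ 2)) (d ^+ 2)
  (divr_gt0 (sq0 _ (divr_gt0 (mulr_gt0 ltr02 p0) Lx_gt0)) a2)
  (divr_gt0 (sq0 _ (divr_gt0 (mulr_gt0 ltr02 p0) Ly_gt0)) a2)
  (sq0 _ (divr_gt0 p0 (mulr_gt0 alpha_gt0 Lz_gt0))).
move=> BM; exists M; apply: abs_bounded_le BM => p.
rewrite /lattice_weight /ewald_weight -opprD.
set X := (_ / _) ^+ 2 + _; set Y := (X in _ <= `|expR (- X) / X|).
suff -> : X = Y by [].
rewrite /X /Y [(enorm _ / _) ^+ 2]exprMn exprVn sqr_enorm_hvec [(d * _) ^+ 2]exprMn.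
rewrite (_ : (2 * alpha) ^+ 2 = 4 * alpha ^+ 2); last by ring.
by rewrite mulrDl; congr (_ + _ + _); rewrite mulrAC.
Qed.

Definition lattice_wave (u : 'rV[R]_3) (p : int * int * int) : R[i] :=
  expi (dot (kvec Lx Ly Lz p) u) * (lattice_weight p)%:C.

Lemma Fourier_integrand_wave (u : 'rV[R]_3) n m :
  expi (dot (hvec Lx Ly n) u) *
    Fourier_integrand alpha (enorm (hvec Lx Ly n)) (zcoord u) (d * m%:~R) =
  lattice_wave u (n, m).
Proof.
rewrite Fourier_integrand_weight /lattice_wave dot_kvec expiD -[RHS]mulrA.
congr (_ * (expi _ * _)); rewrite /trapezoidal_mesh.
by move: (pi : R) => p; field; rewrite !gt_eqF.
Qed.

(* The weight vanishes at [k = 0] only because of the convention [x / 0 = 0]. *)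
Lemma lattice_weight0 : lattice_weight 0 = 0.
Proof.
by rewrite /lattice_weight/= enorm_hvec0 /ewald_weight mul0r mulr0 expr0n addr0 invr0 mulr0.
Qed.

Lemma lattice_wave0 u : lattice_wave u 0 = 0.
Proof. by rewrite /lattice_wave lattice_weight0 mulr0. Qed.

Lemma has_csum_lattice_wave (u : 'rV[R]_3) :
  exists (S : R[i]) (g : int * int -> R[i]),
    [/\ has_csum (lattice_wave u) S, has_csum g S &
        forall n, has_csum (fun m => lattice_wave u (n, m)) (g n)].
Proof.
have [M WM] := abs_bounded_lattice_weight.
have [S [hS _]] := has_csum_expi (fun p => dot (kvec Lx Ly Lz p) u) WM.
have /choice[g hg] n : exists s, has_csum (fun m => lattice_wave u (n, m)) s.
  have [s [hs _]] := has_csum_expi (fun m => dot (kvec Lx Ly Lz (n, m)) u)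
    (@abs_bounded_fiber _ _ _ _ _ n WM).
  by exists s.
by exists S, g; split => //; exact: has_csum_prod hg.
Qed.

Lemma trapezoidal_wave (u : 'rV[R]_3) n s :
  has_csum (fun m => lattice_wave u (n, m)) s ->
  expi (dot (hvec Lx Ly n) u) *
    trapezoidal d (Fourier_integrand alpha (enorm (hvec Lx Ly n)) (zcoord u)) = d%:C * s.
Proof.
move=> ns; set e := expi _.
have hE : (expi (- dot (hvec Lx Ly n) u) * e = 1).
  by rewrite /e -expiD addNr expi0.
rewrite (@trapezoidalE _ _ _ (expi (- dot (hvec Lx Ly n) u) * s)).
  by rewrite -[RHS]mul1r -hE; ring.
have := has_csumZ (expi (- dot (hvec Lx Ly n) u)) ns; apply: eq_has_csum => m.
by rewrite -Fourier_integrand_wave mulrA hE mul1r.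
Qed.

(** [S] runs over the whole three-dimensional lattice. The column [g 0] of the vector [h = 0],
    removed here, is returned by the trapezoidal rule for [J0]. *)
Lemma sum_neq0_trapezoidal (u : 'rV[R]_3) (S : R[i]) g :
  has_csum g S -> (forall n, has_csum (fun m => lattice_wave u (n, m)) (g n)) ->
  sum_neq0 (fun n => expi (dot (hvec Lx Ly n) u) *
    trapezoidal d (Fourier_integrand alpha (enorm (hvec Lx Ly n)) (zcoord u))) =
  d%:C * (S - g 0).
Proof.
move=> gS hg; rewrite /sum_neq0 mulrBr; apply: has_csumE.
have := has_csum_neq0 (has_csumZ d%:C gS); apply: eq_has_csum => n.
by case: ifP => // _; rewrite (trapezoidal_wave (hg n)).
Qed.

Variables (N : nat) (q : 'I_N -> R) (r : 'I_N -> 'rV[R]_3).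
Hypothesis neutral : \sum_i q i = 0.

Definition dipole : R := \sum_i q i * zcoord (r i).

Lemma zcoordB (u v : 'rV[R]_3) : zcoord (u - v) = zcoord u - zcoord v.
Proof. by rewrite /zcoord !mxE. Qed.

(** Neutrality cancels the terms [- 1 / t^2]; what remains is the structure factor at the vertical
    wave vector of length [2 alpha |t|]. *)
Lemma sum_J0_integrand (t : R) :
  \sum_i \sum_j (q i * q j)%:C * J0_integrand alpha (zdiff r i j) t =
  (expR (- t ^+ 2) / t ^+ 2)%:C *
    `|\sum_i (q i)%:C * expi (2 * alpha * t * zcoord (r i))| ^+ 2.
Proof.
rewrite sqr_norm_structure_factor mulr_sumr.
transitivity (\sum_i (\sum_j (expR (- t ^+ 2) / t ^+ 2)%:C * ((q i * q j)%:C *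
  expi (2 * alpha * t * zcoord (r i) - 2 * alpha * t * zcoord (r j)))
   - \sum_j (q i * q j)%:C / (t ^+ 2)%:C)).
  apply: eq_bigr => i _; rewrite -sumrB; apply: eq_bigr => j _.
  rewrite /J0_integrand (_ : 2 * alpha * zdiff r i j * t =
    2 * alpha * t * zcoord (r i) - 2 * alpha * t * zcoord (r j)); last first.
    by rewrite /zdiff zcoordB; ring.
  have -> : (expR (- t ^+ 2) / t ^+ 2)%:C = (expR (- t ^+ 2))%:C * (t ^+ 2)%:C^-1.
    by rewrite rmorphM fmorphV.
  by ring.
rewrite sumrB (_ : \sum_i \sum_j (q i * q j)%:C / (t ^+ 2)%:C = 0).
  by rewrite subr0; apply: eq_bigr => i _; rewrite mulr_sumr.
rewrite (eq_bigr (fun i => (\sum_j q i * q j)%:C / (t ^+ 2)%:C)); last first.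
  by move=> i _; rewrite -mulr_suml rmorph_sum.
by rewrite -mulr_suml -(rmorph_sum (real_complex R)) sum_qq_eq0// mul0r.
Qed.

(** By neutrality the cosine sum [C] vanishes at 0, as does the sine sum [S]. Divided by [t], both
    are difference quotients, with limits 0 and [2 alpha] times the dipole. *)
Lemma cvg_sum_J0_integrand :
  (\sum_i \sum_j (q i * q j)%:C * J0_integrand alpha (zdiff r i j) t : R[i]^o)
    @[t --> 0^'] --> ((4 * alpha ^+ 2 * dipole ^+ 2)%:C : R[i]^o).
Proof.
pose C t := \sum_i q i * cos (2 * alpha * t * zcoord (r i)).
pose S t := \sum_i q i * sin (2 * alpha * t * zcoord (r i)).
have Eq t : \sum_i \sum_j (q i * q j)%:C * J0_integrand alpha (zdiff r i j) t =
    (expR (- t ^+ 2) * ((C t / t) ^+ 2 + (S t / t) ^+ 2))%:C.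
  rewrite sum_J0_integrand sqr_normc -rmorphM/=; congr (_%:C).
  have -> : complex.Re (\sum_i (q i)%:C * expi (2 * alpha * t * zcoord (r i))) = C t.
    by rewrite raddf_sum; apply: eq_bigr => i _; rewrite /= mul0r subr0.
  have -> : complex.Im (\sum_i (q i)%:C * expi (2 * alpha * t * zcoord (r i))) = S t.
    by rewrite raddf_sum; apply: eq_bigr => i _; rewrite /= mul0r addr0.
  by rewrite -[LHS]mulrA !expr_div_n -mulrDl [X in _ = _ * X]mulrC.
rewrite (funext Eq); apply: cvg_complex => /=; last exact: cvg_cst.
have -> : 4 * alpha ^+ 2 * dipole ^+ 2 = 1 * (0 ^+ 2 + (2 * alpha * dipole) ^+ 2) by ring.
have cC : C t / t @[t --> 0^'] --> 0.
  have -> : (fun t => C t / t) =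
      (fun t => \sum_i q i * ((cos (2 * alpha * t * zcoord (r i)) - 1) / t)).
    apply/funext => t; rewrite /C mulr_suml.
    have n0 : \sum_i q i / t = 0 by rewrite -mulr_suml neutral mul0r.
    rewrite -[LHS]subr0 -[X in _ - X]n0 -sumrB; apply: eq_bigr => i _.
    by rewrite mulrA mulrBr mulr1 mulrBl.
  rewrite -[X in _ --> X](@big1_eq _ _ +%R 'I_N (index_enum _) xpredT).
  apply: cvg_sumr => i; rewrite -[X in _ --> X](mulr0 (q i)); apply: cvgM; first exact: cvg_cst.
   apply: derive_quotient.
    by derive; rewrite mulr0 mul0r sin0; ring.
  by rewrite mulr0 mul0r cos0 subrr.
have cS : S t / t @[t --> 0^'] --> 2 * alpha * dipole.
  have -> : (fun t => S t / t) =
      (fun t => \sum_i q i * (sin (2 * alpha * t * zcoord (r i)) / t)).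
    by apply/funext => t; rewrite /S mulr_suml; apply: eq_bigr => i _; rewrite mulrA.
  rewrite /dipole mulr_sumr.
  apply: cvg_sumr => i; rewrite mulrCA; apply: cvgM; first exact: cvg_cst.
   apply: derive_quotient.
    by derive; rewrite mulr0 mul0r cos0; ring.
  by rewrite mulr0 mul0r sin0.
have cE : expR (- t ^+ 2) @[t --> (0 : R)^'] --> (1 : R).
  have : continuous (fun t : R => expR (- t ^+ 2)) by continuity.
  by move=> /(_ 0) /cvg_within_filter; rewrite /= expr0n oppr0 expR0; exact.
apply: cvgM => //; apply: cvgD; exact: cvgM.
Qed.

(** At the node 0 the wave is 0 by the convention [x / 0 = 0], so the extended value is added as a
    separate term. At the other nodes the wave exceeds [J0_integrand] by [1 / t^2], which neutrality
    cancels. *)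
Lemma J0_trapezoidalE (g0 : 'I_N -> 'I_N -> R[i]) :
  (forall i j, has_csum (fun m => lattice_wave (r i - r j) (0, m)) (g0 i j)) ->
  J0_trapezoidal Lx Ly alpha q r Lz = (2 * alpha * Lx * Ly)^-1%:C * (d%:C *
    ((4 * alpha ^+ 2 * dipole ^+ 2)%:C + \sum_i \sum_j (q i * q j)%:C * g0 i j)).
Proof.
move=> hg; rewrite /J0_trapezoidal; congr (_ * _); apply: trapezoidalE.
have h1 : has_csum (fun m => \sum_i \sum_j (q i * q j)%:C * lattice_wave (r i - r j) (0, m))
    (\sum_i \sum_j (q i * q j)%:C * g0 i j).
  by apply: has_csum_sum => i; apply: has_csum_sum => j; exact: has_csumZ.
have := has_csumD (has_csum_single (0 : int) (4 * alpha ^+ 2 * dipole ^+ 2)%:C) h1.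
apply: eq_has_csum => m; rewrite /extend0.
have d0 : d != 0 by rewrite gt_eqF// divr_gt0 ?pi_gt0// mulr_gt0.
have [->|m0] := eqVneq m 0.
  rewrite mulr0 eqxx [X in _ + X]big1 ?addr0; last first.
    by move=> i _; rewrite big1// => j _; rewrite lattice_wave0 mulr0.
  by apply/esym/(@cvg_lim R[i]^o); [exact: norm_hausdorff|exact: cvg_sum_J0_integrand].
rewrite add0r ifN; last by rewrite mulf_neq0 ?intr_eq0.
set t := d * _.
have E i j : lattice_wave (r i - r j) (0, m) =
    J0_integrand alpha (zdiff r i j) t + (t ^+ 2)%:C^-1.
  rewrite -Fourier_integrand_wave dot_hvec/= !mul0r !mulr0 !mul0r addr0 expi0 mul1r.
  rewrite /Fourier_integrand /J0_integrand enorm_hvec0 expr0n mul0r oppr0 !add0r.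
  by rewrite rmorphM fmorphV/=; ring.
under [LHS]eq_bigr do under eq_bigr do rewrite E mulrDr.
under [LHS]eq_bigr do rewrite big_split/=.
rewrite big_split/= [X in _ + X = _](_ : _ = 0) ?addr0//.
rewrite (eq_bigr (fun i => (\sum_j q i * q j)%:C * (t ^+ 2)%:C^-1)); last first.
  by move=> i _; rewrite -mulr_suml rmorph_sum.
by rewrite -mulr_suml -(rmorph_sum (real_complex R)) sum_qq_eq0// mul0r.
Qed.

(** No estimate is involved: the parts [S - g 0] from [h <> 0] and [g 0] from [J0_trapezoidal]
    recombine into the full sum. *)
Lemma U_Fourier_trapezoidalE : U_Fourier_trapezoidal Lx Ly alpha q r Lz =
  U_Ewald3D Lx Ly alpha q r Lz - (U_self alpha q)%:C + (U_IBC Lx Ly q r Lz)%:C.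
Proof.
have [S hS] := choice (fun ij => has_csum_lattice_wave (r ij.1 - r ij.2)).
have [g hg] := choice hS.
have hW i j := let: And3 h _ _ := hg (i, j) in h.
have hgS i j := let: And3 _ h _ := hg (i, j) in h.
have hgn i j := let: And3 _ _ h := hg (i, j) in h.
rewrite /U_Fourier_trapezoidal addrAC.
rewrite (@J0_trapezoidalE (fun i j => g (i, j) 0) (fun i j => hgn i j 0)).
have -> : Fourier_neq0 Lx Ly alpha q r (trapezoidal d) = (2 * alpha * Lx * Ly)^-1%:C *
    (d%:C * (\sum_i \sum_j (q i * q j)%:C * (S (i, j) - g (i, j) 0))).
  congr (_ * _); rewrite mulr_sumr; apply: eq_bigr => i _.
  rewrite mulr_sumr; apply: eq_bigr => j _; rewrite mulrCA; congr (_ * _).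
  exact: sum_neq0_trapezoidal (hgS i j) (hgn i j).
rewrite -mulrDr -mulrDr [RHS]addrAC; congr (_ - _).
rewrite (_ : _ + (_ + _) = (4 * alpha ^+ 2)%:C * (dipole ^+ 2)%:C +
  \sum_i \sum_j (q i * q j)%:C * S (i, j)); last first.
  rewrite addrCA -rmorphM; congr (_ + _); rewrite -big_split; apply: eq_bigr => i _.
  by rewrite /= -big_split; apply: eq_bigr => j _; rewrite /= -mulrDr subrK.
have -> : U_Ewald3D Lx Ly alpha q r Lz = (2 * pi / (Lx * Ly * Lz))%:C *
    ((4 * alpha ^+ 2)^-1%:C * \sum_i \sum_j (q i * q j)%:C * S (i, j)).
  congr (_ * _); apply: has_csumE.
  have h1 : has_csum (fun p => (4 * alpha ^+ 2)^-1%:C *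
      (\sum_i \sum_j (q i * q j)%:C * lattice_wave (r i - r j) p))
      ((4 * alpha ^+ 2)^-1%:C * \sum_i \sum_j (q i * q j)%:C * S (i, j)).
    apply: has_csumZ; apply: has_csum_sum => i; apply: has_csum_sum => j; apply: has_csumZ.
    exact: (hW i j).
  have := has_csum_neq0 h1.
  rewrite [X in _ - X](_ : _ = 0) ?subr0; last first.
    rewrite big1 ?mulr0// => i _; rewrite big1// => j _; by rewrite lattice_wave0 mulr0.
  apply: eq_has_csum => p; case: ifP => // _ /=.
  rewrite lattice_weightE sqr_norm_structure_factor rmorphM -mulrA; congr (_ * _).
  rewrite mulr_sumr; apply: eq_bigr => i _; rewrite mulr_sumr; apply: eq_bigr => j _.
  by rewrite /lattice_wave dotBr [RHS]mulrCA; congr (_ * _); rewrite mulrC.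
set Q := \sum_i _.
have a2 : 4 * alpha ^+ 2 != 0 by rewrite mulf_neq0// expf_neq0// gt_eqF.
have hc : (2 * alpha * Lx * Ly)^-1 * d = 2 * pi / (Lx * Ly * Lz) / (4 * alpha ^+ 2).
  rewrite /trapezoidal_mesh; move: (pi : R) => p; field.
  by rewrite !gt_eqF.
have hC : (2 * alpha * Lx * Ly)^-1%:C * d%:C =
    (2 * pi / (Lx * Ly * Lz))%:C * (4 * alpha ^+ 2)^-1%:C by rewrite -rmorphM/= hc rmorphM.
rewrite mulrA hC -mulrA [X in _ * X]mulrDr mulrDr [RHS]addrC /U_IBC -/dipole.
by congr (_ + _); rewrite -!rmorphM/= mulKf.
Qed.

End ewald3d.

(** * Error terms *)

Section elc_weight.
Context {R : realType}.

Lemma cosh_le (x y : R) : `|x| <= y -> 0 <= cosh x <= expR y.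
Proof.
rewrite ler_norml => /andP[x1 x2]; rewrite /cosh.
have : expR x <= expR y by rewrite ler_expR.
have : expR (- x) <= expR y by rewrite ler_expR; lra.
by have := expR_gt0 x; have := expR_gt0 (- x); lra.
Qed.

(** [(h - m) (L - H - 1) >= 0] splits [e^(-h (L - H))] into the decay [e^(-m (L - H))] at the
    minimal length [m] and a factor [e^(-h)] that remains for the sum over [h]. The denominator is
    handled by [h L >= m]. *)
Lemma elc_weight_bound (m h z H L : R) : 0 < m -> m <= h -> `|z| <= H -> H + 1 <= L ->
  `|h^-1 * (cosh (h * z) / (1 - expR (h * L)))| <=
  m^-1 * ((1 - expR (- m))^-1 * expR m) * expR (- (m * (L - H))) * expR (- h).
Proof.
move=> m0 mh zH HL; have h0 : 0 < h by exact: lt_le_trans mh.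
have H0 : 0 <= H by exact: le_trans zH.
have L1 : 1 <= L by rewrite (le_trans _ HL)// lerDr.
have hz : `|h * z| <= h * H by rewrite normrM gtr0_norm// ler_wpM2l// ltW.
have /andP[ch0 ch1] := cosh_le hz.
have mL : m <= h * L by rewrite -[m]mulr1; apply: ler_pM => //; exact: ltW.
have em1 : 0 < 1 - expR (- m) by rewrite subr_gt0 expR_lt1 oppr_lt0.
have eL : 0 < expR (h * L) - 1.
  by rewrite subr_gt0 expR_gt1 (lt_le_trans m0).
have q1 : h^-1 <= m^-1 by rewrite lef_pV2.
have q2 : (expR (h * L) - 1)^-1 <= ((1 - expR (- m)) * expR (h * L))^-1.
  rewrite lef_pV2 ?posrE ?mulr_gt0 ?expR_gt0//.
  rewrite mulrBl mul1r lerD2l lerN2 -expRD -[leLHS]expR0 ler_expR.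
  by rewrite addrC subr_ge0.
have q3 : expR (h * H) * (expR (h * L))^-1 <= expR m * expR (- (m * (L - H))) * expR (- h).
  have -> : (expR (h * L))^-1 = expR (- (h * L)) by rewrite expRN.
  rewrite -!expRD ler_expR.
  have : 0 <= (h - m) * (L - H - 1) by rewrite mulr_ge0 ?subr_ge0//; lra.
  by lra.
have -> : m^-1 * ((1 - expR (- m))^-1 * expR m) * expR (- (m * (L - H))) * expR (- h) =
    m^-1 * ((1 - expR (- m))^-1 * (expR m * expR (- (m * (L - H))) * expR (- h))).
  by ring.
rewrite normrM (gtr0_norm (x := h^-1)) ?invr_gt0//.
rewrite normrM (ger0_norm ch0) normfV distrC (gtr0_norm eL).
apply: ler_pM q1 _; [by rewrite invr_ge0 ltW|by rewrite divr_ge0// ltW|].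
apply: (@le_trans _ _ (expR (h * H) * ((1 - expR (- m)) * expR (h * L))^-1)).
  by apply: ler_pM ch1 q2 => //; rewrite invr_ge0 ltW.
by rewrite invfM mulrCA ler_pM2l// invr_gt0.
Qed.

End elc_weight.

(** * Trapezoidal error for the nonzero reciprocal vectors *)

Section reciprocal_error.
Local Open Scope complex_scope.
Context {R : realType}.
Notation normc := (@ComplexField.Normc.normc R).
Variables (Lx Ly alpha H : R).
Hypotheses (Lx_gt0 : 0 < Lx) (Ly_gt0 : 0 < Ly) (alpha_gt0 : 0 < alpha) (H_gt0 : 0 < H).
Notation d Lz := (trapezoidal_mesh alpha Lz).
Notation hnorm n := (enorm (hvec Lx Ly n)).

Lemma trapezoidal_Fourier_integrand (h z Lz : R) : 0 < h -> `|z| <= H ->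
  alpha * H + 2 <= alpha * Lz -> exists E,
  trapezoidal (d Lz) (Fourier_integrand alpha h z) =
  (ewald_transform (h / (2 * alpha)) (alpha * z)
   + 4 * pi * alpha * (cosh (h * z) / h / (expR (h * Lz) - 1)) + E)%:C /\
  `|E| <= ewald_constant * (expR (- (h / alpha)) * expR (- (alpha * Lz - alpha * H) ^+ 2)).
Proof.
move=> h0 zH HL; set a := h / (2 * alpha).
have a0 : 0 < a by rewrite divr_gt0// mulr_gt0.
have zH' w : `|w| <= H -> `|alpha * w| <= alpha * H.
  by move=> wH; rewrite normrM gtr0_norm// ler_pM2l.
have H0 : `|0 : R| <= H by rewrite normr0 ltW.
have [E [hE bE]] := ewald_trapezoidal_sum a0 (zH' z zH) HL.
(* At [z = 0] the cosine is 1, so this case gives the absolute summability of the weights, and with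
   it the existence of the complex sum. *)
have [E0 [hE0 _]] := ewald_trapezoidal_sum a0 (zH' 0 H0) HL.
set p := pi / (alpha * Lz) in hE hE0.
have aL0 : 0 < alpha * Lz by have := mulr_gt0 alpha_gt0 H_gt0; lra.
have p0 : 0 < p by rewrite divr_gt0 ?pi_gt0.
have w0 (n : int) : 0 <= p * ewald_weight a (n%:~R * p).
  by rewrite mulr_ge0 ?ewald_weight_ge0// ltW.
have wE (n : int) : p * (ewald_weight a (n%:~R * p) * cos (2 * (alpha * 0) * (n%:~R * p))) =
    p * ewald_weight a (n%:~R * p) by rewrite !mulr0 mul0r cos0 mulr1.
have {wE}hE0 := eq_has_sum wE hE0.
have [s [hs _]] := has_csum_expi (fun n : int => 2 * (alpha * z) * (n%:~R * p))
  (has_sum_abs_bounded w0 hE0).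
have sE : trapezoidal (d Lz) (Fourier_integrand alpha h z) = s.
  rewrite (@trapezoidalE _ _ _ ((d Lz)^-1%:C * s)).
    by rewrite mulrA -rmorphM/= mulfV ?mul1r// gt_eqF.
  have := has_csumZ (d Lz)^-1%:C hs; apply: eq_has_csum => n.
  rewrite Fourier_integrand_weight// mulrCA [n%:~R * _]mulrC; congr (_ * _).
  by rewrite -rmorphM/= mulKf// gt_eqF.
exists E; split; last first.
  by move: bE; rewrite (_ : 2 * a = h / alpha)// /a; field; rewrite gt_eqF.
rewrite sE; move: hs => [hRe hIm]; apply/eqP; rewrite eq_complex/=; apply/andP; split; apply/eqP.
  have {}hRe : has_sum (fun n : int => p * (ewald_weight a (n%:~R * p) *
      cos (2 * (alpha * z) * (n%:~R * p)))) (complex.Re s).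
    by apply: eq_has_sum hRe => n; rewrite Re_mul/=; ring.
  rewrite (has_sum_unique hRe hE); congr (_ + _ + _).
  rewrite (_ : 2 * a * (alpha * z) = h * z); last by rewrite /a; field; rewrite gt_eqF.
  rewrite (_ : 2 * a * (alpha * Lz) = h * Lz); last by rewrite /a; field; rewrite gt_eqF.
  rewrite /a; move: (cosh _) (_ - 1)^-1 (pi : R) => c e q; field.
  by rewrite !gt_eqF.
apply: has_sum_odd hIm => n /=.
by rewrite !mulr0 !add0r mulrNz mulNr mulrN sinN mulNr /ewald_weight sqrrN.
Qed.

Definition elc_term (Lz : R) (u : 'rV[R]_3) (n : int * int) : R :=
  if n == 0 then 0 else
  (hnorm n)^-1 * (cosh (hnorm n * zcoord u) / (1 - expR (hnorm n * Lz))).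

Lemma elc_term_bound : exists K, forall Lz : R, H + 1 <= Lz -> forall u : 'rV[R]_3,
  `|zcoord u| <= H -> abs_bounded (elc_term Lz u)
     (K * expR (- (2 * pi * (Lz - H) / Num.max Lx Ly))).
Proof.
pose m := 2 * pi / Num.max Lx Ly.
have m0 : 0 < m by rewrite divr_gt0 ?mulr_gt0 ?pi_gt0// lt_max Lx_gt0.
have [M BM] := abs_bounded_expR_hvec Lx_gt0 Ly_gt0 (ltr01 : 0 < 1 :> R).
pose c := m^-1 * ((1 - expR (- m))^-1 * expR m).
have em : expR (- m) < 1 by rewrite expR_lt1 oppr_lt0.
have c0 : 0 <= c by rewrite !mulr_ge0 ?invr_ge0 ?expR_ge0 ?subr_ge0// ltW.
exists (c * M) => Lz HL u uH.
have -> : 2 * pi * (Lz - H) / Num.max Lx Ly = m * (Lz - H) by rewrite /m; ring.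
have := abs_boundedZ (c * expR (- (m * (Lz - H)))) BM.
have ce : 0 <= c * expR (- (m * (Lz - H))) by rewrite mulr_ge0// expR_ge0.
rewrite (ger0_norm ce) (mulrAC c M); apply: abs_bounded_le => n.
rewrite /elc_term; case: eqVneq => [_|n0]; first by rewrite normr0.
have mh := enorm_hvec_min Lx_gt0 Ly_gt0 n0; rewrite -/m in mh.
rewrite mul1r (ger0_norm (mulr_ge0 ce (expR_ge0 _))).
exact: elc_weight_bound.
Qed.

Lemma has_csum_elc : exists K, forall Lz : R, H + 1 <= Lz -> forall u : 'rV[R]_3,
  `|zcoord u| <= H -> exists s,
    has_csum (fun n => expi (dot (hvec Lx Ly n) u) * (elc_term Lz u n)%:C) s /\
    normc s <= K * expR (- (2 * pi * (Lz - H) / Num.max Lx Ly)).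
Proof.
have [K hK] := elc_term_bound; exists (2 * K) => Lz HL u uH.
have [s [hs bs]] := has_csum_expi (fun n => dot (hvec Lx Ly n) u) (hK Lz HL u uH).
by exists s; rewrite -mulrA.
Qed.

Lemma sum_neq0_elc Lz u s :
  has_csum (fun n => expi (dot (hvec Lx Ly n) u) * (elc_term Lz u n)%:C) s ->
  sum_neq0 (fun n : int * int =>
    expi (dot (hvec Lx Ly n) u) / (hnorm n)%:C *
    (cosh (hnorm n * zcoord u) / (1 - expR (hnorm n * Lz)))%:C) = s.
Proof.
move=> hs; apply: has_csumE; apply: eq_has_csum hs => n; rewrite /elc_term.
by case: ifP => _; rewrite ?mulr0// rmorphM fmorphV/= mulrA.
Qed.

(** The factor [e^(-h / alpha)] in the error for each [h] makes the errors summable, with [K]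
    independent of [Lz] and [u]. The ELC sum enters with a plus sign because [1 - e^(h Lz)] is
    negative. *)
Lemma reciprocal_trapezoidal_error : exists K, forall Lz : R,
  H + 1 <= Lz -> alpha * H + 2 <= alpha * Lz -> forall u : 'rV[R]_3, `|zcoord u| <= H ->
  exists e,
  sum_neq0 (fun n => expi (dot (hvec Lx Ly n) u) *
    Cintegral setT (Fourier_integrand alpha (hnorm n) (zcoord u))) =
  sum_neq0 (fun n => expi (dot (hvec Lx Ly n) u) *
    trapezoidal (d Lz) (Fourier_integrand alpha (hnorm n) (zcoord u)))
  + (4 * pi * alpha)%:C * sum_neq0 (fun n : int * int =>
    expi (dot (hvec Lx Ly n) u) / (hnorm n)%:C *
    (cosh (hnorm n * zcoord u) / (1 - expR (hnorm n * Lz)))%:C) + e /\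
  normc e <= K * expR (- (alpha * Lz - alpha * H) ^+ 2).
Proof.
have ia0 : 0 < alpha^-1 by rewrite invr_gt0.
have [M BM] := abs_bounded_expR_hvec Lx_gt0 Ly_gt0 ia0.
have [K hK] := has_csum_elc.
exists (2 * (ewald_constant * M)) => Lz HL aHL u uH.
set W := expR _.
have Lz0 : 0 < Lz by rewrite (lt_le_trans _ HL)// addr_gt0.
have /choice[E hE] n : exists E, n != 0 ->
   trapezoidal (d Lz) (Fourier_integrand alpha (hnorm n) (zcoord u)) =
     Cintegral setT (Fourier_integrand alpha (hnorm n) (zcoord u))
     - (4 * pi * alpha)%:C * (elc_term Lz u n)%:C + E%:C /\
   `|E| <= ewald_constant * (expR (- (alpha^-1 * hnorm n)) * W).
  have [n0|n0] := eqVneq n 0; first by exists 0.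
  have h0 := enorm_hvec_gt0 Lx_gt0 Ly_gt0 n0.
  have [E [-> hE]] := trapezoidal_Fourier_integrand h0 uH aHL.
  exists E => _; split; last by rewrite mulrC -mulrC; move: hE; rewrite [_ / alpha]mulrC.
  rewrite Cintegral_Fourier_integrand// -rmorphM -rmorphB -rmorphD/=; congr (_ + _ + _)%:C.
  rewrite /elc_term ifN// -(opprB 1) invrN; ring.
pose E' n := if n == 0 then 0 else E n.
have BE : abs_bounded E' (ewald_constant * M * W).
  have ec := @ewald_constant_ge0 R.
  have := abs_boundedZ (ewald_constant * W) BM.
  have cW : 0 <= ewald_constant * W by rewrite mulr_ge0 ?expR_ge0.
  rewrite (ger0_norm cW) (mulrAC ewald_constant M); apply: abs_bounded_le => n.
  rewrite /E'; case: eqVneq => [_|n0]; first by rewrite normr0.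
  rewrite (ger0_norm (mulr_ge0 cW (expR_ge0 _))) -mulrA (mulrC W).
  by have [] := hE n n0.
have [e [he be]] := has_csum_expi (fun n => dot (hvec Lx Ly n) u) BE.
have [s [hs _]] := hK Lz HL u uH.
have [S [g [_ gS hg]]] := has_csum_lattice_wave Lx_gt0 Ly_gt0 Lz0 alpha_gt0 u.
exists (- e); split; last first.
  rewrite (_ : normc (- e) = normc e); last by case: (e) => x y; rewrite /= !sqrrN.
  by rewrite -[leRHS]mulrA.
rewrite (sum_neq0_elc hs).
rewrite (sum_neq0_trapezoidal Lz0 alpha_gt0 gS hg); apply: has_csumE.
have h1 := has_csum_neq0 (has_csumZ (d Lz)%:C gS).
(* The sum of the exact integrals is never bounded directly: it converges because it is a
   combination of three convergent sums. *)
have := has_csumD (has_csumD h1 (has_csumZ (4 * pi * alpha)%:C hs)) (has_csumN he).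
rewrite -mulrBr; apply: eq_has_csum => n.
rewrite /E'; case: eqVneq => [->|n0]; first by rewrite /elc_term eqxx !mulr0 addr0 subr0.
rewrite -(trapezoidal_wave Lz0 alpha_gt0 (hg n)).
have [-> _] := hE n n0; ring.
Qed.

End reciprocal_error.

(** * The mode [h = 0] as a limit *)

Section zero_mode.
Context {R : realType}.
Notation mu := (@lebesgue_measure R).
Notation RT := (measurableTypeR R).

(** The kernel at [v] minus the kernel at 0. The factor [cos - 1], of order [t^2], compensates the
    pole of the weight at [a = 0] and gives bounds independent of [a]. *)
Definition zero_mode (a v t : R) : R := ewald_weight a t * (cos (2 * v * t) - 1).

(** For [a = 0] the continuous extension at 0 would be [-2 v^2]. The node missing from the
    trapezoidal sum, of weight [pi / L], accounts for the term [2 pi v^2 / L] in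
    [zero_mode_trapezoidal]. *)
Lemma zero_mode_t0 (a v : R) : zero_mode a v 0 = 0.
Proof. by rewrite /zero_mode mulr0 cos0 subrr mulr0. Qed.

Lemma zero_mode_le (a v t : R) : `|zero_mode a v t| <= 2 * v ^+ 2 * expR (- t ^+ 2).
Proof.
have v20 := sqr_ge0 v; have a20 := sqr_ge0 a.
have [->|t0] := eqVneq t 0.
  by rewrite zero_mode_t0 normr0 mulr_ge0 ?expR_ge0// mulr_ge0.
have t2 : 0 < t ^+ 2 by rewrite exprn_even_gt0.
have /andP[c1 c2] := one_sub_cos_bound (2 * v * t).
have w0 := ewald_weight_ge0 a t.
rewrite /zero_mode normrM (ger0_norm w0) distrC (ger0_norm c1).
have w : ewald_weight a t <= expR (- t ^+ 2) / t ^+ 2.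
  have at2 : 0 < a ^+ 2 + t ^+ 2 by rewrite ltr_wpDl.
  apply: ler_pM; [exact: expR_ge0|by rewrite invr_ge0 ltW|by rewrite ler_expR; lra|].
  by rewrite lef_pV2 ?posrE// lerDr.
apply: (le_trans (ler_pM w0 c1 w c2)).
by rewrite le_eqVlt; apply/orP; left; apply/eqP; field.
Qed.

Lemma zero_modeE (v t : R) :
  zero_mode 0 v t = expR (- t ^+ 2) * (cos (2 * v * t) - 1) / t ^+ 2.
Proof. by rewrite /zero_mode /ewald_weight expr0n oppr0 !add0r mulrAC. Qed.

Lemma measurable_zero_mode (a v : R) : 0 <= a -> measurable_fun (setT : set RT) (zero_mode a v).
Proof.
rewrite le_eqVlt => /predU1P[<-|a0].
  rewrite (funext (zero_modeE v)); apply: measurable_div_sqr; continuity.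
apply: continuous_measurable_fun => t; apply: cvgM; first exact: continuous_ewald_weight.
by move: t; continuity.
Qed.

Lemma zero_mode_le_lorentz (a v t : R) : `|zero_mode a v t| <= 2 * v ^+ 2 / (1 + t ^+ 2).
Proof.
apply: le_trans (zero_mode_le a v t) _; rewrite ler_wpM2l ?expRN_le_lorentz//.
by rewrite mulr_ge0 ?sqr_ge0.
Qed.

Lemma integrable_zero_mode (a v : R) : 0 <= a -> mu.-integrable setT (EFin \o zero_mode a v).
Proof.
move=> a0; apply: (@integrable_dominated _ _ _ (2 * v ^+ 2)) => //.
  exact: measurable_zero_mode.
exact: zero_mode_le_lorentz.
Qed.

Lemma ewald_transformB0 (a v : R) : 0 < a ->
  ewald_transform a v - ewald_transform a 0 = \int[mu]_t zero_mode a v t.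
Proof.
move=> a0; rewrite /ewald_transform -RintegralB//.
- apply: eq_Rintegral => t _; rewrite /zero_mode mulr0 mul0r cos0; ring.
- by apply: integrable_ewald => //; [continuity|move=> t; exact: cos_max].
- by apply: integrable_ewald => //; [continuity|move=> t; exact: cos_max].
Qed.

(** The second integral does not depend on [v], so it disappears from [J0] by neutrality. *)
Lemma Rintegral_pv_weight (v : R) :
  \int[mu]_t pv_weight v t = \int[mu]_t zero_mode 0 v t + \int[mu]_t pv_weight 0 t.
Proof.
rewrite -RintegralD//; [|exact: integrable_zero_mode|exact: integrable_pv_weight].
apply: eq_Rintegral => t _; rewrite zero_modeE /pv_weight -mulrDl.
by congr (_ / _); rewrite mulr0 mul0r cos0; ring.
Qed.

Lemma cvg_zero_mode (u : R^nat) (v t : R) : u @ \oo --> 0 ->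
  zero_mode (u k) v t @[k --> \oo] --> zero_mode 0 v t.
Proof.
move=> u0; have [->|t0] := eqVneq t 0.
  by under eq_fun do rewrite zero_mode_t0; rewrite zero_mode_t0; exact: cvg_cst.
apply: cvgM; last exact: cvg_cst.
have u2 : u k ^+ 2 @[k --> \oo] --> (0 : R) ^+ 2 by exact: cvgM.
apply: cvgM.
  apply: continuous_cvg; first exact: continuous_expR.
  by apply: cvgB; [exact: cvgN|exact: cvg_cst].
apply: cvgV; first by rewrite expr0n add0r expf_neq0.
by apply: cvgD => //; exact: cvg_cst.
Qed.

(** Since [cosh (2 x v) - 1] is [(e^(x v) - e^(-x v))^2 / 2], the expression is built from two
    difference quotients of first order. *)
Lemma cvg_cosh_ratio (u : R^nat) (v L : R) : 0 < L -> u @ \oo --> 0 -> (forall k, u k != 0) ->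
  2 * pi / u k * (cosh (2 * u k * v) - 1) / (expR (2 * u k * L) - 1) @[k --> \oo]
    --> 2 * pi * v ^+ 2 / L.
Proof.
move=> L0 u0 un0.
have hu (f : R -> R) (l : R) : f x / x @[x --> 0^'] --> l -> f (u k) / u k @[k --> \oo] --> l.
  by move=> /(cvgr_dnbhsP (fun x => f x / x) 0 l) h; apply: h; split.
have d1 : (expR (x * v) - expR (- (x * v))) / x @[x --> 0^'] --> 2 * v.
  apply: derive_quotient; last by rewrite mul0r oppr0 subrr.
  by derive; rewrite mul0r oppr0 expR0; ring.
have d2 : (expR (2 * x * L) - 1) / x @[x --> 0^'] --> 2 * L.
  apply: derive_quotient; last by rewrite mulr0 mul0r expR0 subrr.
  by derive; rewrite mulr0 mul0r expR0; ring.
have -> : 2 * pi * v ^+ 2 / L = pi * (2 * v) ^+ 2 / (2 * L).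
  by move: (pi : R) => p; field; rewrite gt_eqF.
have -> : (fun k => 2 * pi / u k * (cosh (2 * u k * v) - 1) / (expR (2 * u k * L) - 1)) =
    (fun k => pi * ((expR (u k * v) - expR (- (u k * v))) / u k) ^+ 2 *
      ((expR (2 * u k * L) - 1) / u k)^-1).
  apply/funext => k; have := un0 k; move: (u k) => x x0.
  rewrite invf_div /cosh.
  have -> : 2 * x * v = x * v + x * v by ring.
  rewrite opprD !expRD; have := expRxMexpNx_1 (x * v).
  move: (expR (x * v)) (expR (- (x * v))) ((expR (2 * x * L) - 1)^-1) (pi : R) => e f g p ef.
  have -> : (e * e + f * f) / 2 - 1 = (e - f) ^+ 2 / 2 + (e * f - 1) by field.
  rewrite ef subrr addr0.
  by field.
apply: cvgM.
  apply: cvgM; first exact: cvg_cst.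
  by apply: cvgM; exact: hu d1.
apply: cvgV; first by rewrite mulf_neq0// gt_eqF.
exact: hu d2.
Qed.

(* [ewald_trapezoidal_sum] at [v] minus the same at [0], in the limit [a -> 0]: each
   of the two diverges as [a -> 0]. *)
Lemma zero_mode_trapezoidal (v L H : R) : 0 <= H -> `|v| <= H -> H + 2 <= L -> exists T,
  has_sum (fun n : int => pi / L * zero_mode 0 v (n%:~R * (pi / L))) T /\
  `|T - \int[mu]_t zero_mode 0 v t - 2 * pi * v ^+ 2 / L|
     <= 2 * ewald_constant * expR (- (L - H) ^+ 2).
Proof.
move=> H0 vH HL; have L0 : 0 < L by lra.
set p := pi / L; have p0 : 0 < p by rewrite divr_gt0 ?pi_gt0.
have p2 : 0 < p ^+ 2 by rewrite exprn_gt0.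
have v20 := sqr_ge0 v.
(* A majorant independent of [a], as [tannery] requires, obtained from [n^2 >= |n|] in the
   Gaussian. *)
pose G (n : int) := p * (2 * v ^+ 2 * expR (- (p ^+ 2 * `|n|%N%:R))).
have FG a n : `|p * zero_mode a v (n%:~R * p)| <= G n.
  rewrite normrM (gtr0_norm p0) ler_pM2l// (le_trans (zero_mode_le _ _ _))//.
  have v2 : 0 <= 2 * v ^+ 2 by rewrite mulr_ge0.
  apply: (ler_wpM2l v2); rewrite ler_expR lerN2 [leRHS]exprMn [leRHS]mulrC (ler_pM2l p2).
  exact: natr_absz_le_sqr.
have := abs_boundedZ (p * (2 * v ^+ 2)) (abs_bounded_expR_absz p2).
set M := `|_| * _ => BG'.
have BG : abs_bounded G M.
  by apply: abs_bounded_le BG' => n; rewrite /G mulrA.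
have [T [hT _]] : exists T, has_sum (fun n : int => p * zero_mode 0 v (n%:~R * p)) T /\ `|T| <= M.
  apply: abs_bounded_has_sum; apply: abs_bounded_le BG => n.
  by apply: le_trans (FG 0 n) _; exact: ler_norm.
exists T; split=> //.
pose u : R^nat := harmonic.
have u_gt0 k : 0 < u k by exact: harmonic_gt0.
have u0 : u @ \oo --> 0 by exact: cvg_harmonic.
pose X k := 2 * pi / u k * (cosh (2 * u k * v) - 1) / (expR (2 * u k * L) - 1).
have /choice[E hE] k : exists E, has_sum (fun n : int => p * zero_mode (u k) v (n%:~R * p))
    (\int[mu]_t zero_mode (u k) v t + X k + E) /\
    `|E| <= 2 * ewald_constant * expR (- (L - H) ^+ 2).
  have [E1 [h1 b1]] := ewald_trapezoidal_sum (u_gt0 k) vH HL.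
  have H0' : `|0 : R| <= H by rewrite normr0.
  have [E2 [h2 b2]] := ewald_trapezoidal_sum (u_gt0 k) H0' HL.
  exists (E1 - E2); split.
    have := has_sumB h1 h2; rewrite -ewald_transformB0// /X.
    rewrite (_ : cosh (2 * u k * 0) = 1); last by rewrite /cosh mulr0 oppr0 expR0; field.
    set s := _ + E1 - _; set s' := _ + (E1 - E2).
    have -> : s = s' by rewrite /s /s'; ring.
    by apply: eq_has_sum => n; rewrite mulr0 mul0r cos0 /zero_mode -/p; ring.
  rewrite (le_trans (ler_normB _ _))//.
  have b (x : R) : `|x| <= ewald_constant * (expR (- (2 * u k)) * expR (- (L - H) ^+ 2)) ->
      `|x| <= ewald_constant * expR (- (L - H) ^+ 2).
    move=> /le_trans; apply; rewrite ler_wpM2l ?ewald_constant_ge0//.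
    by rewrite ler_piMl ?expR_ge0// -[leRHS]expR0 ler_expR oppr_le0 mulr_ge0// ltW.
  by have := b _ b1; have := b _ b2; lra.
have cS : (\int[mu]_t zero_mode (u k) v t + X k + E k) @[k --> \oo] --> T.
  apply: (tannery BG (fun k => FG (u k)) _ (fun k => (hE k).1) hT) => n.
  by apply: cvgM; [exact: cvg_cst|exact: cvg_zero_mode].
have cI : \int[mu]_t zero_mode (u k) v t @[k --> \oo] --> \int[mu]_t zero_mode 0 v t.
  apply: (@dominated_cvg_Rintegral _ _ _ _ (fun t => 2 * v ^+ 2 / (1 + t ^+ 2))) => //.
  - by move=> k; apply: measurable_zero_mode; exact: ltW.
  - by move=> t _; exact: cvg_zero_mode.
  - apply: (@integrableMl_const _ _ (fun t => (1 + t ^+ 2)^-1)) => //.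
    exact: integrable_lorentz.
  - by move=> k t _; exact: zero_mode_le_lorentz.
have cX : X k @[k --> \oo] --> 2 * pi * v ^+ 2 / L.
  by apply: cvg_cosh_ratio => // k; rewrite gt_eqF.
have cE : `|E k| @[k --> \oo] --> `|T - \int[mu]_t zero_mode 0 v t - 2 * pi * v ^+ 2 / L|.
  apply: cvg_norm.
  have -> : E = (fun k => (\int[mu]_t zero_mode (u k) v t + X k + E k) -
      \int[mu]_t zero_mode (u k) v t - X k) by apply/funext => k; ring.
  by apply: cvgB => //; exact: cvgB.
by apply: (cvg_le cE); apply: nearW => k; exact: (hE k).2.
Qed.

End zero_mode.

(** * Sums over pairs of charges, and neutrality *)

Section pair_sums.
Local Open Scope complex_scope.
Context {R : realType}.
Notation normc := (@ComplexField.Normc.normc R).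
Variables (N : nat) (q : 'I_N -> R).

Lemma normc_real (x : R) : normc x%:C = `|x|.
Proof. by rewrite /= expr0n addr0 sqrtr_sqr. Qed.

Lemma normcD (x y : R[i]) : normc (x + y) <= normc x + normc y.
Proof.
have E (z : R[i]) : `|z| = (normc z)%:C by [].
by have := ler_normD x y; rewrite !E -(rmorphD (real_complex R)) lecR.
Qed.

Lemma normcM (x y : R[i]) : normc (x * y) = normc x * normc y.
Proof. exact: ComplexField.Normc.normcM. Qed.

Lemma normc_sum (I : Type) (s : seq I) (F : I -> R[i]) :
  normc (\sum_(i <- s) F i) <= \sum_(i <- s) normc (F i).
Proof.
elim: s => [|i s IH]; first by rewrite !big_nil normc_real normr0.
by rewrite !big_cons (le_trans (normcD _ _))// lerD2l.
Qed.

Definition abs_pair_sum : R := \sum_i \sum_j `|q i * q j|.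

Lemma normc_pair_sum (s : 'I_N -> 'I_N -> R[i]) B : (forall i j, normc (s i j) <= B) ->
  normc (\sum_i \sum_j (q i * q j)%:C * s i j) <= abs_pair_sum * B.
Proof.
move=> sB; rewrite (le_trans (normc_sum _ _))// /abs_pair_sum mulr_suml ler_sum// => i _.
rewrite (le_trans (normc_sum _ _))// mulr_suml ler_sum// => j _.
by rewrite normcM normc_real ler_wpM2l.
Qed.

Hypothesis neutral : \sum_i q i = 0.

Lemma pair_sum_cst c : \sum_i \sum_j q i * q j * c = 0.
Proof.
transitivity ((\sum_i \sum_j q i * q j) * c); last by rewrite sum_qq_eq0 ?mul0r.
by rewrite mulr_suml; apply: eq_bigr => i _; rewrite mulr_suml.
Qed.

(** Neutrality kills the two pure squares of the expansion. The terms [2 pi v^2 / L] of the zero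
    mode thereby cancel the contribution of the node 0 to [J0_trapezoidal]. *)
Lemma pair_sum_sqrB (z : 'I_N -> R) :
  \sum_i \sum_j q i * q j * (z i - z j) ^+ 2 = - 2 * (\sum_i q i * z i) ^+ 2.
Proof.
set P := \sum_i q i * z i.
transitivity (\sum_i (q i * z i ^+ 2 * (\sum_j q j) + q i * (\sum_j q j * z j ^+ 2)
  - 2 * (q i * z i) * P)).
  apply: eq_bigr => i _; rewrite /P !mulr_sumr -big_split -sumrB.
  by apply: eq_bigr => j _ /=; ring.
rewrite neutral sumrB big_split/= [X in X + _ - _]big1 ?add0r => [|i _]; last by rewrite mulr0.
rewrite -mulr_suml neutral mul0r sub0r -mulr_suml -mulr_sumr -/P; ring.
Qed.

End pair_sums.

Section zero_mode_error.
Local Open Scope complex_scope.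
Context {R : realType}.
Notation mu := (@lebesgue_measure R).
Notation normc := (@ComplexField.Normc.normc R).
Variables (Lx Ly alpha H : R) (N : nat) (q : 'I_N -> R) (r : 'I_N -> 'rV[R]_3).
Hypotheses (Lx_gt0 : 0 < Lx) (Ly_gt0 : 0 < Ly) (alpha_gt0 : 0 < alpha) (H_gt0 : 0 < H).
Hypothesis neutral : \sum_i q i = 0.
Hypothesis zdiff_le : forall i j, `|zdiff r i j| <= H.

Lemma pair_sumC (s : 'I_N -> 'I_N -> R) :
  \sum_i \sum_j (q i * q j)%:C * (s i j)%:C = (\sum_i \sum_j q i * q j * s i j)%:C.
Proof.
rewrite rmorph_sum; apply: eq_bigr => i _; rewrite rmorph_sum; apply: eq_bigr => j _.
by rewrite -rmorphM.
Qed.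

Lemma J0E : J0 Lx Ly alpha q r = ((2 * alpha * Lx * Ly)^-1 *
  \sum_i \sum_j q i * q j * \int[mu]_t zero_mode 0 (alpha * zdiff r i j) t)%:C.
Proof.
rewrite /J0 (eq_bigr (fun i => \sum_j (q i * q j)%:C *
    (\int[mu]_t pv_weight (alpha * zdiff r i j) t)%:C)); last first.
  by move=> i _; apply: eq_bigr => j _; rewrite pv_integral_J0.
rewrite pair_sumC -rmorphM/=; congr (_ * _)%:C.
under eq_bigr do under eq_bigr do rewrite Rintegral_pv_weight mulrDr.
under eq_bigr do rewrite big_split/=.
by rewrite big_split/= pair_sum_cst// addr0.
Qed.

(** The wave is split into the zero mode and the kernel at [v = 0], whose sum [c] does not depend on
    [u] and is later removed by neutrality. *)
Lemma has_csum_lattice_wave_zero (Lz T c : R) (u : 'rV[R]_3) : 0 < Lz ->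
  let p := trapezoidal_mesh alpha Lz in
  has_sum (fun n : int => p * zero_mode 0 (alpha * zcoord u) (n%:~R * p)) T ->
  has_sum (fun n : int => p * ewald_weight 0 (n%:~R * p)) c ->
  has_csum (fun m => lattice_wave Lx Ly Lz alpha u (0, m)) (p^-1 * (T + c))%:C.
Proof.
move=> Lz0 p hT hc.
have p0 : 0 < p by rewrite divr_gt0 ?pi_gt0// mulr_gt0.
have [_ [g [_ _ /(_ 0)]]] := has_csum_lattice_wave Lx_gt0 Ly_gt0 Lz0 alpha_gt0 u.
have E m : lattice_wave Lx Ly Lz alpha u (0, m) =
    expi (2 * (alpha * zcoord u) * (m%:~R * p)) * (ewald_weight 0 (m%:~R * p))%:C.
  rewrite -Fourier_integrand_wave// Fourier_integrand_weight// enorm_hvec0 mul0r.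
  rewrite dot_hvec/= !mul0r !mulr0 !mul0r addr0 expi0 mul1r [_ * m%:~R]mulrC.
  by [].
rewrite (funext E) => -[_ hIm]; split => /=.
  have := has_sumZ (c := p^-1) (has_sumD hT hc); apply: eq_has_sum => m.
  by rewrite mulr0 subr0 -mulrDr mulKf ?gt_eqF// /zero_mode; ring.
rewrite -[X in has_sum _ X](has_sum_odd _ hIm)//= => m.
by rewrite !mulr0 !add0r mulrNz mulNr mulrN sinN mulNr /ewald_weight sqrrN.
Qed.

Lemma J0_trapezoidal_error (Lz : R) : alpha * H + 2 <= alpha * Lz ->
  normc (J0 Lx Ly alpha q r - J0_trapezoidal Lx Ly alpha q r Lz) <=
  (2 * alpha * Lx * Ly)^-1 * (abs_pair_sum q *
    (2 * ewald_constant * expR (- (alpha * Lz - alpha * H) ^+ 2))).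
Proof.
move=> HL; set W := expR _.
have aH : 0 < alpha * H by rewrite mulr_gt0.
have aL : 0 < alpha * Lz by lra.
have Lz0 : 0 < Lz by rewrite -(pmulr_rgt0 _ alpha_gt0).
pose v ij := alpha * zdiff r ij.1 ij.2.
have vH ij : `|v ij| <= alpha * H by rewrite normrM gtr0_norm// ler_pM2l.
have [T hT] := choice (fun ij => zero_mode_trapezoidal (ltW aH) (vH ij) HL).
set p := pi / (alpha * Lz) in hT.
have [c hc] : exists c, has_sum (fun n : int => p * ewald_weight 0 (n%:~R * p)) c.
  have [M BM] := abs_bounded_lattice_weight Lx_gt0 Ly_gt0 Lz0 alpha_gt0.
  have [s [hs _]] := abs_bounded_has_sum (@abs_bounded_fiber _ _ _ _ _ (0 : int * int) BM).
  exists (p * s); have := has_sumZ (c := p) hs; apply: eq_has_sum => m.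
  by rewrite /lattice_weight/= enorm_hvec0 mul0r mulrC [X in ewald_weight _ X]mulrC mulrC.
have hg i j : has_csum (fun m => lattice_wave Lx Ly Lz alpha (r i - r j) (0, m))
    (p^-1 * (T (i, j) + c))%:C.
  exact: has_csum_lattice_wave_zero (hT (i, j)).1 hc.
have p0 : p != 0 by rewrite gt_eqF// divr_gt0 ?pi_gt0.
rewrite (J0_trapezoidalE Lz0 alpha_gt0 neutral hg) J0E pair_sumC.
have realE (x I B S : R) : (x * I)%:C - x%:C * (p%:C * (B%:C + S%:C)) = (x * (I - p * (B + S)))%:C.
  by apply/eqP; rewrite eq_complex/=; apply/andP; split; apply/eqP; ring.
rewrite -[trapezoidal_mesh _ _]/p realE normc_real normrM ger0_norm; last first.
  by rewrite invr_ge0 !mulr_ge0// ltW.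
apply: ler_wpM2l; first by rewrite invr_ge0 !mulr_ge0// ltW.
set A := _ - _.
have -> : A = - (\sum_i \sum_j q i * q j *
    (T (i, j) - \int[mu]_t zero_mode 0 (v (i, j)) t - 2 * pi * v (i, j) ^+ 2 / (alpha * Lz))).
  have E1 : \sum_i \sum_j q i * q j * (p^-1 * (T (i, j) + c)) =
      p^-1 * \sum_i \sum_j q i * q j * T (i, j).
    transitivity (\sum_i (\sum_j p^-1 * (q i * q j * T (i, j)) + \sum_j q i * q j * (p^-1 * c))).
      by apply: eq_bigr => i _; rewrite -big_split; apply: eq_bigr => j _ /=; ring.
    rewrite big_split/= pair_sum_cst// addr0 mulr_sumr; apply: eq_bigr => i _.
    by rewrite mulr_sumr.
  transitivity (- (\sum_i \sum_j q i * q j * T (i, j)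
    - \sum_i \sum_j q i * q j * \int[mu]_t zero_mode 0 (alpha * zdiff r i j) t
    - 2 * p * alpha ^+ 2 * \sum_i \sum_j q i * q j * (zcoord (r i) - zcoord (r j)) ^+ 2)).
    rewrite pair_sum_sqrB// -/(dipole q r) /A E1 mulrDr mulVKf//; ring.
  congr (- _); rewrite mulr_sumr -!sumrB; apply: eq_bigr => i _.
  rewrite mulr_sumr -!sumrB; apply: eq_bigr => j _.
  rewrite /v/= /zdiff zcoordB /p.
  have aL0 : alpha * Lz != 0 by rewrite gt_eqF.
  move: (\int[mu]_t _) (pi : R) => I x; move: aL0; rewrite mulf_eq0 negb_or => /andP[? ?].
  by field; apply/andP.
rewrite normrN -normc_real -pair_sumC; apply: normc_pair_sum => i j.
by rewrite normc_real; exact: (hT (i, j)).2.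
Qed.

End zero_mode_error.

(** * Error and ELC bounds summed over the pairs of charges *)

Section ewald2d.
Local Open Scope complex_scope.
Context {R : realType}.
Notation normc := (@ComplexField.Normc.normc R).
Variables (Lx Ly alpha H : R) (N : nat) (q : 'I_N -> R) (r : 'I_N -> 'rV[R]_3).
Hypotheses (Lx_gt0 : 0 < Lx) (Ly_gt0 : 0 < Ly) (alpha_gt0 : 0 < alpha) (H_gt0 : 0 < H).
Hypothesis zdiff_le : forall i j, `|zdiff r i j| <= H.

Lemma Fourier_neq0_error : exists K, forall Lz : R,
  H + 1 <= Lz -> alpha * H + 2 <= alpha * Lz -> exists e,
  Fourier_neq0 Lx Ly alpha q r (Cintegral setT) =
    Fourier_neq0 Lx Ly alpha q r (trapezoidal (trapezoidal_mesh alpha Lz))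
    + U_ELC Lx Ly q r Lz + e /\
  normc e <= K * expR (- (alpha * Lz - alpha * H) ^+ 2).
Proof.
have [K hK] := reciprocal_trapezoidal_error Lx_gt0 Ly_gt0 alpha_gt0 H_gt0.
exists (`|(2 * alpha * Lx * Ly)^-1| * (abs_pair_sum q * K)) => Lz HL aHL.
have [e he] := choice (fun ij => hK Lz HL aHL (r ij.1 - r ij.2) (zdiff_le ij.1 ij.2)).
exists ((2 * alpha * Lx * Ly)^-1%:C * \sum_i \sum_j (q i * q j)%:C * e (i, j)); split; last first.
  rewrite normcM normc_real -!mulrA ler_wpM2l// normc_pair_sum// => i j.
  exact: (he (i, j)).2.
have -> : U_ELC Lx Ly q r Lz = (2 * alpha * Lx * Ly)^-1%:C *
    \sum_i \sum_j (q i * q j)%:C * ((4 * pi * alpha)%:C * sum_neq0 (fun n : int * int =>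
      let h := enorm (hvec Lx Ly n) in
      expi (dot (hvec Lx Ly n) (r i - r j)) / h%:C *
      (cosh (h * zdiff r i j) / (1 - expR (h * Lz)))%:C)).
  rewrite /U_ELC (_ : 2 * pi / (Lx * Ly) = (2 * alpha * Lx * Ly)^-1 * (4 * pi * alpha)).
    rewrite (rmorphM (real_complex R)) -[LHS]mulrA; congr (_ * _).
    rewrite mulr_sumr; apply: eq_bigr => i _.
    by rewrite mulr_sumr; apply: eq_bigr => j _; rewrite mulrCA.
  by move: (pi : R) => p; field; rewrite !gt_eqF.
rewrite /Fourier_neq0 -!mulrDr -!big_split; congr (_ * _); apply: eq_bigr => i _.
rewrite /= -!big_split; apply: eq_bigr => j _ /=; rewrite -!mulrDr; congr (_ * _).
exact: (he (i, j)).1.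
Qed.

Lemma U_ELC_bound : exists K, forall Lz : R, H + 1 <= Lz ->
  normc (U_ELC Lx Ly q r Lz) <= K * expR (- (2 * pi * (Lz - H) / Num.max Lx Ly)).
Proof.
have [K hK] := has_csum_elc H Lx_gt0 Ly_gt0.
exists (`|2 * pi / (Lx * Ly)| * (abs_pair_sum q * K)) => Lz HL.
rewrite normcM normc_real -[leRHS]mulrA -[abs_pair_sum q * K * _]mulrA.
rewrite ler_wpM2l// normc_pair_sum// => i j.
have [s [hs bs]] := hK Lz HL (r i - r j) (zdiff_le i j).
by rewrite (sum_neq0_elc hs).
Qed.

End ewald2d.

Lemma eqO_pinfty_norm (R : realType) (f : R -> R[i]) (g : R -> R) (K a : R) :
  (forall x, 0 <= g x) -> (forall x, a <= x -> ComplexField.Normc.normc (f x) <= K * g x) ->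
  (fun x => ComplexField.Normc.normc (f x)) =O_+oo g.
Proof.
(* The constant of the O-relation has to be positive, which [K] need not be. *)
move=> g0 fg; apply/eqO_exP; exists (Num.max K 1); first by rewrite lt_max ltr01 orbT.
near=> x.
have n0 : 0 <= ComplexField.Normc.normc (f x).
  by have := normr_ge0 (f x); rewrite /Num.norm/= lecR.
rewrite (ger0_norm n0) (ger0_norm (g0 x)).
have ax : a <= x.
  by near: x; exists a; split; [exact: num_real|move=> y; exact: ltW].
by rewrite (le_trans (fg x ax))// ler_wpM2r// le_max lexx.
Unshelve. all: by end_near. Qed.

Local Open Scope complex_scope.

Theorem theorem2p1 (R : realType) (Lx Ly H alpha : R) (N : nat)
  (q : 'I_N -> R) (r : 'I_N -> 'rV[R]_3)
  (Lx_gt0 : 0 < Lx) (Ly_gt0 : 0 < Ly) (H_gt0 : 0 < H) (alpha_gt0 : 0 < alpha)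
  (rx : forall i, 0 <= xcoord (r i) <= Lx)
  (ry : forall i, 0 <= ycoord (r i) <= Ly)
  (rz : forall i, 0 < zcoord (r i) < H)
  (neutral : \sum_i q i = 0) :
  exists U_err : R -> R[i],
    [/\ (forall Lz : R, H <= Lz ->
           U_Fourier_trapezoidal Lx Ly alpha q r Lz =
             U_Ewald3D Lx Ly alpha q r Lz - (U_self alpha q)%:C
             + (U_IBC Lx Ly q r Lz)%:C),
        (forall Lz : R, H <= Lz ->
           U_Fourier Lx Ly alpha q r =
             U_Ewald3D Lx Ly alpha q r Lz - (U_self alpha q)%:C
             + (U_IBC Lx Ly q r Lz)%:C + U_ELC Lx Ly q r Lz + U_err Lz),
        (fun Lz : R => ComplexField.Normc.normc (U_ELC Lx Ly q r Lz)) =O_+oo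
          (fun Lz : R => expR (- (2 * pi * (Lz - H) / Num.max Lx Ly))) &
        (fun Lz : R => ComplexField.Normc.normc (U_err Lz)) =O_+oo
          (fun Lz : R => expR (- (alpha ^+ 2 * (Lz - H) ^+ 2)))].
Proof.
have zdiff_le i j : `|zdiff r i j| <= H.
  rewrite /zdiff zcoordB ler_norml; have := rz i; have := rz j; lra.
have eq1 (Lz : R) : H <= Lz -> _ := fun HL =>
  U_Fourier_trapezoidalE Lx_gt0 Ly_gt0 (lt_le_trans H_gt0 HL) alpha_gt0 r neutral.
(* The remainder is defined as a difference, so the decomposition holds for all [Lz >= H]; the
   content lies in its estimate for large [Lz]. *)
pose U_err Lz := U_Fourier Lx Ly alpha q r - (U_Ewald3D Lx Ly alpha q r Lz
  - (U_self alpha q)%:C + (U_IBC Lx Ly q r Lz)%:C) - U_ELC Lx Ly q r Lz.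
exists U_err; split => //.
- by move=> Lz _; rewrite /U_err; ring.
- have [K hK] := U_ELC_bound q Lx_gt0 Ly_gt0 zdiff_le.
  by apply: eqO_pinfty_norm hK => Lz; exact: expR_ge0.
have [K hK] := Fourier_neq0_error q Lx_gt0 Ly_gt0 alpha_gt0 H_gt0 zdiff_le.
(* The threshold combines [Lz >= H + 1], needed for the ELC sums, with [alpha (Lz - H) >= 2], needed
   for the asymptotics of the transform. *)
apply: (@eqO_pinfty_norm _ _ _ (K + (2 * alpha * Lx * Ly)^-1 *
  (abs_pair_sum q * (2 * ewald_constant))) (H + 1 + 2 / alpha)) => [Lz|Lz HL].
  exact: expR_ge0.
have ia : 0 < 2 / alpha by rewrite divr_gt0.
have HL1 : H + 1 <= Lz by lra.
have HL0 : H <= Lz by lra.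
have aHL : alpha * H + 2 <= alpha * Lz.
  have -> : alpha * H + 2 = alpha * (H + 2 / alpha) by field; rewrite gt_eqF.
  by rewrite ler_pM2l//; lra.
have [e [eE be]] := hK Lz HL1 aHL.
have bJ := J0_trapezoidal_error Lx_gt0 Ly_gt0 alpha_gt0 H_gt0 neutral zdiff_le aHL.
(* By the exact identity for the discretized energy, the remainder is the discretization error of
   the modes [h <> 0] beyond the ELC term, plus that of [J0]. *)
have -> : U_err Lz = e + (J0 Lx Ly alpha q r - J0_trapezoidal Lx Ly alpha q r Lz).
  by rewrite /U_err -eq1// /U_Fourier /U_Fourier_trapezoidal eE; ring.
have -> : alpha ^+ 2 * (Lz - H) ^+ 2 = (alpha * Lz - alpha * H) ^+ 2 by ring.
apply: (le_trans (normcD _ _)); move: be bJ; set W := expR _; lra.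
Qed.
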